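(* Let $K$ be a field. Each of the Lie superalgebra $\mathbf Q$, the associative algebra $\mathbf A$, and the Poisson superalgebra without unit $\mathbf P^o$ (and, when $\operatorname{char}K\ne2$, the Jordan superalgebras without unit $\mathbf J^o$ and $\mathbf K^o$) decomposes as a direct sum of two locally nilpotent subalgebras: $$\mathbf Q=\mathbf Q_+\oplus\mathbf Q_-,\quad\mathbf A=\mathbf A_+\oplus\mathbf A_-,\quad\mathbf P^o=\mathbf P_+\oplus\mathbf P_-,\quad\mathbf J^o=\mathbf J_+\oplus\mathbf J_-,\quad\mathbf K^o=\mathbf K_+\oplus\mathbf K_-,$$ and for each of these algebras there are continuum many different such decompositions.
   Context: $\Lambda$ is the Grassmann algebra over $K$ on odd $x_0,x_1,\dots$ ($x_i$ acting by left multiplication), $\partial_i$ the superderivation with $\partial_i(x_j)=\delta_{ij}$, $v_i=\sum_{k\ge0}\big(\prod_{n=0}^{k-1}x_{i+3n}x_{i+3n+1}\big)\partial_{i+3k}$. $\mathbf Q$ is the Lie subsuperalgebra of $(\operatorname{End}\Lambda)^{(-)}$ generated by $v_0,v_1,v_2$ (closed under squares of odd elements in characteristic $2$); $\mathbf A$ is the associative subalgebra of $\operatorname{End}\Lambda$ generated by $v_0,v_1,v_2$. $H_\infty=\Lambda(x_i,y_i\mid i\ge0)$ (odd generators) with Poisson bracket $\{y_i,x_j\}=\delta_{ij}$, $\{x_i,x_j\}=\{y_i,y_j\}=0$; $\widetilde H$ its completion by formal sums $c\cdot1+\sum\lambda_{\alpha,\beta}x^\alpha y^\beta$ over monomials with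 $\beta\ne0$ and (largest index in $\alpha$) $<$ (largest index in $\beta$); $V_i=\sum_{k\ge0}\big(\prod_{n=0}^{k-1}x_{i+3n}x_{i+3n+1}\big)y_{i+3k}$; $\mathbf P$ is the smallest unital subalgebra of $\widetilde H$ containing $V_0,V_1,V_2$ closed under product, bracket and (in characteristic $2$) the formal square of odd elements ($m^{[2]}=0$ for odd monomials, $(f+g)^{[2]}=f^{[2]}+\{f,g\}+g^{[2]}$); $\mathbf P^o$ is the span of its elements without constant term (its ideal without unit). $\mathbf J=\mathrm{Kan}(\mathbf P)=\mathbf P\oplus\bar{\mathbf P}$ with $|\bar a|=1-|a|$ and $a\bullet b=ab$, $\bar a\bullet b=(-1)^{|b|}\overline{ab}$, $a\bullet\bar b=\overline{ab}$, $\bar a\bullet\bar b=(-1)^{|b|}\{a,b\}$; $\mathbf J^o=\mathbf P^o\oplus\bar{\mathbf P}$. $\mathbf K=K1\oplus\mathbf Q\oplus K\bar1\oplus\bar{\mathbf Q}$ with only nonzero products (besides the unit $1$) $\bar x\bullet\bar y=[x,y]$, $x\bullet\bar1=(-1)^{|x|}\bar1\bullet x=\bar x$; $\mathbf K^o=\mathbf Q\oplus K\bar1\oplus\bar{\mathbf Q}$. An algebra is locally nilpotent if every finitely generated subalgebra is nilpotent. *)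

(* Defs.v *)
From HB Require Import structures.
From mathcomp Require Import all_boot all_algebra.
From mathcomp Require Import finmap.
From mathcomp.multinomials Require Import monalg.

Set Implicit Arguments.
Unset Strict Implicit.
Unset Printing Implicit Defensive.

Import GRing.Theory.
Local Open Scope ring_scope.

(* An ambient K-vector space [car] (given by its zero, sum and scalar     *)
(* multiplication), an even/odd decomposition [pe]/[po] (the projections *)
(* onto the even and odd parts), a list of bilinear products [ops] and a *)
(* squaring map [sq] (used on odd elements: it is the characteristic-2   *)
(* formal square; in characteristic <> 2 closure under it is automatic). *)
Record alg (K : fieldType) := Alg {
  car : Type;
  az : car;
  aadd : car -> car -> car;
  ascale : K -> car -> car;
  ape : car -> car;
  apo : car -> car;
  aops : seq (car -> car -> car);
  asq : car -> car
}.
Arguments car {K} a.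
Arguments az {K} a.
Arguments aadd {K} a _ _.
Arguments ascale {K} a _ _.
Arguments ape {K} a _.
Arguments apo {K} a _.
Arguments aops {K} a.
Arguments asq {K} a _.

Fixpoint InL (T : Type) (x : T) (s : seq T) : Prop :=
  if s is y :: s' then y = x \/ InL x s' else False.

Section Framework.
Variables (K : fieldType) (A : alg K).

Definition is_odd (x : car A) : Prop := apo A x = x.

Definition is_subalg (B : car A -> Prop) : Prop :=
  [/\ B (az A),
      (forall x y, B x -> B y -> B (aadd A x y)),
      (forall c x, B x -> B (ascale A c x)),
      (forall x, B x -> B (ape A x) /\ B (apo A x)) &
      (forall f x y, InL f (aops A) -> B x -> B y -> B (f x y)) /\
      (forall x, B x -> is_odd x -> B (asq A x))].

Inductive gen (S : seq (car A)) : car A -> Prop :=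
| gen_in x : InL x S -> gen S x
| gen_0 : gen S (az A)
| gen_add x y : gen S x -> gen S y -> gen S (aadd A x y)
| gen_scale c x : gen S x -> gen S (ascale A c x)
| gen_pe x : gen S x -> gen S (ape A x)
| gen_po x : gen S x -> gen S (apo A x)
| gen_op f x y : InL f (aops A) -> gen S x -> gen S y -> gen S (f x y)
| gen_sq x : gen S x -> is_odd x -> gen S (asq A x).

Inductive pw (B : car A -> Prop) : nat -> car A -> Prop :=
| pw_in x : B x -> pw B 1 x
| pw_0 n : pw B n (az A)
| pw_add n x y : pw B n x -> pw B n y -> pw B n (aadd A x y)
| pw_scale n c x : pw B n x -> pw B n (ascale A c x)
| pw_op f i j x y : InL f (aops A) -> pw B i x -> pw B j y ->
    pw B (i + j) (f x y)
| pw_sq i x : pw B i x -> is_odd x -> pw B (2 * i) (asq A x).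

Definition nilpotent (B : car A -> Prop) : Prop :=
  exists N : nat, forall n x, (N <= n)%N -> pw B n x -> x = az A.

Definition locally_nilpotent (B : car A -> Prop) : Prop :=
  forall S : seq (car A), (forall x, InL x S -> B x) -> nilpotent (gen S).

Definition ln_decomposition (X B1 B2 : car A -> Prop) : Prop :=
  [/\ is_subalg B1 /\ is_subalg B2,
      locally_nilpotent B1 /\ locally_nilpotent B2,
      (forall x, B1 x -> X x) /\ (forall x, B2 x -> X x),
      (forall x, X x -> exists a b, [/\ B1 a, B2 b & x = aadd A a b]) &
      (forall x, B1 x -> B2 x -> x = az A)].

Definition continuum_ln_decompositions (X : car A -> Prop) : Prop :=
  exists D : (nat -> bool) -> (car A -> Prop) * (car A -> Prop),
    (forall s, ln_decomposition X (D s).1 (D s).2) /\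
    (forall s t, s <> t ->
       ~ ((forall x, (D s).1 x <-> (D t).1 x) /\
          (forall x, (D s).2 x <-> (D t).2 x))).

End Framework.

Fixpoint subs (s : seq nat) : seq (seq nat) :=
  if s is x :: s' then [seq x :: p | p <- subs s'] ++ subs s' else [:: [::]].

(* number of inversions between two monomials: the sign of the product  *)
(* x^a x^b of two disjoint sorted monomials is (-1)^(inv a b) *)
Definition inv (a b : seq nat) : nat := \sum_(x <- a) count (fun y => y < x)%N b.

Definition maxl (s : seq nat) : nat := foldr maxn 0%N s.

Definition sgn (K : fieldType) (n : nat) : K := (-1) ^+ n.

(* coefficient of the monomial t in the product x^a * x^b *)
Definition pcoef (K : fieldType) (a b t : seq nat) : K :=
  if sorted ltn t && perm_eq t (a ++ b) then sgn K (inv a b) else 0.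

(* monomials x_{s_1} ... x_{s_k}, s_1 < ... < s_k *)
Definition mono := {s : seq nat | sorted ltn s}.

(* Lambda = Grassmann algebra over K on x_0, x_1, ...: finitely supported *)
(* K-linear combinations of monomials *)
Definition Lam (K : fieldType) := {malg K[mono]}.

Definition mk (K : fieldType) (t : seq nat) : Lam K :=
  if insub t is Some m then << m >> else 0.

Definition lmul (K : fieldType) (a b : seq nat) : Lam K :=
  if has (fun x => x \in b) a then 0 else sgn K (inv a b) *: mk K (sort leq (a ++ b)).

Definition blk (i k : nat) : seq nat :=
  flatten [seq [:: i + 3 * n; i + 3 * n + 1]%N | n <- iota 0 k].

(* v_i applied to a monomial x^s:                                        *)
(*   sum_k (x_i x_{i+1} ... x_{i+3(k-1)+1}) * d_{i+3k}(x^s),             *)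
(* d_j the (left) superderivation, d_j(x^s) = (-1)^(index j s) x^(s\j) *)
Definition vmono (K : fieldType) (i : nat) (s : seq nat) : Lam K :=
  \sum_(k <- iota 0 (maxl s).+1)
    (if (i + 3 * k)%N \in s then
       sgn K (index (i + 3 * k)%N s) *: lmul K (blk i k) (rem (i + 3 * k)%N s)
     else 0).

Definition v (K : fieldType) (i : nat) (f : Lam K) : Lam K :=
  \sum_(m <- msupp f) f@_m *: vmono K i (val m).

Definition lpe (K : fieldType) (f : Lam K) : Lam K :=
  \sum_(m <- msupp f | ~~ odd (size (val m))) f@_m *: << m >>.
Definition lpo (K : fieldType) (f : Lam K) : Lam K :=
  \sum_(m <- msupp f | odd (size (val m))) f@_m *: << m >>.

Definition End (K : fieldType) := Lam K -> Lam K.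
Definition ez (K : fieldType) : End K := fun _ => 0.
Definition eadd (K : fieldType) (M N : End K) : End K := fun f => M f + N f.
Definition escale (K : fieldType) (c : K) (M : End K) : End K := fun f => c *: M f.
Definition ecomp (K : fieldType) (M N : End K) : End K := fun f => M (N f).
Definition eopp (K : fieldType) (M : End K) : End K := fun f => - M f.
Definition epe (K : fieldType) (M : End K) : End K :=
  eadd (ecomp (@lpe K) (ecomp M (@lpe K))) (ecomp (@lpo K) (ecomp M (@lpo K))).
Definition epo (K : fieldType) (M : End K) : End K :=
  eadd (ecomp (@lpo K) (ecomp M (@lpe K))) (ecomp (@lpe K) (ecomp M (@lpo K))).
Definition eflip (K : fieldType) (M : End K) : End K := eadd (epe M) (eopp (epo M)).

(* supercommutator [M,N] = MN - (-1)^(|M||N|) NM, extended bilinearly *)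
Definition ebr (K : fieldType) (M N : End K) : End K :=
  let Me := epe M in let Mo := epo M in let Ne := epe N in let No := epo N in
  eadd (eadd (ecomp Me N) (eopp (ecomp N Me)))
  (eadd (eadd (ecomp Mo Ne) (eopp (ecomp Ne Mo)))
        (eadd (ecomp Mo No) (ecomp No Mo))).

Definition LieEnd (K : fieldType) : alg K :=
  @Alg K (End K) (@ez K) (@eadd K) (@escale K) (@epe K) (@epo K)
       [:: @ebr K] (fun M => ecomp M M).

Definition AssEnd (K : fieldType) : alg K :=
  @Alg K (End K) (@ez K) (@eadd K) (@escale K) id (fun _ => @ez K)
       [:: @ecomp K] (fun M => ecomp M M).

Definition Qalg (K : fieldType) : End K -> Prop :=
  gen (A := LieEnd K) [:: @v K 0; @v K 1; @v K 2].
Definition Aalg (K : fieldType) : End K -> Prop :=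
  gen (A := AssEnd K) [:: @v K 0; @v K 1; @v K 2].

(* Generators of H_infinity are encoded by naturals: x_i = 2i, y_i = 2i+1, *)
(* ordered by their codes; a monomial is a strictly increasing list of   *)
(* codes.  An element of the completion H~ is a formal (possibly         *)
(* infinite) sum, i.e. a coefficient function on monomials.              *)
Definition Hf (K : fieldType) := seq nat -> K.
Definition hz (K : fieldType) : Hf K := fun _ => 0.
Definition hadd (K : fieldType) (f g : Hf K) : Hf K := fun t => f t + g t.
Definition hscale (K : fieldType) (c : K) (f : Hf K) : Hf K := fun t => c * f t.
Definition hpe (K : fieldType) (f : Hf K) : Hf K := fun t => if odd (size t) then 0 else f t.
Definition hpo (K : fieldType) (f : Hf K) : Hf K := fun t => if odd (size t) then f t else 0.
Definition hflip (K : fieldType) (f : Hf K) : Hf K := fun t => sgn K (size t) * f t.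

(* the completion H~: c.1 + sum over monomials x^a y^b with b <> 0 and   *)
(* (largest index in a) < (largest index in b) *)
Definition xs (t : seq nat) : seq nat := [seq n./2 | n <- t & ~~ odd n].
Definition ys (t : seq nat) : seq nat := [seq n./2 | n <- t & odd n].
Definition Htilde (K : fieldType) (f : Hf K) : Prop :=
  forall t, f t != 0 -> sorted ltn t /\
    (t = [::] \/ (ys t != [::] /\ (xs t == [::] \/ (maxl (xs t) < maxl (ys t))%N))).

(* product (exact: finitely many terms) *)
Definition hmul (K : fieldType) (f g : Hf K) : Hf K := fun t =>
  \sum_(p <- undup (subs t))
     f p * g [seq y <- t | y \notin p] * pcoef K p [seq y <- t | y \notin p] t.

(* coefficient of t in the Poisson bracket {x^m1, x^m2} of two monomials:  *)
(* {f,g} = -(-1)^|f| sum_j (d_{y_j} f . d_{x_j} g + d_{x_j} f . d_{y_j} g) *)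
(* (the unique Poisson superbracket with {y_i,x_j} = delta_ij,            *)
(*  {x_i,x_j} = {y_i,y_j} = 0; d_z the left superderivations)            *)
Definition dterm (K : fieldType) (z1 z2 : nat) (m1 m2 t : seq nat) : K :=
  if (z1 \in m1) && (z2 \in m2) then
    sgn K (index z1 m1) * sgn K (index z2 m2) * pcoef K (rem z1 m1) (rem z2 m2) t
  else 0.
Definition mbr (K : fieldType) (m1 m2 t : seq nat) : K :=
  - sgn K (size m1) *
    \sum_(j <- iota 0 (maxl m1).+1)
       (dterm K (2 * j).+1 (2 * j) m1 m2 t + dterm K (2 * j) (2 * j).+1 m1 m2 t).

(* the (finitely many) pairs of monomials (m1,m2) that can contribute to  *)
(* the coefficient of t in {f,g} for f, g in H~ (the contracted index j   *)
(* is then < the largest index of a y in t) *)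
Definition candH (t : seq nat) : seq (seq nat * seq nat) :=
  undup (flatten [seq flatten
     [seq [seq (sort leq (zz.1 :: p), sort leq (zz.2 :: [seq y <- t | y \notin p]))
          | p <- subs t]
     | zz <- [:: ((2 * j).+1, 2 * j); (2 * j, (2 * j).+1)]]
   | j <- iota 0 (maxl t).+1]).

Definition hbr (K : fieldType) (f g : Hf K) : Hf K := fun t =>
  \sum_(pq <- candH t) f pq.1 * g pq.2 * mbr K pq.1 pq.2 t.

Fixpoint lexlt (a b : seq nat) : bool :=
  match a, b with
  | [::], [::] => false
  | [::], _ => true
  | _, [::] => false
  | x :: a', y :: b' => (x < y)%N || ((x == y) && lexlt a' b')
  end.

(* formal square of an odd element f = sum l_m m:                         *)
(* f^[2] = sum_{m < m'} l_m l_m' {m, m'}  (m^[2] = 0 for odd monomials)   *)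
Definition hsq (K : fieldType) (f : Hf K) : Hf K := fun t =>
  \sum_(pq <- candH t | lexlt pq.1 pq.2) f pq.1 * f pq.2 * mbr K pq.1 pq.2 t.

Definition Halg (K : fieldType) : alg K :=
  @Alg K (Hf K) (@hz K) (@hadd K) (@hscale K) (@hpe K) (@hpo K)
       [:: @hmul K; @hbr K] (@hsq K).

Definition hone (K : fieldType) : Hf K := fun t => if t == [::] then 1 else 0.

(* the monomial x_i x_{i+1} x_{i+3} x_{i+4} ... x_{i+3(k-1)+1} y_{i+3k} *)
Definition Lk (i k : nat) : seq nat :=
  [seq (2 * n)%N | n <- blk i k] ++ [:: (2 * (i + 3 * k)).+1].

(* V_i = sum_k (prod_{n<k} x_{i+3n} x_{i+3n+1}) y_{i+3k} *)
Definition VV (K : fieldType) (i : nat) : Hf K := fun t =>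
  if has (fun k => t == Lk i k) (iota 0 (size t).+1) then 1 else 0.

Definition Palg (K : fieldType) : Hf K -> Prop :=
  gen (A := Halg K) [:: hone K; VV K 0; VV K 1; VV K 2].
Definition Po (K : fieldType) : Hf K -> Prop := fun f => @Palg K f /\ f [::] = 0.

(* 4. Kantor double J = Kan(P) and K = K1 + Q + K1bar + Qbar             *)

(* (a, b) stands for a + bbar *)
Definition Jcar (K : fieldType) := (Hf K * Hf K)%type.
Definition jprod (K : fieldType) (u w : Jcar K) : Jcar K :=
  let: (a, b) := u in let: (c, d) := w in
  (hadd (hmul a c) (hbr b (hflip d)), hadd (hmul a d) (hmul b (hflip c))).

Definition Jalg (K : fieldType) : alg K :=
  @Alg K (Jcar K) (hz K, hz K)
       (fun u w => (hadd u.1 w.1, hadd u.2 w.2))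
       (fun c u => (hscale c u.1, hscale c u.2))
       (fun u => (hpe u.1, hpo u.2)) (fun u => (hpo u.1, hpe u.2))
       [:: @jprod K] (fun u => jprod u u).

Definition Jo (K : fieldType) : Jcar K -> Prop := fun u => @Po K u.1 /\ @Palg K u.2.

(* (l, x, m, y) stands for l.1 + x + m.1bar + ybar *)
Definition Kcar (K : fieldType) := (K * End K * K * End K)%type.
Definition kprod (K : fieldType) (u w : Kcar K) : Kcar K :=
  let: (l, x, m, y) := u in let: (l', x', m', y') := w in
  (l * l',
   eadd (eadd (escale l x') (escale l' x)) (ebr y y'),
   l * m' + l' * m,
   eadd (eadd (escale l y') (escale l' y)) (eadd (escale m' x) (escale m (eflip x')))).

Definition Kalg (K : fieldType) : alg K :=
  @Alg K (Kcar K) (0, @ez K, 0, @ez K)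
       (fun u w => let: (l, x, m, y) := u in let: (l', x', m', y') := w in
                   (l + l', eadd x x', m + m', eadd y y'))
       (fun c u => let: (l, x, m, y) := u in
                   (c * l, escale c x, c * m, escale c y))
       (fun u => let: (l, x, m, y) := u in (l, epe x, 0, epo y))
       (fun u => let: (l, x, m, y) := u in (0, epo x, m, epe y))
       [:: @kprod K] (fun u => kprod u u).

Definition Ko (K : fieldType) : Kcar K -> Prop := fun u =>
  let: (l, x, m, y) := u in [/\ l = 0, @Qalg K x & @Qalg K y].

Arguments Qalg K _ : clear implicits.
Arguments Aalg K _ : clear implicits.
Arguments Palg K _ : clear implicits.
Arguments Po K _ : clear implicits.
Arguments Jo K _ : clear implicits.
Arguments Ko K _ : clear implicits.

(* Main.v *)
From Stdlib Require Import ZArith Reals Lra Classical FunctionalExtensionality.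
From mathcomp Require Import all_boot all_algebra finmap zify.
From mathcomp.multinomials Require Import monalg.
Require Import Defs.

Set Implicit Arguments.
Unset Strict Implicit.
Unset Printing Implicit Defensive.

Import GRing.Theory.

(* Each of the algebras is graded by N^3 through the degrees in v_0, v_1, v_2, and
   v_n has degree X^n in Z[X]/(X^3 - X - 2).  Expanding the letters of a word by
   v_j = d_j + x_j x_{j+1} v_{j+3} down to monomials in the x_j and d_j, the numbers
   n_j of letters v_j met on the way satisfy n_j = 2 n_{j+3} + n_{j+2} + eps_j with
   eps_j in {-1, 0, 1}, because every x_j and every d_j is odd.  As the real root of
   X^3 - X - 2 exceeds the modulus of the complex root mu, the value d(mu) of the
   degree d of a nonzero element is o(|d|).  A half-plane of C through 0 then
   splits the degrees into two additively closed parts, and on either side finitely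
   many degrees have sums that leave the origin of C linearly fast, so long products
   vanish.  Rotating the half-plane gives continuum many decompositions, told apart by
   the v_n since the arguments of the powers mu^n are dense. *)

(** * Half-planes of degrees *)

Section Cones.
Local Open Scope R_scope.

(** Elements may be infinite sums, or operators with infinitely many matrix entries, so no word is
    ever expanded. A degree is attached to each monomial or matrix entry instead: once b_j - a_j is
    read off from it, the balance equations have at most one finitely supported solution n, whose
    first three values are the degree. The growth estimate comes from iterating the balance N times:
    up to an error bounded for fixed N, a degree is carried by the letters v_N, v_{N+1}, v_{N+2},
    which weigh about |mu|^N at mu but lam^N at the real root lam. The degrees on the boundary line
    of a half-plane have to be divided too, so one half of that line belongs to the half-plane;
    finitely many nonzero degrees of one side still lie strictly on one side of a slightly rotated
    line. That an infinite support carries only finitely many degrees is not automatic: it comes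
    from writing generated elements as finite sums of homogeneous ones. *)

Definition triple := (nat * nat * nat)%type.
Definition tadd (d e : triple) : triple :=
  let: (a, b, c) := d in let: (a', b', c') := e in (a + a', b + b', c + c')%N.
Definition t0 : triple := (0, 0, 0)%N.
Definition tri (n : nat -> nat) : triple := (n 0, n 1, n 2)%N.

(* [vdeg n] is the degree of [v_n]: the class of X^n in Z[X]/(X^3 - X - 2). *)
Definition tstep (d : triple) : triple :=
  let: (a, b, c) := d in (2 * c, a + c, b)%N.
Definition vdeg (n : nat) : triple := iter n tstep (1, 0, 0)%N.

(* [n j] counts the letters [v_j] that occur when the letters of a word in
   v_0, v_1, v_2 are expanded by v_j = d_j + x_j x_{j+1} v_{j+3}; [b j] and
   [a j] say whether d_j, resp. x_j, survives in the resulting monomial. *)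
Definition balanced (n a b : nat -> nat) : Prop := forall j,
  (n j + a j = b j + 2 * n (j + 3) + (if j is j'.+1 then n (j' + 3) else 0))%N.
Definition admissible (n : nat -> nat) : Prop := exists a b : nat -> nat,
  (forall j, a j <= 1 /\ b j <= 1)%N /\ balanced n a b.

Inductive nsum (L : seq triple) : nat -> triple -> Prop :=
| nsum0 : nsum L 0 t0
| nsumS k d e : d \in L -> nsum L k e -> nsum L k.+1 (tadd d e).

(** Such sequences are the values f(X^j) of the additive maps f from Z[X]/(X^3 - X - 2) to the
    reals; [tlin m] is f on degrees. *)
Definition trec (m : nat -> R) : Prop :=
  forall j, m (j + 3)%N = 2 * m j + m (j + 1)%N.

Definition tlin (m : nat -> R) (d : triple) : R :=
  let: (a, b, c) := d in INR a * m 0%N + INR b * m 1%N + INR c * m 2%N.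

Lemma INRD m n : INR (m + n)%N = INR m + INR n.
Proof. exact: plus_INR. Qed.

Lemma INRM m n : INR (m * n)%N = INR m * INR n.
Proof. exact: mult_INR. Qed.

Lemma tlinD m d e : tlin m (tadd d e) = tlin m d + tlin m e.
Proof.
case: d => [[a b] c]; case: e => [[a' b'] c'] /=.
rewrite !INRD; ring.
Qed.

Lemma tlin0 m : tlin m t0 = 0.
Proof. rewrite /= ; ring. Qed.

Lemma tlin_lc (m1 m2 : nat -> R) x y d :
  tlin (fun j => x * m1 j + y * m2 j) d = x * tlin m1 d + y * tlin m2 d.
Proof. case: d => [[a b] c] /=; ring. Qed.

Lemma tlin_vdeg m n : trec m -> tlin m (vdeg n) = m n.
Proof.
elim: n m => [|n IHn] m mP; first by rewrite /=; ring.
have sP : trec (fun j => m (j + 1)%N) by move=> j; rewrite -mP; congr m; lia.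
have := IHn _ sP; rewrite addn1 => <-.
rewrite /vdeg iterS /=; case: (iter _ _ _) => [[a b] c] /=.
rewrite mul2n -addnn !INRD.
have -> : m 3%N = 2 * m 0%N + m 1%N := mP 0%N.
rewrite -[(0 + 1)%N]/1%N -[(1 + 1)%N]/2%N; ring.
Qed.

Lemma vdeg_rec n :
  vdeg n.+3 = tadd (tadd (vdeg n) (vdeg n)) (vdeg n.+1).
Proof.
rewrite /vdeg !iterS; case: (iter _ _ _) => [[a b] c] /=.
by congr (_, _, _); lia.
Qed.

Lemma vdeg_nz n : vdeg n <> t0.
Proof.
elim: n => // n IHn; rewrite /vdeg iterS -/(vdeg n).
by move: IHn; case: (vdeg n) => [[a b] c] /= IHn [] *; apply: IHn; congr (_, _, _); lia.
Qed.

Definition psum (m : nat -> R) (N : nat) : R :=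
  sum_f_R0 (fun j => Rabs (m j)) N.

(** For N > 0, the weight of everything of index at least N once only the letters v_j with j < N are
    expanded. The letters v_N, v_{N+1}, v_{N+2} remain, and each v_{N+2} was born together with
    x_{N-1} x_N; its x_N weighs - m_N. *)
Definition tailpart (m : nat -> R) (n : nat -> nat) (N : nat) : R :=
  INR (n N) * m N + INR (n (N + 1)%N) * m (N + 1)%N
  + INR (n (N + 2)%N) * (m (N + 2)%N - m N).

(** Expanding v_{N+1} too moves only the surviving letters of index N+1 out of the tail, so the
    change is (b - a) m_{N+1} with |b - a| at most 1. *)
Lemma tail_step m n a b N : trec m -> balanced n a b ->
  (forall j, a j <= 1 /\ b j <= 1)%N ->
  Rabs (tailpart m n N.+1 - tailpart m n N.+2) <= Rabs (m N.+1).
Proof.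
move=> mP nP abP; rewrite /tailpart.
have E : INR (n N.+1) + INR (a N.+1) =
         INR (b N.+1) + 2 * INR (n (N.+1 + 3)%N) + INR (n (N.+1 + 2)%N).
  have := f_equal INR (nP N.+1).
  rewrite (_ : N.+1 + 2 = N + 3)%N; last by lia.
  rewrite mul2n -addnn !INRD => ->; ring.
have -> : (N.+2 = N.+1 + 1)%N by lia.
have -> : (N.+1 + 1 + 2 = N.+1 + 3)%N by lia.
have -> : (N.+1 + 1 + 1 = N.+1 + 2)%N by lia.
rewrite mP; set x := INR (n N.+1) in E *.
have -> : x = INR (b N.+1) - INR (a N.+1) + 2 * INR (n (N.+1 + 3)%N)
              + INR (n (N.+1 + 2)%N) by lra.
match goal with |- Rabs ?u <= _ =>
  have -> : u = (INR (b N.+1) - INR (a N.+1)) * m N.+1 by ring end.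
rewrite Rabs_mult -[X in _ <= X]Rmult_1_l.
apply: Rmult_le_compat_r; first exact: Rabs_pos.
case: (abP N.+1); case: (a _) => [|[|?]] //; case: (b _) => [|[|?]] // _ _;
  rewrite /=; apply: Rabs_le; lra.
Qed.

Lemma tail_bound m n a b N : trec m -> balanced n a b ->
  (forall j, a j <= 1 /\ b j <= 1)%N ->
  Rabs (tlin m (tri n) - tailpart m n N.+1) <= psum m N.
Proof.
move=> mP nP abP; elim: N => [|N IHN].
  rewrite /psum /= /tailpart.
  (* There is no v_{-1}, so x_0 comes from v_0 alone and the balance at 0 has no n_2 term. *)
  have E : INR (n 0%N) + INR (a 0%N) = INR (b 0%N) + 2 * INR (n 3%N).
    have := f_equal INR (nP 0%N); rewrite addn0 add0n.
    by rewrite mul2n -addnn !INRD => ->; ring.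
  have M : m 3%N = 2 * m 0%N + m 1%N by have := mP 0%N.
  rewrite -[(1 + 1)%N]/2%N -[(1 + 2)%N]/3%N M.
  set x := INR (n 0%N) in E *.
  have -> : x = INR (b 0%N) - INR (a 0%N) + 2 * INR (n 3%N) by lra.
  match goal with |- Rabs ?u <= _ =>
    have -> : u = (INR (b 0%N) - INR (a 0%N)) * m 0%N by ring end.
  rewrite Rabs_mult -[X in _ <= X]Rmult_1_l.
  apply: Rmult_le_compat_r; first exact: Rabs_pos.
  case: (abP 0%N); case: (a _) => [|[|?]] //; case: (b _) => [|[|?]] // _ _;
    rewrite /=; apply: Rabs_le; lra.
have H := tail_step N mP nP abP.
have -> : tlin m (tri n) - tailpart m n N.+2 =
  (tlin m (tri n) - tailpart m n N.+1) + (tailpart m n N.+1 - tailpart m n N.+2) by ring.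
apply: Rle_trans (Rabs_triang _ _) _.
by rewrite /psum tech5 -/(psum m N); apply: Rplus_le_compat.
Qed.

(** * Growth of degrees at the roots of X^3 - X - 2 *)

Variables (lam rho phi : R).
Hypotheses (lam_lo : 3 / 2 < lam) (lam_hi : lam < 8 / 5).
Hypothesis lam_eq : lam ^ 3 = lam + 2.
Hypotheses (rho_pos : 0 < rho) (rho_sq : rho ^ 2 = lam ^ 2 - 1).
Hypotheses (cos_phi : 2 * rho * cos phi = - lam) (sin_phi : 0 < sin phi).

Let rho_lam : rho < lam.
Proof. by nra. Qed.

Let rho_hi : rho < 5 / 4.
Proof. by nra. Qed.

Lemma trec_lam : trec (fun j => lam ^ j).
Proof. by move=> j; rewrite !pow_add lam_eq; ring. Qed.

(** Let s count the letters v_N, v_{N+1}, v_{N+2}. The tail at N is at least lam^N s for the powers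
    of lam and at most 3 B rho^N s for m, while the part before N is bounded independently of n. As
    rho < lam, some N brings the ratio below eta. *)
Lemma sublinear (m : nat -> R) B : 0 < B -> trec m ->
    (forall j, Rabs (m j) <= B * rho ^ j) ->
  forall eta, 0 < eta -> exists C, forall n, admissible n ->
    Rabs (tlin m (tri n)) <= C + eta * tlin (fun j => lam ^ j) (tri n).
Proof.
move=> B0 mP mB eta eta0.
have q0 : 0 < rho / lam by apply: Rdiv_lt_0_compat; lra.
have q1 : rho / lam < 1.
  by apply: (Rmult_lt_reg_r lam); [lra | rewrite /Rdiv Rmult_assoc Rinv_l; lra].
have aq : Rabs (rho / lam) < 1 by rewrite Rabs_pos_eq; lra.
have e0 : 0 < eta / (3 * B) by apply: Rdiv_lt_0_compat; lra.
have [N0 HN0] := pow_lt_1_zero _ aq _ e0.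
pose N := N0.+1.
have HN : (rho / lam) ^ N < eta / (3 * B).
  apply: Rle_lt_trans (HN0 N _); last by apply/leP.
  exact: Rle_abs.
pose m1 := fun j : nat => lam ^ j.
exists (psum m N0 + eta * psum m1 N0) => n [a [b [ab nP]]].
have H1 := tail_bound N0 mP nP ab.
have H2 := tail_bound N0 trec_lam nP ab.
rewrite -/m1 -/N in H1 H2 *.
pose s := INR (n N) + INR (n (N + 1)%N) + INR (n (N + 2)%N).
have p0 := pos_INR (n N); have p1 := pos_INR (n (N + 1)%N).
have p2 := pos_INR (n (N + 2)%N).
have lN : 0 < lam ^ N by apply: pow_lt; lra.
have rN : 0 < rho ^ N by apply: pow_lt; lra.
have T1 : lam ^ N * s <= tailpart m1 n N.
  rewrite /tailpart /m1 !pow_add pow_1 /s.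
  have -> : INR (n N) * lam ^ N + INR (n (N + 1)%N) * (lam ^ N * lam) +
    INR (n (N + 2)%N) * (lam ^ N * lam ^ 2 - lam ^ N) =
    lam ^ N * (INR (n N) + lam * INR (n (N + 1)%N) + (lam ^ 2 - 1) * INR (n (N + 2)%N)).
    by ring.
  apply: Rmult_le_compat_l; first by lra.
  have : INR (n (N + 1)%N) <= lam * INR (n (N + 1)%N) by nra.
  (* By lam > 3/2 the three coefficients 1, lam and lam^2 - 1 are all at least 1. *)
  have l2 : 1 < lam ^ 2 - 1 by nra.
  have : INR (n (N + 2)%N) <= (lam ^ 2 - 1) * INR (n (N + 2)%N) by nra.
  lra.
(* The factor 3 comes from m_{N+2} - m_N, bounded by (rho^2 + 1) B rho^N with rho^2 < 2. *)
have T2 : Rabs (tailpart m n N) <= 3 * B * rho ^ N * s.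
  have b0 := mB N; have b1 := mB (N + 1)%N; have b2 := mB (N + 2)%N.
  rewrite !pow_add pow_1 in b1 b2.
  have BN : 0 < B * rho ^ N by nra.
  have r2 : rho ^ 2 < 2 by nra.
  have b1' : Rabs (m (N + 1)%N) <= 3 * (B * rho ^ N) by nra.
  have b2' : Rabs (m (N + 2)%N - m N) <= 3 * (B * rho ^ N).
    apply: Rle_trans (Rabs_triang _ _) _; rewrite Rabs_Ropp.
    have : B * (rho ^ N * rho ^ 2) <= 2 * (B * rho ^ N) by nra.
    lra.
  rewrite /tailpart /s.
  apply: Rle_trans (Rabs_triang _ _) _.
  have := Rabs_triang (INR (n N) * m N) (INR (n (N + 1)%N) * m (N + 1)%N).
  rewrite !Rabs_mult !(Rabs_pos_eq _ (pos_INR _)).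
  have : INR (n N) * Rabs (m N) <= INR (n N) * (3 * (B * rho ^ N)).
    by apply: Rmult_le_compat_l; lra.
  have : INR (n (N + 1)%N) * Rabs (m (N + 1)%N) <= INR (n (N + 1)%N) * (3 * (B * rho ^ N)).
    by apply: Rmult_le_compat_l; lra.
  have : INR (n (N + 2)%N) * Rabs (m (N + 2)%N - m N) <= INR (n (N + 2)%N) * (3 * (B * rho ^ N)).
    by apply: Rmult_le_compat_l; lra.
  lra.
have T3 : lam ^ N * s <= tlin m1 (tri n) + psum m1 N0.
  have := Rle_abs (- (tlin m1 (tri n) - tailpart m1 n N)).
  rewrite Rabs_Ropp; lra.
have T4 : 3 * B * rho ^ N * s <= eta * (lam ^ N * s).
  have s0 : 0 <= s by rewrite /s; lra.
  have : 3 * B * rho ^ N <= eta * lam ^ N.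
    have -> : rho ^ N = (rho / lam) ^ N * lam ^ N.
      by rewrite -Rpow_mult_distr /Rdiv Rmult_assoc Rinv_l ?Rmult_1_r //; lra.
    have : 3 * B * (rho / lam) ^ N <= eta.
      have -> : eta = 3 * B * (eta / (3 * B)) by field; lra.
      by apply: Rmult_le_compat_l; lra.
    nra.
  nra.
have T5 : eta * (lam ^ N * s) <= eta * (tlin m1 (tri n) + psum m1 N0).
  by apply: Rmult_le_compat_l; lra.
have := Rabs_triang (tlin m (tri n) - tailpart m n N) (tailpart m n N).
have -> : tlin m (tri n) - tailpart m n N + tailpart m n N = tlin m (tri n) by ring.
lra.
Qed.

(** A sum of k degrees from L has m-weight at least k del and lam-weight at most k M. For eta = del
    / (2 M) the sublinear bound makes the m-weight at most C + k del / 2, whence k <= 2 C / del. *)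
Lemma nsum_bound (m : nat -> R) B (L : seq triple) : 0 < B -> trec m ->
    (forall j, Rabs (m j) <= B * rho ^ j) ->
    (forall d, d \in L -> 0 < tlin m d) ->
  exists N, forall k n, (N <= k)%N -> admissible n -> nsum L k (tri n) -> False.
Proof.
move=> B0 mP mB Lpos.
have [del [del0 Hdel]] : exists del, 0 < del /\ forall d, d \in L -> del <= tlin m d.
  elim: L Lpos => [|d L IHL] Lpos; first by exists 1; split => //; lra.
  have [|del [del0 H]] := IHL.
    by move=> e eL; apply: Lpos; rewrite inE eL orbT.
  have d0 : 0 < tlin m d by apply: Lpos; rewrite inE eqxx.
  exists (Rmin del (tlin m d)); split; first exact: Rmin_glb_lt.
  move=> e; rewrite inE => /orP[/eqP -> | /H]; first exact: Rmin_r.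
  by move=> ?; apply: Rle_trans (Rmin_l _ _) _.
pose c := tlin (fun j => lam ^ j).
have [M [M0 HM]] : exists M, 0 < M /\ forall d, d \in L -> c d <= M.
  elim: L {Lpos Hdel} => [|d L [M [M0 H]]]; first by exists 1; split => //; lra.
  exists (Rmax M (c d)); split; first by apply: Rlt_le_trans M0 (Rmax_l _ _).
  move=> e; rewrite inE => /orP[/eqP -> | /H]; first exact: Rmax_r.
  by move=> ?; apply: Rle_trans (Rmax_l M (c d)).
have [|C HC] := sublinear B0 mP mB (eta := del / (2 * M)).
  by apply: Rdiv_lt_0_compat; lra.
have S1 k d : nsum L k d -> INR k * del <= tlin m d /\ c d <= INR k * M.
  elim=> {k d} [|k d e dL _ [H1 H2]].
    by rewrite /c !tlin0 /=; lra.
  rewrite S_INR /c !tlinD -/c; move: (Hdel _ dL) (HM _ dL); rewrite -/(c d) -/(c e).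
  by move=> *; split; lra.
have [N HN] := INR_unbounded (2 * C / del).
exists N => k n Nk nA /S1 [H1 H2].
have H3 := HC _ nA; rewrite -/c in H3.
have kN : INR N <= INR k by apply: le_INR; apply/leP.
have H4 : del / (2 * M) * c (tri n) <= del / (2 * M) * (INR k * M).
  by apply: Rmult_le_compat_l => //; apply: Rlt_le; apply: Rdiv_lt_0_compat; lra.
have H5 : del / (2 * M) * (INR k * M) = INR k * del / 2 by field; lra.
have H6 := Rle_abs (tlin m (tri n)).
have H7 : INR k * del <= 2 * C by lra.
have : INR k <= 2 * C / del.
  by apply: (Rmult_le_reg_r del) => //; rewrite /Rdiv Rmult_assoc Rinv_l; lra.
lra.
Qed.

(** The real part of e^(-i psi) mu^j, where mu = rho e^(i phi) is the complex root: the coordinate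
    of mu^j in the direction psi. *)
Definition mm (psi : R) (j : nat) : R := rho ^ j * cos (INR j * phi - psi).

(** mu is a root of X^2 + lam X + lam^2 - 1, the quotient of X^3 - X - 2 by X - lam. *)
Lemma mm_rec2 psi j : mm psi j.+2 = - lam * mm psi j.+1 - (lam ^ 2 - 1) * mm psi j.
Proof.
rewrite -rho_sq -cos_phi /mm !S_INR; set x := INR j * phi - psi.
have -> : (INR j + 1 + 1) * phi - psi = x + phi + phi by rewrite /x; ring.
have -> : (INR j + 1) * phi - psi = x + phi by rewrite /x; ring.
have -> : cos x = cos ((x + phi) - phi) by congr cos; ring.
rewrite (cos_plus (x + phi) phi) (cos_minus (x + phi) phi) /=; ring.
Qed.

Lemma mm_trec psi : trec (mm psi).
Proof.
move=> j; rewrite addn3 addn1 !mm_rec2.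
have E : lam * lam ^ 2 = lam + 2 by rewrite -lam_eq /=; ring.
ring_simplify; rewrite lam_eq; ring.
Qed.

Lemma mm_bound psi j : Rabs (mm psi j) <= 1 * rho ^ j.
Proof.
rewrite /mm Rabs_mult (Rabs_pos_eq (rho ^ j)); last by apply: pow_le; lra.
rewrite Rmult_comm; apply: Rmult_le_compat_r; first by apply: pow_le; lra.
by apply: Rabs_le; case: (COS_bound (INR j * phi - psi)).
Qed.

(** Rational root test: in lowest terms b'^3 = (b' + 2 c') c'^2 forces c' = 1, and b'^3 = b' + 2 has
    no solution in natural numbers. *)
Lemma lam_irrational (b c : nat) : INR b = lam * INR c -> b = 0%N /\ c = 0%N.
Proof.
case: (posnP c) => [-> | c0].
  by rewrite Rmult_0_r => /(INR_eq _ 0).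
move=> E; exfalso.
pose g := gcdn b c.
have g0 : (0 < g)%N by rewrite /g gcdn_gt0 c0 orbT.
have [b' Eb] : exists b', b = (b' * g)%N by apply/dvdnP; exact: dvdn_gcdl.
have [c' Ec] : exists c', c = (c' * g)%N by apply/dvdnP; exact: dvdn_gcdr.
have cop : coprime b' c'.
  have H : (gcdn b' c' * g = 1 * g)%N by rewrite muln_gcdl -Eb -Ec mul1n.
  by move/eqP: H; rewrite eqn_pmul2r.
have E' : INR b' = lam * INR c'.
  move: E; rewrite Eb Ec !INRM => E.
  apply: (Rmult_eq_reg_r (INR g)); first by lra.
  by apply: not_0_INR; lia.
have Q : (b' * b' * b' = (b' + 2 * c') * (c' * c'))%N.
  apply: INR_eq; rewrite !INRM INRD INRM E'.
  have -> : lam * INR c' * (lam * INR c') * (lam * INR c') = lam ^ 3 * INR c' ^ 3 by ring.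
  by rewrite lam_eq /=; ring.
have c1 : c' = 1%N.
  apply/eqP; rewrite -dvdn1.
  have D : (c' %| b' * b' * b')%N by rewrite Q mulnA dvdn_mull.
  have C2 : coprime c' (b' * b' * b') by rewrite !coprimeMr coprime_sym cop.
  by rewrite -(eqP C2) dvdn_gcd dvdnn D.
have {}Q : (b' * b' * b' = b' + 2)%N by rewrite Q c1; lia.
case: b' Q {E' cop Eb} => [|[|b']] // Q.
have : (4 * b'.+2 <= b'.+2 * b'.+2 * b'.+2)%N by rewrite leq_mul2r; apply/orP; right; lia.
by lia.
Qed.

(** The direction PI/2 measures imaginary parts, and Im mu^2 = - lam Im mu. *)
Lemma tlin_mm0 d : tlin (mm (PI / 2)) d =
  rho * sin phi * (INR d.1.2 - lam * INR d.2).
Proof.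
case: d => [[a b] c] /=; rewrite mm_rec2 /mm /=.
have -> : 0 * phi - PI / 2 = - (PI / 2) by ring.
have -> : 1 * phi - PI / 2 = phi - PI / 2 by ring.
rewrite cos_neg cos_minus cos_PI2 sin_PI2; ring.
Qed.

(** Evaluation at mu kills no nonzero degree. Two orthogonal coordinates vanish, hence all do; the
    imaginary part yields b = lam c, so b = c = 0 by irrationality, and the real part then yields a
    = 0. *)
Lemma tlin_nz psi d : tlin (mm psi) d = 0 -> tlin (mm (psi + PI / 2)) d = 0 -> d = t0.
Proof.
have key x : tlin (mm x) d = cos x * tlin (mm 0) d + sin x * tlin (mm (PI / 2)) d.
  rewrite -tlin_lc; case: d => [[a b] c] /=.
  have E j : mm x j = cos x * mm 0 j + sin x * mm (PI / 2) j.
    rewrite /mm Rminus_0_r !cos_minus cos_PI2 sin_PI2; ring.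
  by rewrite !E.
rewrite (key psi) (key (psi + PI / 2)) cos_plus sin_plus cos_PI2 sin_PI2 => A B.
have S := sin2_cos2 psi; rewrite /Rsqr in S.
have C : tlin (mm (PI / 2)) d = 0.
  set u := tlin (mm 0) d in A B; set w := tlin _ d in A B *.
  have -> : w = w * (sin psi * sin psi + cos psi * cos psi) by rewrite S; ring.
  have -> : w * (sin psi * sin psi + cos psi * cos psi) =
     sin psi * (cos psi * u + sin psi * w) +
     cos psi * ((cos psi * 0 - sin psi * 1) * u + (sin psi * 0 + cos psi * 1) * w) by ring.
  by rewrite A B; ring.
have D : tlin (mm 0) d = 0.
  set u := tlin (mm 0) d in A B *; rewrite C in A B.
  have -> : u = u * (sin psi * sin psi + cos psi * cos psi) by rewrite S; ring.
  have -> : u * (sin psi * sin psi + cos psi * cos psi) =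
     cos psi * (cos psi * u + sin psi * 0) -
     sin psi * ((cos psi * 0 - sin psi * 1) * u + (sin psi * 0 + cos psi * 1) * 0) by ring.
  by rewrite A B; ring.
move: C; rewrite tlin_mm0 => C.
have rs : rho * sin phi <> 0 by nra.
case: (Rmult_integral _ _ C) => // E.
have [b0 c0] := @lam_irrational d.1.2 d.2 ltac:(lra).
case: d {key A B C E} D b0 c0 => [[a b] c] D /= b0 c0; move: D; rewrite b0 c0 /= => D.
have m0 : mm 0 0 = 1 by rewrite /mm /= Rmult_0_l Rminus_0_r cos_0; ring.
rewrite /t0; congr (_, _, _); apply: (INR_eq _ 0%N).
by move: D; rewrite m0 /=; lra.
Qed.

(** Otherwise mu^n would be real and v_n would have degree (a, 0, 0); undoing one [tstep] would then
    make the degree of v_{n-1} zero. *)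
Lemma phi_irrational n z : (0 < n)%N -> INR n * phi <> IZR z * (2 * PI).
Proof.
move=> n0 E.
have M : mm (PI / 2) n = 0.
  rewrite /mm E cos_minus cos_PI2 sin_PI2.
  have -> : sin (IZR z * (2 * PI)) = 0.
    by apply: sin_eq_0_1; exists (Z.add z z); rewrite plus_IZR; ring.
  ring.
rewrite -(tlin_vdeg _ (mm_trec _)) tlin_mm0 in M.
have rs : rho * sin phi <> 0 by nra.
case: (Rmult_integral _ _ M) => // E'.
have [b0 c0] := @lam_irrational (vdeg n).1.2 (vdeg n).2 ltac:(lra).
case: n n0 {E M E'} b0 c0 => // n _.
rewrite /vdeg iterS -/(vdeg n); have := @vdeg_nz n.
case: (vdeg n) => [[a b] c] /= H A B; apply: H; congr (_, _, _); lia.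
Qed.

(** * Density of the arguments of the powers of mu *)

Definition nfloor (x : R) : nat := Z.to_nat (Z.sub (up x) 1).

Lemma nfloorP x : 0 <= x -> INR (nfloor x) <= x < INR (nfloor x) + 1.
Proof.
move=> x0; have [u1 u2] := archimed x.
have uz : Z.le 0 (Z.sub (up x) 1).
  suff : Z.lt 0 (up x) by lia.
  by apply: lt_IZR; lra.
by rewrite /nfloor INR_IZR_INZ Z2Nat.id // minus_IZR; lra.
Qed.

Lemma nfloor_lt x N : 0 <= x -> x < INR N -> (nfloor x < N)%N.
Proof.
move=> x0 xN; have [H _] := nfloorP x0.
by apply/ltP; apply: INR_lt; lra.
Qed.

(** Dirichlet's pigeonhole argument: two of the N + 1 fractional parts of k phi / (2 PI), 0 <= k <=
    N, fall into the same of N bins. *)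
Lemma small_multiple del : 0 < del ->
  exists k z, (0 < k)%N /\ Rabs (INR k * phi - IZR z * (2 * PI)) < del.
Proof.
move=> del0; pose T := 2 * PI.
have T0 : 0 < T by rewrite /T; have := PI_RGT_0; lra.
have [N HN] := INR_unbounded (T / del).
have N0 : 0 < INR N by apply: Rlt_trans HN; apply: Rdiv_lt_0_compat.
have TN : T / INR N < del.
  apply: (Rmult_lt_reg_r (INR N)) => //.
  rewrite /Rdiv Rmult_assoc Rinv_l ?Rmult_1_r; last by lra.
  have -> : T = T / del * del by field; lra.
  by rewrite (Rmult_comm del); apply: Rmult_lt_compat_r.
pose zf k := Z.sub (up (INR k * phi / T)) 1.
pose r k := INR k * phi / T - IZR (zf k).
have rP k : 0 <= r k < 1.
  have [u1 u2] := archimed (INR k * phi / T).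
  by rewrite /r /zf minus_IZR; lra.
have rN k : 0 <= r k * INR N < INR N by have := rP k; nra.
have binlt (k : 'I_N.+1) : (nfloor (r k * INR N) < N)%N.
  by apply: nfloor_lt; have := rN k; lra.
pose bin (k : 'I_N.+1) : 'I_N := Ordinal (binlt k).
have [k1 [k2 [k12 E]]] : exists k1 k2 : 'I_N.+1, (k1 < k2)%N /\ bin k1 = bin k2.
  apply: NNPP => H.
  have inj : injective bin.
    move=> i j Eij; apply: val_inj; case: (ltngtP i j) => // ij; exfalso; apply: H.
      by exists i, j.
    by exists j, i.
  by have := leq_card _ inj; rewrite !card_ord ltnn.
exists (k2 - k1)%N, (Z.sub (zf k2) (zf k1)); split; first by lia.
have E' : nfloor (r k1 * INR N) = nfloor (r k2 * INR N) by case: E.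
have A1 := nfloorP (proj1 (rN k1)); have A2 := nfloorP (proj1 (rN k2)).
rewrite E' in A1.
rewrite -/T minus_INR; last by apply/leP; lia.
rewrite minus_IZR.
have -> : (INR k2 - INR k1) * phi - (IZR (zf k2) - IZR (zf k1)) * T =
          (r k2 * INR N - r k1 * INR N) * (T / INR N).
  by rewrite /r; field; lra.
rewrite Rabs_mult (Rabs_pos_eq (T / INR N)); last first.
  by apply: Rlt_le; apply: Rdiv_lt_0_compat.
have : Rabs (r k2 * INR N - r k1 * INR N) <= 1 by apply: Rabs_le; lra.
have : 0 < T / INR N by apply: Rdiv_lt_0_compat.
nra.
Qed.

Lemma phi_dense p q : p < q ->
  exists n z, p < INR n * phi - IZR z * (2 * PI) < q.
Proof.
move=> pq; have [|k [z [k0 H]]] := @small_multiple (q - p); first lra.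
pose T := 2 * PI; rewrite -/T in H *.
have T0 : 0 < T by rewrite /T; have := PI_RGT_0; lra.
set th := INR k * phi - IZR z * T in H.
have th0 : th <> 0.
  by move=> E; apply: (@phi_irrational k z k0); rewrite -/T; rewrite /th in E; lra.
case: (Rlt_le_dec 0 th) => [thp | thn].
  rewrite Rabs_pos_eq in H; last lra.
  (* M full turns make the left end nonnegative. The first multiple of th beyond p + M T exceeds it
     by at most th, which is less than q - p. *)
  have [M HM] := INR_unbounded (- p / T).
  have p0 : 0 <= p + INR M * T.
    have : - p / T * T < INR M * T by apply: Rmult_lt_compat_r.
    have -> : - p / T * T = - p by field; lra.
    lra.
  have [|F1 F2] := @nfloorP ((p + INR M * T) / th).
    by apply: Rmult_le_pos => //; apply: Rlt_le; apply: Rinv_0_lt_compat.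
  set f := nfloor _ in F1 F2.
  exists (f.+1 * k)%N, (Z.add (Z.mul (Z.of_nat f.+1) z) (Z.of_nat M)).
  rewrite plus_IZR mult_IZR -!INR_IZR_INZ INRM.
  have -> : INR f.+1 * INR k * phi - (INR f.+1 * IZR z + INR M) * T =
            INR f.+1 * th - INR M * T by rewrite /th; ring.
  rewrite S_INR.
  have G1 : INR f * th <= (p + INR M * T) / th * th by apply: Rmult_le_compat_r; lra.
  have G2 : (p + INR M * T) / th * th < (INR f + 1) * th by apply: Rmult_lt_compat_r; lra.
  have G3 : (p + INR M * T) / th * th = p + INR M * T by field; lra.
  by rewrite G3 in G1 G2; lra.
have thm : 0 < - th by lra.
rewrite Rabs_left in H; last lra.
have [M HM] := INR_unbounded (q / T).
have q0 : 0 <= INR M * T - q.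
  have : q / T * T < INR M * T by apply: Rmult_lt_compat_r.
  have -> : q / T * T = q by field; lra.
  lra.
have [|F1 F2] := @nfloorP ((INR M * T - q) / - th).
  by apply: Rmult_le_pos => //; apply: Rlt_le; apply: Rinv_0_lt_compat.
set f := nfloor _ in F1 F2.
exists (f.+1 * k)%N, (Z.sub (Z.mul (Z.of_nat f.+1) z) (Z.of_nat M)).
rewrite minus_IZR mult_IZR -!INR_IZR_INZ INRM.
have -> : INR f.+1 * INR k * phi - (INR f.+1 * IZR z - INR M) * T =
          INR f.+1 * th + INR M * T by rewrite /th; ring.
rewrite S_INR.
have G1 : INR f * - th <= (INR M * T - q) / - th * - th by apply: Rmult_le_compat_r; lra.
have G2 : (INR M * T - q) / - th * - th < (INR f + 1) * - th by apply: Rmult_lt_compat_r; lra.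
have G3 : (INR M * T - q) / - th * - th = INR M * T - q by field; lra.
by rewrite G3 in G1 G2; lra.
Qed.

(** * Half-planes with one half of their boundary line *)

Variable psi : (nat -> bool) -> R.
Hypothesis psi_range : forall s, 0 <= psi s <= 3 / 2.
Hypothesis psi_inj : forall s t, s <> t -> psi s <> psi t.

Let F s := tlin (mm (psi s)).
Let G s := tlin (mm (psi s + PI / 2)).

(** The tie-break by [G] divides the boundary line, so that no two nonzero degrees on the same side
    have opposite values at mu. *)
Definition cone (s : nat -> bool) (d : triple) : bool :=
  if Rlt_dec 0 (F s d) then true
  else if Req_dec_T (F s d) 0 then (if Rlt_dec 0 (G s d) then true else false)
  else false.

Lemma coneP s d : reflect (0 < F s d \/ F s d = 0 /\ 0 < G s d) (cone s d).
Proof.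
rewrite /cone; case: Rlt_dec => [?|H1]; first by apply: ReflectT; left.
case: Req_dec_T => [?|H2]; last by apply: ReflectF => -[|[]].
case: Rlt_dec => [?|H3]; first by apply: ReflectT; right.
by apply: ReflectF => -[|[]].
Qed.

Lemma cone0 s : cone s t0 = false.
Proof. by apply/coneP; rewrite /F /G !tlin0; lra. Qed.

Lemma coneD s d e b : cone s d = b -> cone s e = b -> cone s (tadd d e) = b.
Proof.
case: b => [/coneP A /coneP B | /coneP A /coneP B]; apply/coneP;
  rewrite /F /G !tlinD -!/(F _ _) -!/(G _ _); rewrite -!/(F _ _) -!/(G _ _) in A B; lra.
Qed.

Lemma cone_sign s d b : d <> t0 -> cone s d = b ->
  let sg := if b then 1 else -1 in
  0 < sg * F s d \/ sg * F s d = 0 /\ 0 < sg * G s d.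
Proof.
move=> d0; case: b => /= /coneP A; first by lra.
case: (Rtotal_order (F s d) 0) => [?|[E|?]]; [by lra | | by lra].
case: (Rtotal_order (G s d) 0) => [?|[E'|?]]; [by lra | | by lra].
by case: d0; apply: (tlin_nz (psi := psi s)).
Qed.

(** A finite set does not see the tie-break: rotating the line slightly, that is taking M f + g with
    M large, puts all of it strictly on one side. *)
Lemma lex_to_linear (f g : triple -> R) (L : seq triple) :
    (forall d, d \in L -> 0 < f d \/ f d = 0 /\ 0 < g d) ->
  exists M, 0 <= M /\ forall M', M <= M' -> forall d, d \in L -> 0 < M' * f d + g d.
Proof.
elim: L => [|d L IHL] H; first by exists 0; split => //; lra.
have [|M [M0 HM]] := IHL; first by move=> e eL; apply: H; rewrite inE eL orbT.
have [M1 [M10 HM1]] : exists M1, 0 <= M1 /\ forall M', M1 <= M' -> 0 < M' * f d + g d.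
  case: (H d); first by rewrite inE eqxx.
    move=> fd; exists ((Rabs (g d) + 1) / f d); split.
      apply: Rlt_le; apply: Rdiv_lt_0_compat => //.
      by have := Rabs_pos (g d); lra.
    move=> M' HM'.
    have A : (Rabs (g d) + 1) / f d * f d <= M' * f d by apply: Rmult_le_compat_r; lra.
    have B : (Rabs (g d) + 1) / f d * f d = Rabs (g d) + 1 by field; lra.
    have := Rle_abs (- g d); rewrite Rabs_Ropp; lra.
  by move=> [-> ?]; exists 0; split; [lra | move=> *; lra].
exists (Rmax M M1); split; first by apply: Rle_trans (Rmax_l _ _).
move=> M' HM' e; rewrite inE => /orP[/eqP -> | eL].
  by apply: HM1; apply: Rle_trans (Rmax_r _ _) HM'.
by apply: HM => //; apply: Rle_trans (Rmax_l _ _) HM'.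
Qed.

Lemma cone_nsum_bound s b (L : seq triple) :
    (forall d, d \in L -> d <> t0 /\ cone s d = b) ->
  exists N, forall k n, (N <= k)%N -> admissible n -> nsum L k (tri n) -> False.
Proof.
move=> HL; pose sg := if b then 1 else -1.
have [|M [M0 HM]] := @lex_to_linear (fun d => sg * F s d) (fun d => sg * G s d) L.
  by move=> d /HL[d0 cd]; apply: cone_sign.
pose m j := (M * sg) * mm (psi s) j + sg * mm (psi s + PI / 2) j.
have sg1 : Rabs sg = 1 by rewrite /sg; case: (b); rewrite ?Rabs_Ropp Rabs_R1.
apply: (@nsum_bound m (M + 1)).
- by lra.
- by move=> j; rewrite /m !mm_trec; ring.
- move=> j; apply: Rle_trans (Rabs_triang _ _) _.
  rewrite (Rabs_mult (M * sg)) (Rabs_mult M) (Rabs_mult sg) sg1 (Rabs_pos_eq M) //.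
  have A := mm_bound (psi s) j; have B := mm_bound (psi s + PI / 2) j.
  have : M * Rabs (mm (psi s) j) <= M * (1 * rho ^ j) by apply: Rmult_le_compat_l.
  lra.
- move=> d dL; have := HM M (Rle_refl _) d dL.
  by rewrite /m tlin_lc -/(F s d) -/(G s d); lra.
Qed.

(** A power mu^n whose argument lies in the sector between the two boundary lines is on different
    sides of them. The angles psi range over an interval shorter than PI/2, which fixes the signs of
    both cosines. *)
Lemma cone_separated s t : s <> t -> exists n, cone s (vdeg n) <> cone t (vdeg n).
Proof.
wlog lt_st : s t / psi s < psi t.
  move=> H st; case: (Rtotal_order (psi s) (psi t)) => [|[/psi_inj|]] //.
    by move/H; apply.
  by move=> lt_ts; have [n Hn] := H _ _ lt_ts (nesym st); exists n; exact: nesym.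
move=> _; have [|n [z [H1 H2]]] := @phi_dense (PI / 2 + psi s) (PI / 2 + psi t); first lra.
exists n.
have rn : 0 < rho ^ n by apply: pow_lt.
have P32 := PI2_3_2.
have per x : cos (INR n * phi - x) = cos (INR n * phi - IZR z * (2 * PI) - x).
  have [k [-> | ->]] : exists k : nat, z = Z.of_nat k \/ z = Z.opp (Z.of_nat k).
    by exists (Z.abs_nat z); lia.
    rewrite -INR_IZR_INZ -(cos_period (_ - _ - x) k); congr cos; ring.
  rewrite opp_IZR -INR_IZR_INZ -(cos_period (_ - x) k); congr cos; ring.
have Fs : F s (vdeg n) < 0.
  rewrite /F (tlin_vdeg _ (mm_trec _)) /mm per.
  have : cos (INR n * phi - IZR z * (2 * PI) - psi s) < 0.
    have := psi_range s; have := psi_range t.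
    by move=> *; apply: cos_lt_0; lra.
  nra.
have Ft : 0 < F t (vdeg n).
  rewrite /F (tlin_vdeg _ (mm_trec _)) /mm per.
  have : 0 < cos (INR n * phi - IZR z * (2 * PI) - psi t).
    have := psi_range s; have := psi_range t.
    by move=> *; apply: cos_gt_0; lra.
  nra.
have -> : cone t (vdeg n) by apply/coneP; left.
by move/coneP; lra.
Qed.

End Cones.

(** * Continuum many angles, and the roots of the cubic *)

Section CantorReals.
Local Open Scope R_scope.

(** Base 3 with digits 0 and 1: a first difference at place k weighs 1 / 3^k, and all later places
    together at most half of that. Hence the limit is injective in s, with values between 0 and
    3/2. *)
Let ps (s : nat -> bool) := sum_f_R0 (fun i => (if s i then 1 else 0) / 3 ^ i).

Let pow3 n : 0 < / 3 ^ n.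
Proof. by apply: Rinv_0_lt_compat; apply: pow_lt; lra. Qed.

Let inv3S n : / 3 ^ n.+1 = / 3 ^ n / 3.
Proof. by rewrite /= Rinv_mult /Rdiv Rmult_comm. Qed.

Let ps_step s n :
  ps s n <= ps s n.+1 /\ ps s n.+1 + / 2 * / 3 ^ n.+1 <= ps s n + / 2 * / 3 ^ n.
Proof.
rewrite /ps tech5 /Rdiv inv3S; have := pow3 n; set u := / 3 ^ n; set a := sum_f_R0 _ _.
by case: (s _); lra.
Qed.

Let ps_mono s n k : ps s n <= ps s (n + k)%N /\
  ps s (n + k)%N + / 2 * / 3 ^ (n + k) <= ps s n + / 2 * / 3 ^ n.
Proof.
elim: k => [|k [H1 H2]]; first by rewrite addn0; lra.
by rewrite addnS; have [] := ps_step s (n + k)%N; lra.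
Qed.

Lemma cantor_reals : exists psi : (nat -> bool) -> R,
  (forall s, 0 <= psi s <= 3 / 2) /\ (forall s t, s <> t -> psi s <> psi t).
Proof.
have ub s n m : ps s m <= ps s n + / 2 * / 3 ^ n.
  have := pow3 m; have := pow3 n.
  case: (leqP n m) => [/subnKC <- | /ltnW/subnKC <-].
    by have [_] := ps_mono s n (m - n)%N; have := pow3 (n + (m - n)); lra.
  by have [] := ps_mono s m (n - m)%N; lra.
have bd s : bound (fun x => exists n, x = ps s n).
  by exists (ps s 0%N + / 2 * / 3 ^ 0) => x [n ->]; exact: ub.
have ne s : exists x, (fun x => exists n, x = ps s n) x by exists (ps s 0%N), 0%N.
pose psi s := proj1_sig (completeness _ (bd s) (ne s)).
have psiP s n : ps s n <= psi s <= ps s n + / 2 * / 3 ^ n.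
  rewrite /psi; case: completeness => x /= [H1 H2]; split; first by apply: H1; exists n.
  by apply: H2 => y [m ->]; exact: ub.
exists psi; split=> [s|s t st E].
  have := psiP s 0%N; rewrite /ps /=; case: (s 0%N); lra.
have dif : exists n, s n != t n.
  apply: NNPP => H; apply: st; apply: functional_extensionality => n.
  by apply/eqP; apply/negP => /negP ?; apply: H; exists n.
case: (ex_minnP dif) => k kdif kmin.
have agree i : (i < k)%N -> s i = t i.
  by move=> ik; apply/eqP; apply/negP => /negP /kmin; lia.
have A := psiP s k; have B := psiP t k; rewrite E in A.
have [c [Es Et]] : exists c, ps s k = c + (if s k then 1 else 0) / 3 ^ k /\
                             ps t k = c + (if t k then 1 else 0) / 3 ^ k.
  case: k agree {kdif kmin A B} => [|k] agree; first by exists 0; rewrite /ps /= !Rplus_0_l.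
  exists (ps s k); rewrite /ps !tech5; split => //; congr (_ + _).
  by apply: PartSum.sum_eq => i /leP ik; rewrite agree.
move: kdif A B; rewrite Es Et /Rdiv; have := pow3 k.
by case: (s k); case: (t k) => //; lra.
Qed.

Lemma cubic_root : exists lam rho phi : R,
  [/\ 3 / 2 < lam < 8 / 5, lam ^ 3 = lam + 2, 0 < rho /\ rho ^ 2 = lam ^ 2 - 1,
      2 * rho * cos phi = - lam & 0 < sin phi].
Proof.
pose f x := x * x * x - x - 2.
have [||||lam [[l1 l2] fl]] := @IVT f (3 / 2) (8 / 5).
- by rewrite /f; reg.
- by lra.
- by rewrite /f; lra.
- by rewrite /f; lra.
have lo : 3 / 2 < lam by case: (Rle_lt_or_eq _ _ l1) => // E; move: fl; rewrite /f -E; lra.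
have hi : lam < 8 / 5 by case: (Rle_lt_or_eq _ _ l2) => // E; move: fl; rewrite /f E; lra.
have p : 0 < lam ^ 2 - 1 by nra.
pose rho := sqrt (lam ^ 2 - 1).
have r0 : 0 < rho by apply: sqrt_lt_R0.
have r2 : rho ^ 2 = lam ^ 2 - 1 by apply: pow2_sqrt; lra.
(* This puts the cosine - lam / (2 rho) strictly above -1, so the remaining two roots are not real
   and the arccosine has positive sine. *)
have rl : lam < 2 * rho by nra.
pose x := - lam / (2 * rho).
have xE : 2 * rho * x = - lam by rewrite /x; field; lra.
have x1 : -1 < x < 0 by split; nra.
exists lam, rho, (acos x); split=> //.
- by move: fl; rewrite /f /=; lra.
- by rewrite cos_acos; lra.
- by rewrite sin_acos; [apply: sqrt_lt_R0; rewrite /Rsqr; nra | lra].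
Qed.

End CantorReals.

(** Everything that the algebraic part uses from the plane; the real numbers do not occur after
    it. *)
Lemma cone_family : exists cone : (nat -> bool) -> triple -> bool,
  [/\ forall s, cone s t0 = false,
      forall s d e b, cone s d = b -> cone s e = b -> cone s (tadd d e) = b,
      forall s b (L : seq triple),
        (forall d, d \in L -> d <> t0 /\ cone s d = b) ->
        exists N, forall k n, (N <= k)%N -> admissible n -> nsum L k (tri n) -> False &
      forall s t, s <> t -> exists n, cone s (vdeg n) <> cone t (vdeg n)].
Proof.
have [lam [rho [phi [[l1 l2] l3 [r1 r2] c1 s1]]]] := cubic_root.
have [psi [p1 p2]] := cantor_reals.
exists (cone rho phi psi); split.
- exact: cone0.
- exact: coneD.
- exact: (@cone_nsum_bound lam).
- exact: (@cone_separated lam).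
Qed.

(** * Graded algebras *)

Lemma tri_nadd (n1 n2 : nat -> nat) :
  tri (fun j => n1 j + n2 j)%N = tadd (tri n1) (tri n2).
Proof. by []. Qed.

Lemma tadd0t d : tadd t0 d = d.
Proof. by case: d => [[a b] c]. Qed.

Lemma taddC d e : tadd d e = tadd e d.
Proof.
by case: d => [[a b] c]; case: e => [[a' b'] c'] /=; congr (_, _, _); rewrite addnC.
Qed.

Lemma taddA d e f : tadd d (tadd e f) = tadd (tadd d e) f.
Proof.
case: d => [[a b] c]; case: e => [[a' b'] c']; case: f => [[a'' b''] c''] /=.
by rewrite !addnA.
Qed.

Lemma nsumD L k l d e : nsum L k d -> nsum L l e -> nsum L (k + l) (tadd d e).
Proof.
move=> Hd He; elim: Hd => [|k' d' e' d'L _ IH]; first by rewrite tadd0t.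
by rewrite -taddA addSn; apply: nsumS.
Qed.

Lemma nsum1 L d : d \in L -> nsum L 1 d.
Proof.
by move=> dL; have := nsumS dL (nsum0 L); rewrite taddC tadd0t.
Qed.

Section GradedAlgebra.
Variables (K : fieldType) (A : alg K) (X : car A -> Prop).
Variables (I : Type) (supp : car A -> I -> Prop) (W : I -> (nat -> nat) -> Prop).

Definition Wadd (i1 i2 i : I) : Prop := forall n1 n2, W i1 n1 -> W i2 n2 ->
  W i (fun j => n1 j + n2 j)%N.

(** Supports replace homogeneous components, since an element can have infinitely many nonzero
    coefficients. [W] is a relation because an index need not have letter counts; [C] tells from
    which indices an index of a product can arise. *)
Record graded (C : I -> I -> I -> Prop) : Prop := Graded {
  g_sub : is_subalg X;
  g_0 : forall i, ~ supp (az A) i;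
  g_sep : forall x, X x -> (forall i, ~ supp x i) -> x = az A;
  g_add : forall x y i, X x -> X y -> supp (aadd A x y) i -> supp x i \/ supp y i;
  g_scale : forall c x i, X x -> supp (ascale A c x) i -> supp x i;
  g_pe : forall x i, X x -> supp (ape A x) i -> supp x i;
  g_po : forall x i, X x -> supp (apo A x) i -> supp x i;
  g_op : forall f x y i, InL f (aops A) -> X x -> X y -> supp (f x y) i ->
    exists i1 i2, [/\ supp x i1, supp y i2 & C i1 i2 i];
  g_sq : forall x i, X x -> is_odd x -> supp (asq A x) i ->
    exists i1 i2, [/\ supp x i1, supp x i2 & C i1 i2 i];
  g_Wadd : forall i1 i2 i, C i1 i2 i -> Wadd i1 i2 i;
  g_W : forall x i, X x -> supp x i -> exists n, W i n;
  g_adm : forall i n, W i n -> admissible n;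
  g_uniq : forall i n n', W i n -> W i n' -> tri n = tri n'
}.

Definition hom (d : triple) (x : car A) : Prop :=
  forall i n, supp x i -> W i n -> tri n = d.

Section Hom.
Variable (C : I -> I -> I -> Prop) (G : graded C).

Lemma hom_scale d c x : X x -> hom d x -> hom d (ascale A c x).
Proof. by move=> Xx H i n /(g_scale G Xx); apply: H. Qed.

Lemma hom_pe d x : X x -> hom d x -> hom d (ape A x).
Proof. by move=> Xx H i n /(g_pe G Xx); apply: H. Qed.

Lemma hom_po d x : X x -> hom d x -> hom d (apo A x).
Proof. by move=> Xx H i n /(g_po G Xx); apply: H. Qed.

Lemma hom_op d e f x y : InL f (aops A) -> X x -> X y ->
  hom d x -> hom e y -> hom (tadd d e) (f x y).
Proof.
move=> fA Xx Xy Hx Hy i n /(g_op G fA Xx Xy)[i1 [i2 [s1 s2 c]]] Wn.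
have [n1 W1] := g_W G Xx s1; have [n2 W2] := g_W G Xy s2.
rewrite (g_uniq G Wn (g_Wadd G c W1 W2)) tri_nadd.
by rewrite (Hx _ _ s1 W1) (Hy _ _ s2 W2).
Qed.

Lemma hom_sq d x : X x -> is_odd x -> hom d x -> hom (tadd d d) (asq A x).
Proof.
move=> Xx ox Hx i n /(g_sq G Xx ox)[i1 [i2 [s1 s2 c]]] Wn.
have [n1 W1] := g_W G Xx s1; have [n2 W2] := g_W G Xx s2.
rewrite (g_uniq G Wn (g_Wadd G c W1 W2)) tri_nadd.
by rewrite (Hx _ _ s1 W1) (Hx _ _ s2 W2).
Qed.

End Hom.

(* Elements over a [bar] index are the barred ones of a Kantor double, and the
   only one of degree zero is the multiple of 1bar, over a [unit] index. *)
Variables (bar unit : I -> bool).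

(** The last clause reflects that 1bar has zero product with every barred element. *)
Definition kcompose (i1 i2 i : I) : Prop :=
  [/\ Wadd i1 i2 i, bar i = bar i1 (+) bar i2 &
      bar i1 -> bar i2 -> ~~ unit i1 /\ ~~ unit i2].

Variable G : graded kcompose.
Hypothesis unit_bar : forall i, unit i -> bar i.
Hypothesis unit_deg : forall i n, unit i -> W i n -> tri n = t0.
Hypothesis deg_unit : forall x i n, X x -> supp x i -> W i n -> tri n = t0 -> unit i.
Hypothesis degs_fin : forall x, X x ->
  exists L : seq triple, forall i n, supp x i -> W i n -> tri n \in L.
Hypothesis split : forall (P : triple -> bool) x, P t0 = false -> X x ->
  exists a b, [/\ X a, X b, x = aadd A a b,
    forall i n, supp a i -> W i n -> P (tri n) = true &
    forall i n, supp b i -> W i n -> P (tri n) = false].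
Hypothesis has_vdeg : forall n, exists x i, [/\ X x, supp x i & hom (vdeg n) x].

Section OneCone.
Variables (P : triple -> bool) (b : bool).
Hypothesis PD : forall d e, P d = b -> P e = b -> P (tadd d e) = b.
Hypothesis Pbound : forall L : seq triple,
  (forall d, d \in L -> d <> t0 /\ P d = b) ->
  exists N, forall k n, (N <= k)%N -> admissible n -> nsum L k (tri n) -> False.

Definition part (x : car A) : Prop :=
  X x /\ forall i n, supp x i -> W i n -> P (tri n) = b.

Lemma part_subalg : is_subalg part.
Proof.
have [X0 XD XZ Xp [Xop Xsq]] := g_sub G; split.
- by split=> // i n /(g_0 G).
- move=> x y [Xx Hx] [Xy Hy]; split; first exact: XD.
  by move=> i n /(g_add G Xx Xy)[]; [apply: Hx | apply: Hy].
- by move=> c x [Xx Hx]; split; [apply: XZ | move=> i n /(g_scale G Xx); apply: Hx].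
- move=> x [Xx Hx]; have [Xe Xo] := Xp _ Xx; split; split=> // i n.
    by move/(g_pe G Xx); apply: Hx.
  by move/(g_po G Xx); apply: Hx.
- split.
  + move=> f x y fA [Xx Hx] [Xy Hy]; split; first exact: Xop.
    move=> i n /(g_op G fA Xx Xy)[i1 [i2 [s1 s2 [c _ _]]]] Wn.
    have [n1 W1] := g_W G Xx s1; have [n2 W2] := g_W G Xy s2.
    rewrite (g_uniq G Wn (c _ _ W1 W2)) tri_nadd.
    by apply: PD; [apply: Hx W1 | apply: Hy W2].
  + move=> x [Xx Hx] ox; split; first exact: Xsq.
    move=> i n /(g_sq G Xx ox)[i1 [i2 [s1 s2 [c _ _]]]] Wn.
    have [n1 W1] := g_W G Xx s1; have [n2 W2] := g_W G Xx s2.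
    rewrite (g_uniq G Wn (c _ _ W1 W2)) tri_nadd.
    by apply: PD; [apply: Hx W1 | apply: Hx W2].
Qed.

Section FinitelyGenerated.
Variables (S : seq (car A)) (L : seq triple).
Hypothesis SX : forall x, InL x S -> X x.
Hypothesis SL : forall x i n, InL x S -> supp x i -> W i n -> ~~ unit i -> tri n \in L.

Lemma gen_sub x : gen S x -> X x.
Proof.
have [X0 XD XZ Xp [Xop Xsq]] := g_sub G.
elim=> {x} [x /SX| | x y _ Xx _ Xy | c x _ Xx | x _ Xx | x _ Xx
           | f x y fA _ Xx _ Xy | x _ Xx ox] //.
- exact: XD.
- exact: XZ.
- by case: (Xp _ Xx).
- by case: (Xp _ Xx).
- exact: Xop.
- exact: Xsq.
Qed.

Let degs (k0 : I -> nat -> Prop) x :=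
  forall i n, supp x i -> W i n -> unit i \/ exists k, nsum L k (tri n) /\ k0 i k.

(** At most one factor lies over a unit index; the other one is then unbarred and already has the
    degree of the product. Without a unit the counts add up. *)
Let degs_comp i1 i2 i n n1 n2 (k0 : I -> nat -> Prop) (k1 k2 : I -> nat -> Prop) :
  kcompose i1 i2 i -> W i n -> W i1 n1 -> W i2 n2 ->
  (unit i1 \/ exists k, nsum L k (tri n1) /\ k1 i1 k) ->
  (unit i2 \/ exists k, nsum L k (tri n2) /\ k2 i2 k) ->
  (forall k l, k1 i1 k -> k2 i2 l -> k0 i (k + l)%N) ->
  (forall k, bar i -> ~~ bar i1 -> k1 i1 k -> k0 i k) ->
  (forall k, bar i -> ~~ bar i2 -> k2 i2 k -> k0 i k) ->
  unit i \/ exists k, nsum L k (tri n) /\ k0 i k.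
Proof.
move=> [c bi nu] Wn W1 W2 H1 H2 h12 h1 h2.
rewrite (g_uniq G Wn (c _ _ W1 W2)) tri_nadd.
case: H1 => [u1 | [k [S1 kk1]]]; case: H2 => [u2 | [l [S2 kk2]]].
- by have [] := nu (unit_bar u1) (unit_bar u2); rewrite u1.
- right; exists l; rewrite (unit_deg u1 W1) tadd0t; split=> //.
  have b2 : ~~ bar i2.
    by apply/negP => b2; have [] := nu (unit_bar u1) b2; rewrite u1.
  by apply: h2 => //; rewrite bi (unit_bar u1) (negbTE b2).
- right; exists k; rewrite (unit_deg u2 W2) taddC tadd0t; split=> //.
  have b1 : ~~ bar i1.
    by apply/negP => b1; have [] := nu b1 (unit_bar u2); rewrite u2.
  by apply: h1 => //; rewrite bi (unit_bar u2) (negbTE b1).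
- by right; exists (k + l)%N; split; [apply: nsumD | apply: h12].
Qed.

(** The count has to be positive so that a single generated element, a product of length 1, starts
    the induction on [rate]. *)
Lemma gen_degs x : gen S x -> degs (fun _ k => 0 < k)%N x.
Proof.
elim=> {x} [x xS| | x y gx Hx gy Hy | c x gx Hx | x gx Hx | x gx Hx
           | f x y fA gx Hx gy Hy | x gx Hx ox] i n.
- move=> s Wn; case: (boolP (unit i)) => [|nu]; [by left | right].
  by exists 1%N; split=> //; apply: nsum1; apply: SL s Wn nu.
- by move/(g_0 G).
- by move=> /(g_add G (gen_sub gx) (gen_sub gy))[]; [apply: Hx | apply: Hy].
- by move/(g_scale G (gen_sub gx)); apply: Hx.
- by move/(g_pe G (gen_sub gx)); apply: Hx.
- by move/(g_po G (gen_sub gx)); apply: Hx.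
- move=> /(g_op G fA (gen_sub gx) (gen_sub gy))[i1 [i2 [s1 s2 c]]] Wn.
  have [n1 W1] := g_W G (gen_sub gx) s1; have [n2 W2] := g_W G (gen_sub gy) s2.
  apply: (degs_comp c Wn W1 W2 (Hx _ _ s1 W1) (Hy _ _ s2 W2)) => *; lia.
- move=> /(g_sq G (gen_sub gx) ox)[i1 [i2 [s1 s2 c]]] Wn.
  have [n1 W1] := g_W G (gen_sub gx) s1; have [n2 W2] := g_W G (gen_sub gx) s2.
  apply: (degs_comp c Wn W1 W2 (Hx _ _ s1 W1) (Hx _ _ s2 W2)) => *; lia.
Qed.

(* Multiplying by 1bar does not raise the degree, but it turns an unbarred
   element into a barred one, and two barred elements are needed to get back:
   so 1bar makes up at most about two thirds of a nonzero product. *)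
Let rate m i k := (m + (if bar i then 1 else 2) <= 3 * k)%N.

Lemma pw_degs m x : pw (gen S) m x ->
  X x /\ forall i n, supp x i -> W i n ->
    (unit i && (m <= 1))%N \/ exists k, nsum L k (tri n) /\ rate m i k.
Proof.
have [X0 XD XZ _ [Xop Xsq]] := g_sub G.
have comp m1 m2 i1 i2 i n n1 n2 : kcompose i1 i2 i -> W i n -> W i1 n1 -> W i2 n2 ->
    ((unit i1 && (m1 <= 1))%N \/ exists k, nsum L k (tri n1) /\ rate m1 i1 k) ->
    ((unit i2 && (m2 <= 1))%N \/ exists k, nsum L k (tri n2) /\ rate m2 i2 k) ->
    (unit i && (m1 + m2 <= 1))%N \/ exists k, nsum L k (tri n) /\ rate (m1 + m2) i k.
  move=> [c bi nu] Wn W1 W2.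
  rewrite (g_uniq G Wn (c _ _ W1 W2)) tri_nadd /rate bi.
  (* Two units are impossible. A unit next to an unbarred factor adds at most 1 to the length and
     makes the product barred, which lowers the constant in [rate] from 2 to 1. Two barred factors
     contribute 1 each, the constant 2 of their unbarred product. *)
  case=> [/andP[u1 l1] | [k [S1 kk1]]]; case=> [/andP[u2 l2] | [l [S2 kk2]]]; right.
  - by have [] := nu (unit_bar u1) (unit_bar u2); rewrite u1.
  - exists l; rewrite (unit_deg u1 W1) tadd0t; split=> //; move: kk2 nu.
    rewrite (unit_bar u1) u1; case: (bar i2) => /=; last by lia.
    by move=> _ /(_ isT isT)[].
  - exists k; rewrite (unit_deg u2 W2) taddC tadd0t; split=> //; move: kk1 nu.
    rewrite (unit_bar u2) u2; case: (bar i1) => /=; last by lia.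
    by move=> _ /(_ isT isT)[].
  - exists (k + l)%N; split; first exact: nsumD.
    by move: kk1 kk2; case: (bar i1); case: (bar i2) => /=; lia.
elim=> {m x} [x gx | m | m x y _ [Xx Hx] _ [Xy Hy] | m c x _ [Xx Hx]
             | f m1 m2 x y fA _ [Xx Hx] _ [Xy Hy] | m x _ [Xx Hx] ox].
- split; first exact: gen_sub.
  move=> i n s Wn; case: (gen_degs gx s Wn) => [-> | [k [Sk k0]]]; [by left | right].
  by exists k; split=> //; rewrite /rate; case: (bar i); lia.
- by split=> // i n /(g_0 G).
- split; first exact: XD.
  by move=> i n /(g_add G Xx Xy)[]; [apply: Hx | apply: Hy].
- by split; [apply: XZ | move=> i n /(g_scale G Xx); apply: Hx].
- split; first exact: Xop.
  move=> i n /(g_op G fA Xx Xy)[i1 [i2 [s1 s2 c]]] Wn.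
  have [n1 W1] := g_W G Xx s1; have [n2 W2] := g_W G Xy s2.
  exact: (comp _ _ _ _ _ _ _ _ c Wn W1 W2 (Hx _ _ s1 W1) (Hy _ _ s2 W2)).
- split; first exact: Xsq.
  move=> i n /(g_sq G Xx ox)[i1 [i2 [s1 s2 c]]] Wn.
  have [n1 W1] := g_W G Xx s1; have [n2 W2] := g_W G Xx s2.
  rewrite mul2n -addnn.
  exact: (comp _ _ _ _ _ _ _ _ c Wn W1 W2 (Hx _ _ s1 W1) (Hx _ _ s2 W2)).
Qed.

End FinitelyGenerated.

Lemma part_locally_nilpotent : locally_nilpotent part.
Proof.
move=> S SP.
have SX x : InL x S -> X x by case/SP.
have [L0 HL0] : exists L0 : seq triple,
    forall x i n, InL x S -> supp x i -> W i n -> tri n \in L0.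
  elim: S SX {SP} => [|y S IHS] SX; first by exists [::].
  have [|L1 H1] := IHS; first by move=> x xS; apply: SX; right.
  have [|L2 H2] := @degs_fin y; first by apply: SX; left.
  exists (L2 ++ L1) => x i n /= [<- | xS] s Wn; rewrite mem_cat.
    by rewrite (H2 _ _ s Wn).
  by rewrite (H1 _ _ _ xS s Wn) orbT.
(* Within one part degree 0 occurs at unit indices alone; it is dropped to meet the hypothesis of
   [Pbound]. *)
pose L := [seq d <- L0 | (d != t0) && (P d == b)].
have SL x i n : InL x S -> supp x i -> W i n -> ~~ unit i -> tri n \in L.
  move=> xS s Wn nu; rewrite mem_filter (HL0 _ _ _ xS s Wn) andbT.
  apply/andP; split; last by apply/eqP; case: (SP _ xS) => _; apply; eassumption.
  by apply: contra nu => /eqP E; apply: deg_unit (SX _ xS) s Wn E.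
have [|N HN] := Pbound (L := L).
  by move=> d; rewrite mem_filter => /andP[/andP[/eqP ? /eqP ?] _].
(* By [rate] such a length forces k >= N at every index of the support; being at least 2 it also
   excludes the unit index. *)
exists (3 * N + 2)%N => m x Nm /(pw_degs SX SL)[Xx Hx].
apply: (g_sep G Xx) => i s; have [n Wn] := g_W G Xx s.
case: (Hx _ _ s Wn) => [/andP[_]|[k [Sk rk]]]; first by lia.
apply: (HN k n) => //; last (by apply: (g_adm G) Wn).
by move: rk; case: (bar i); lia.
Qed.

End OneCone.

Theorem graded_continuum : continuum_ln_decompositions X.
Proof.
have [cone [c0 cD cB cS]] := cone_family.
exists (fun s => (part (cone s) true, part (cone s) false)); split=> [s | s t st].
  split=> /=.
  - by split; apply: part_subalg => d e; apply: cD.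
  - by split; apply: part_locally_nilpotent; exact: cB.
  - by split=> x [].
  - move=> x Xx; have [a [b [Xa Xb E Ha Hb]]] := split (c0 s) Xx.
    by exists a, b.
  - move=> x [Xx H1] [_ H2]; apply: (g_sep G Xx) => i si.
    have [n Wn] := g_W G Xx si.
    by have := H1 _ _ si Wn; rewrite (H2 _ _ si Wn).
(* A nonzero homogeneous element of degree [vdeg n] lies in exactly one of the two parts and so
   reveals the side of that degree. *)
move=> [/= E1 E2]; have [n Hn] := cS _ _ st.
have [x [i [Xx si hx]]] := has_vdeg n; have [k Wk] := g_W G Xx si.
have In u : part (cone u) (cone u (vdeg n)) x.
  by split=> // j l sj Wl; rewrite (hx _ _ sj Wl).
have Out u b : part (cone u) b x -> cone u (vdeg n) = b.
  by case=> _ /(_ _ _ si Wk); rewrite (hx _ _ si Wk).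
apply: Hn; have := In s; case E: (cone s (vdeg n)).
  by move/E1/Out.
by move/E2/Out.
Qed.

End GradedAlgebra.

(** * Generated elements as finite sums of homogeneous ones *)

Section HomogeneousSpan.
Variables (K : fieldType) (A : alg K) (S : seq (car A)).
Variables (I : Type) (supp : car A -> I -> Prop) (W : I -> (nat -> nat) -> Prop).
Variables (C : I -> I -> I -> Prop).

Local Notation X := (gen (A := A) S).
Local Notation hom := (hom supp W).
Local Notation "x +' y" := (aadd A x y) (at level 50, left associativity).

(** Additivity of the products is required on generated elements only, because a carrier of
    operators also contains maps that are not linear. [l_sqD] polarises the square by one of the
    products. *)
Record linear_ops : Prop := LinearOps {
  l_addA : forall x y z : car A, x +' (y +' z) = x +' y +' z;
  l_addC : forall x y : car A, x +' y = y +' x;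
  l_add0 : forall x, az A +' x = x;
  l_scaleD : forall c x y, ascale A c (x +' y) = ascale A c x +' ascale A c y;
  l_scale0 : forall c, ascale A c (az A) = az A;
  l_peD : forall x y, ape A (x +' y) = ape A x +' ape A y;
  l_pe0 : ape A (az A) = az A;
  l_poD : forall x y, apo A (x +' y) = apo A x +' apo A y;
  l_po0 : apo A (az A) = az A;
  l_poK : forall x, X x -> apo A (apo A x) = apo A x;
  l_opDl : forall f x y z, InL f (aops A) -> X x -> X y -> X z ->
    f (x +' y) z = f x z +' f y z;
  l_opDr : forall f x y z, InL f (aops A) -> X x -> X y -> X z ->
    f z (x +' y) = f z x +' f z y;
  l_op0l : forall f z, InL f (aops A) -> X z -> f (az A) z = az A;
  l_op0r : forall f z, InL f (aops A) -> X z -> f z (az A) = az A;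
  l_sq0 : asq A (az A) = az A;
  l_sqD : exists2 f, InL f (aops A) & forall x y, X x -> X y -> is_odd x -> is_odd y ->
    asq A (x +' y) = asq A x +' asq A y +' f x y
}.

Hypothesis lin : linear_ops.
Hypothesis G : graded X supp W C.
Hypothesis Shom : forall x, InL x S -> exists d, hom d x.

(** The summands are themselves generated, so that grouping them by side splits an element inside
    the algebra, and their number bounds the number of its degrees. *)
Inductive hspan : car A -> Prop :=
| hspan0 : hspan (az A)
| hspanD d x y : X x -> hom d x -> hspan y -> hspan (x +' y).

Lemma hspan_gen x : hspan x -> X x.
Proof. by elim=> {x} [|d x y gx _ _ gy]; [apply: gen_0 | apply: gen_add]. Qed.

Lemma hspan1 d x : X x -> hom d x -> hspan x.
Proof.
move=> gx hx; have -> : x = x +' az A by rewrite (l_addC lin) (l_add0 lin).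
exact: hspanD gx hx hspan0.
Qed.

Lemma hspan_add x y : hspan x -> hspan y -> hspan (x +' y).
Proof.
move=> hx hy; elim: hx => {x} [|d x z gx dx _ IH]; first by rewrite (l_add0 lin).
by rewrite -(l_addA lin); apply: hspanD dx IH.
Qed.

Lemma hspan_map (f : car A -> car A) :
    f (az A) = az A -> (forall x y, X x -> X y -> f (x +' y) = f x +' f y) ->
    (forall d x, X x -> hom d x -> hspan (f x)) ->
  forall x, hspan x -> hspan (f x).
Proof.
move=> f0 fD fh x; elim=> {x} [|d x y gx dx hy IH]; first by rewrite f0; apply: hspan0.
rewrite fD //; last exact: hspan_gen.
by apply: hspan_add IH; apply: fh dx.
Qed.

Lemma hspan_pe x : hspan x -> hspan (ape A x).
Proof.
apply: hspan_map => [|y z _ _|d y gy dy]; first exact: (l_pe0 lin).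
  exact: (l_peD lin _ _).
by apply: (@hspan1 d); [apply: gen_pe | exact: (hom_pe G gy dy)].
Qed.

Lemma hspan_po x : hspan x -> hspan (apo A x).
Proof.
apply: hspan_map => [|y z _ _|d y gy dy]; first exact: (l_po0 lin).
  exact: (l_poD lin _ _).
by apply: (@hspan1 d); [apply: gen_po | exact: (hom_po G gy dy)].
Qed.

Lemma hspan_scale c x : hspan x -> hspan (ascale A c x).
Proof.
apply: hspan_map => [|y z _ _|d y gy dy]; first exact: (l_scale0 lin _).
  exact: (l_scaleD lin _ _ _).
by apply: (@hspan1 d); [apply: gen_scale | by apply: (hom_scale G)].
Qed.

Lemma hspan_op f x y : InL f (aops A) -> hspan x -> hspan y -> hspan (f x y).
Proof.
move=> fA hx hy; have gy := hspan_gen hy.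
apply: (@hspan_map (fun x => f x y)) hx => [|a b ga gb|d a ga da].
- exact: (l_op0l lin fA gy).
- exact: (l_opDl lin fA _ _ _).
apply: (@hspan_map (f a)) hy => [|b c gb gc|e b gb eb].
- exact: (l_op0r lin fA ga).
- exact: (l_opDr lin fA _ _ _).
by apply: (@hspan1 (tadd d e)); [apply: gen_op | exact: (hom_op G fA ga gb da eb)].
Qed.

(** Homogeneous summands of an odd element need not be odd, but their odd parts are. Phrased with
    [apo], the claim allows polarisation summand by summand. *)
Lemma hspan_sq x : hspan x -> hspan (asq A (apo A x)).
Proof.
have [f fA sqD] := l_sqD lin.
elim=> {x} [|d x y gx dx hy IH].
  by rewrite (l_po0 lin) (l_sq0 lin); apply: hspan0.
have gy := hspan_gen hy.
have ox : is_odd (apo A x) by apply: (l_poK lin).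
have oy : is_odd (apo A y) by apply: (l_poK lin).
have gpx : X (apo A x) by apply: gen_po.
have gpy : X (apo A y) by apply: gen_po.
have dpx := hom_po G gx dx.
rewrite (l_poD lin) sqD //; apply: hspan_add.
  apply: hspan_add IH; apply: (@hspan1 (tadd d d)); first exact: gen_sq.
  exact: (hom_sq G gpx ox dpx).
by apply: hspan_op fA _ (hspan_po hy); apply: hspan1 dpx.
Qed.

Lemma gen_hspan x : X x -> hspan x.
Proof.
elim=> {x} [x xS | | x y _ hx _ hy | c x _ hx | x _ hx | x _ hx
           | f x y fA _ hx _ hy | x _ hx ox].
- by have [d dx] := Shom xS; apply: hspan1 dx; apply: gen_in.
- exact: hspan0.
- exact: hspan_add.
- exact: hspan_scale.
- exact: hspan_pe.
- exact: hspan_po.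
- exact: hspan_op.
- by rewrite -ox; apply: hspan_sq.
Qed.

Lemma gen_degs_fin x : X x ->
  exists L : seq triple, forall i n, supp x i -> W i n -> tri n \in L.
Proof.
move/gen_hspan; elim=> {x} [|d x y gx dx hy [L HL]].
  by exists [::] => i n /(g_0 G).
exists (d :: L) => i n /(g_add G gx (hspan_gen hy))[s|s] Wn; rewrite inE.
  by rewrite (dx _ _ s Wn) eqxx.
by rewrite (HL _ _ s Wn) orbT.
Qed.

Lemma gen_split (P : triple -> bool) x : X x ->
  exists a b, [/\ X a, X b, x = a +' b,
    forall i n, supp a i -> W i n -> P (tri n) = true &
    forall i n, supp b i -> W i n -> P (tri n) = false].
Proof.
move/gen_hspan; elim=> {x} [|d x y gx dx hy [a [b [ga gb -> Ha Hb]]]].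
  exists (az A), (az A); split; rewrite ?(l_add0 lin) //; try exact: gen_0.
    by move=> i n /(g_0 G).
  by move=> i n /(g_0 G).
case Pd: (P d).
  exists (x +' a), b; split=> //; first exact: gen_add.
    exact: (l_addA lin _ _ _).
  move=> i n /(g_add G gx ga)[s|s] Wn; last exact: Ha s Wn.
  by rewrite (dx _ _ s Wn).
exists a, (x +' b); split=> //; first exact: gen_add.
  by rewrite !(l_addA lin) (l_addC lin a).
move=> i n /(g_add G gx gb)[s|s] Wn; last exact: Hb s Wn.
by rewrite (dx _ _ s Wn).
Qed.

End HomogeneousSpan.

(** For Q, A and P no index is barred, so the clauses on bars and units become empty. *)
Lemma graded_kcompose (K : fieldType) (A : alg K) (X : car A -> Prop)
    (I : Type) (supp : car A -> I -> Prop) (W : I -> (nat -> nat) -> Prop) C :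
  graded X supp W C -> graded X supp W (kcompose W pred0 pred0).
Proof.
case=> h1 h2 h3 h4 h5 h6 h7 h8 h9 h10 h11 h12 h13; split=> //.
- move=> f x y i fA Xx Xy /(h8 _ _ _ _ fA Xx Xy)[i1 [i2 [s1 s2 /h10 c]]].
  by exists i1, i2.
- move=> x i Xx ox /(h9 _ _ Xx ox)[i1 [i2 [s1 s2 /h10 c]]].
  by exists i1, i2.
- by move=> i1 i2 i [].
Qed.

Lemma gen_subalg (K : fieldType) (A : alg K) (S : seq (car A)) : is_subalg (gen S).
Proof.
split; first exact: gen_0.
- by move=> x y; apply: gen_add.
- by move=> c x; apply: gen_scale.
- by move=> x Hx; split; [apply: gen_pe | apply: gen_po].
- by split; [move=> f x y fA; apply: gen_op | move=> x; apply: gen_sq].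
Qed.

Lemma graded_sub (K : fieldType) (A : alg K) (X Y : car A -> Prop) (I : Type)
    (supp : car A -> I -> Prop) W C :
  (forall x, Y x -> X x) -> is_subalg Y -> graded X supp W C -> graded Y supp W C.
Proof.
move=> YX Ys [h1 h2 h3 h4 h5 h6 h7 h8 h9 h10 h11 h12 h13]; split=> //.
- by move=> x /YX; apply: h3.
- by move=> x y i /YX ? /YX; apply: h4.
- by move=> c x i /YX; apply: h5.
- by move=> x i /YX; apply: h6.
- by move=> x i /YX; apply: h7.
- by move=> f x y i fA /YX ? /YX; apply: h8.
- by move=> x i /YX; apply: h9.
- by move=> x i /YX; apply: h11.
Qed.

(** * Degrees of monomials *)

Section Balanced.

Definition finsupp_balanced (a b n : nat -> nat) : Prop :=
  (exists J, forall j, (J <= j)%N -> n j = 0%N) /\ balanced n a b.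

(** Downward induction from where both vanish: the balance at j expresses n_j by later values. So
    the degree depends on the monomial alone and not on a word producing it. *)
Lemma fb_uniq a b n n' :
  finsupp_balanced a b n -> finsupp_balanced a b n' -> tri n = tri n'.
Proof.
move=> [[J HJ] Hn] [[J' HJ'] Hn'].
suff E k j : (J + J' <= j + k)%N -> n j = n' j by rewrite /tri !(E (J + J')) //; lia.
elim: k j => [|k IHk] j H; first by rewrite HJ ?HJ' //; lia.
have := Hn j; have := Hn' j; rewrite (IHk (j + 3)%N); last by lia.
case: j H => [|j] H; first by lia.
by rewrite (IHk (j + 3)%N); lia.
Qed.

(** The equations are linear and see a and b only through b - a, so a cancelled pair of an x_j and a
    d_j does not affect the degree. *)
Lemma fb_add a b n a' b' n' a'' b'' : finsupp_balanced a b n ->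
    finsupp_balanced a' b' n' ->
    (forall j, a'' j + (b j + b' j) = b'' j + (a j + a' j))%N ->
  finsupp_balanced a'' b'' (fun j => n j + n' j)%N.
Proof.
move=> [[J HJ] Hn] [[J' HJ'] Hn'] E; split.
  by exists (J + J')%N => j H; rewrite HJ ?HJ' //; lia.
by move=> j; have := Hn j; have := Hn' j; have := E j; case: j => [|j]; lia.
Qed.

Lemma fb0 : finsupp_balanced (fun=> 0%N) (fun=> 0%N) (fun=> 0%N).
Proof. by split; [exists 0%N | case]. Qed.

Lemma fb_ext a b a' b' n : (forall j, a j = a' j) -> (forall j, b j = b' j) ->
  finsupp_balanced a b n -> finsupp_balanced a' b' n.
Proof. by move=> Ea Eb [H1 H2]; split=> // j; rewrite -Ea -Eb. Qed.

Lemma mem_blk j i k : (j \in blk i k) =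
  [&& i <= j, (j - i) %% 3 != 2 & (j - i) %/ 3 < k]%N.
Proof.
apply/flatten_mapP/idP => [[n] | /and3P[ij j2 jk]].
  by rewrite mem_iota !inE => nk /orP[] /eqP ->; lia.
exists ((j - i) %/ 3)%N; first by rewrite mem_iota; lia.
by rewrite !inE; apply/orP; lia.
Qed.

Lemma blkS i k : blk i k.+1 = i :: (i + 1)%N :: blk (i + 3) k.
Proof.
rewrite /blk /= muln0 addn0 (iotaDl 1 0 k) -map_comp; congr [:: _, _ & flatten _].
by apply: eq_map => n /=; congr [:: _; _]; lia.
Qed.

Lemma blk_sorted i k : sorted ltn (blk i k).
Proof.
elim: k i => [|k IHk] i //; rewrite blkS /= addn1 ltnSn /=.
have /= := IHk (i + 3)%N; case: k {IHk} => // k; rewrite blkS /= => ->.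
by rewrite andbT; lia.
Qed.

(* The term x_i x_{i+1} x_{i+3} ... d_{i+3k} of v_i. *)
Lemma fb_blk i k : (i < 3)%N -> exists2 n,
  finsupp_balanced (fun j => (j \in blk i k) : nat) (fun j => (j == i + 3 * k)%N : nat) n &
  tri n = vdeg i.
Proof.
(* On the way from v_i to this term each of v_i, v_{i+3}, ..., v_{i+3k} is met once. *)
move=> i3; exists (fun j => [&& i <= j, (j - i) %% 3 == 0 & (j - i) %/ 3 <= k]%N : nat).
  split; first by exists (i + 3 * k + 1)%N => j H; lia.
  by case=> [|j]; rewrite mem_blk; lia.
by case: i i3 => [|[|[|]]].
Qed.

End Balanced.

(** * Signs, contractions and candidate pairs of monomials *)

Section Monomials.
Local Open Scope ring_scope.
Variable K : fieldType.

Lemma sum_neq0 (V : nmodType) (T : eqType) (s : seq T) (P : pred T) (F : T -> V) :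
  \sum_(x <- s | P x) F x != 0 -> exists x, [/\ x \in s, P x & F x != 0].
Proof.
move=> H; case: (boolP (has (fun x => P x && (F x != 0)) s)).
  by case/hasP => x xs /andP[]; exists x.
move/hasPn => H'; case/eqP: H; rewrite big_seq_cond big1 // => x /andP[xs Px].
by apply/eqP; move: (H' x xs); rewrite Px /= negbK.
Qed.

Lemma maxl_ge (s : seq nat) x : x \in s -> (x <= maxl s)%N.
Proof.
elim: s => //= y s IHs; rewrite inE => /orP[/eqP -> | /IHs H]; first exact: leq_maxl.
by apply: leq_trans H (leq_maxr _ _).
Qed.

Lemma sgnD m n : sgn K (m + n) = sgn K m * sgn K n.
Proof. exact: exprD. Qed.

Lemma sgn_odd n : sgn K n = if odd n then -1 else 1.
Proof. by rewrite /sgn -signr_odd; case: odd; rewrite ?expr1. Qed.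

Lemma inv_cons x a b : inv (x :: a) b = (count (fun y => y < x) b + inv a b)%N.
Proof. by rewrite /inv big_cons. Qed.

(** Each pair of a letter of a and a letter of b is an inversion in exactly one of the two
    orders. *)
Lemma inv_sym (a b : seq nat) : uniq (a ++ b) -> (inv a b + inv b a = size a * size b)%N.
Proof.
elim: a => [|x a IHa] /=.
  rewrite /inv big_nil mul0n add0n; elim: b => [|y b]; first by rewrite big_nil.
  by rewrite big_cons add0n => IHb /andP[_ /IHb].
case/andP=> xab /IHa {}IHa; rewrite inv_cons mulSn -IHa.
have -> : inv b (x :: a) = (count (fun y => x < y) b + inv b a)%N.
  elim: b {xab IHa} => [|y b IHb]; first by rewrite /inv !big_nil.
  by rewrite !inv_cons IHb /=; lia.
rewrite addnACA; congr (_ + _)%N.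
move: xab; rewrite mem_cat negb_or => /andP[_].
elim: b {IHa} => //= y b IHb; rewrite inE negb_or => /andP[xy /IHb].
by case: ltngtP xy; lia.
Qed.

Lemma pcoef_neq0 (a b t : seq nat) : pcoef K a b t != 0 -> sorted ltn t /\ perm_eq t (a ++ b).
Proof. by rewrite /pcoef; case: andP => // _; rewrite eqxx. Qed.

Lemma pcoef_sym (a b t : seq nat) : ~~ odd (size a) -> pcoef K a b t = pcoef K b a t.
Proof.
move=> ea; rewrite /pcoef perm_sym perm_catC perm_sym; case: andP => // -[st pt].
have u : uniq (b ++ a) by rewrite -(perm_uniq pt) (sorted_uniq ltn_trans ltnn).
have E := inv_sym u; rewrite !sgn_odd.
have : odd (inv b a + inv a b) = false by rewrite E oddM (negbTE ea) andbF.
by rewrite oddD; case: odd; case: odd.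
Qed.

(** The shape of a monomial in a Poisson bracket: 2 j and 2 j + 1 encode the conjugate letters x_j
    and y_j, which are contracted. *)
Definition contracted (p q t : seq nat) : Prop := exists j z1 z2,
  [/\ (z1 = (2 * j).+1 /\ z2 = (2 * j)%N) \/ (z1 = (2 * j)%N /\ z2 = (2 * j).+1),
      z1 \in p, z2 \in q, sorted ltn t & perm_eq t (rem z1 p ++ rem z2 q)].

Lemma dterm_neq0 z1 z2 p q t : dterm K z1 z2 p q t != 0 ->
  [/\ z1 \in p, z2 \in q, sorted ltn t & perm_eq t (rem z1 p ++ rem z2 q)].
Proof.
rewrite /dterm; case: andP => [[zp zq]|]; last by rewrite eqxx.
by rewrite mulf_eq0 negb_or => /andP[_ /pcoef_neq0[]].
Qed.

Lemma mbr_neq0 p q t : mbr K p q t != 0 -> contracted p q t.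
Proof.
rewrite /mbr mulf_eq0 negb_or => /andP[_ /sum_neq0[j [_ _ H]]].
have : (dterm K (2 * j).+1 (2 * j) p q t != 0) || (dterm K (2 * j) (2 * j).+1 p q t != 0).
  by apply: contraNT H; rewrite negb_or !negbK => /andP[/eqP -> /eqP ->]; rewrite addr0.
by case/orP => /dterm_neq0[] *; [exists j, (2 * j).+1, (2 * j)%N | exists j, (2 * j)%N, (2 * j).+1];
  split=> //; [left | right].
Qed.

(** The range in [mbr] depends on the first argument; comparing both orders of the arguments needs a
    common one. *)
Lemma mbr_widen B p q t : (maxl p < B)%N -> mbr K p q t = - sgn K (size p) *
  \sum_(j <- iota 0 B)
    (dterm K (2 * j).+1 (2 * j) p q t + dterm K (2 * j) (2 * j).+1 p q t).
Proof.
move=> /subnKC <-; rewrite /mbr iotaD big_cat /= [X in _ = _ * (_ + X)]big_seq [X in _ + X]big1 ?addr0 //.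
move=> j; rewrite mem_iota add0n => /andP[mj _].
have np z : (j <= z)%N -> (z \in p) = false.
  by move=> jz; apply/negP => /maxl_ge; lia.
by rewrite /dterm !np ?addr0 //; lia.
Qed.

(** Exchanging the arguments exchanges the two terms for each j, and the monomials left after
    contraction have even size, so they commute. *)
Lemma mbr_sym (p q t : seq nat) : odd (size p) -> odd (size q) -> mbr K p q t = mbr K q p t.
Proof.
move=> op oq; pose B := (maxl p + maxl q).+1.
rewrite !(@mbr_widen B); [| by rewrite /B; lia | by rewrite /B; lia].
rewrite !sgn_odd op oq; congr (_ * _); apply: eq_bigr => j _; rewrite addrC.
have D z1 z2 : dterm K z1 z2 p q t = dterm K z2 z1 q p t.
  rewrite /dterm andbC; case: andP => // -[zq zp]; rewrite (mulrC (sgn _ _)).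
  by rewrite pcoef_sym // size_rem //; case: (size p) op => //= ? ->.
by rewrite D [X in _ + X]D.
Qed.

(** An odd monomial containing both x_j and y_j has a third letter; it survives in both contracted
    factors, whose product therefore vanishes. *)
Lemma contracted_diag (p t : seq nat) : odd (size p) -> ~ contracted p p t.
Proof.
move=> op [j [z1 [z2 [zz z1p z2p st pt]]]].
have z12 : z1 != z2 by apply/eqP; lia.
have u : uniq (rem z1 p ++ rem z2 p).
  by rewrite -(perm_uniq pt) (sorted_uniq ltn_trans ltnn).
have P1 := perm_to_rem z1p.
have z2r : z2 \in rem z1 p.
  by move: z2p; rewrite (perm_mem P1) inE eq_sym (negbTE z12).
have P2 := perm_to_rem z2r.
set p' := rem z2 (rem z1 p) in P2.
have sp : size p = (size p').+2.
  by rewrite (perm_size P1) /= (perm_size P2).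
case E: p' => [|w p'']; first by move: op; rewrite sp E.
have w1 : w \in rem z1 p by rewrite (perm_mem P2) E !inE eqxx orbT.
have w2 : w \in rem z2 p.
  have : perm_eq p (z2 :: z1 :: p').
    apply: perm_trans P1 _; apply: (@perm_trans _ (z1 :: z2 :: p')).
      by rewrite perm_cons.
    by apply/permPl; apply: (perm_catCA [:: z1] [:: z2] p').
  move=> P3; have : perm_eq (z2 :: rem z2 p) (z2 :: z1 :: p').
    by apply: perm_trans P3; rewrite perm_sym; apply: perm_to_rem.
  by rewrite perm_cons => /perm_mem ->; rewrite E !inE eqxx orbT.
by move: u; rewrite cat_uniq => /and3P[_ /hasPn/(_ w w2)]; rewrite /= w1.
Qed.

Lemma mem_subs p t : (p \in subs t) = subseq p t.
Proof.
elim: t p => [|x t IHt] p /=; first by rewrite inE.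
rewrite mem_cat IHt; apply/orP/idP => [[/mapP[q qs ->] | H] | ].
- by rewrite /= eqxx -IHt.
- by apply: subseq_trans H (subseq_cons _ _).
- case: p => [|y p]; first by right; rewrite sub0seq.
  case: eqP => [-> H | _ H]; last by right.
  by left; apply: map_f; rewrite IHt.
Qed.

Lemma candHP t pq : reflect
  (exists j z1 z2 p, [/\ (j <= maxl t)%N,
    (z1 = (2 * j).+1 /\ z2 = (2 * j)%N) \/ (z1 = (2 * j)%N /\ z2 = (2 * j).+1),
    subseq p t &
    pq = (sort leq (z1 :: p), sort leq (z2 :: [seq y <- t | y \notin p]))])
  (pq \in candH t).
Proof.
rewrite /candH mem_undup; apply: (iffP flatten_mapP).
  move=> [j]; rewrite mem_iota add0n ltnS => jm /flatten_mapP[zz zzP /mapP[p]].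
  rewrite mem_subs => sp E; exists j, zz.1, zz.2, p; split=> //.
  by move: zzP; rewrite !inE => /orP[] /eqP ->; [left | right].
move=> [j [z1 [z2 [p [jm zz sp E]]]]]; exists j; first by rewrite mem_iota add0n ltnS.
apply/flatten_mapP; exists (z1, z2).
  by rewrite !inE; case: zz => -[-> ->]; rewrite eqxx ?orbT.
by apply/mapP; exists p; rewrite ?mem_subs.
Qed.

Definition swap (pq : seq nat * seq nat) := (pq.2, pq.1).

Lemma candH_swap t pq : sorted ltn t -> pq \in candH t -> swap pq \in candH t.
Proof.
move=> st /candHP[j [z1 [z2 [p [jm zz sp ->]]]]]; apply/candHP.
have u : uniq t by rewrite (sorted_uniq ltn_trans ltnn).
exists j, z2, z1, [seq y <- t | y \notin p]; split=> //.
- by case: zz => -[-> ->]; [right | left].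
- exact: filter_subseq.
rewrite /swap /=; congr (_, sort leq (z1 :: _)).
rewrite [LHS](subseq_uniqP u sp); apply: eq_in_filter => y yt.
by rewrite mem_filter yt andbT negbK.
Qed.

Lemma candH_swap_perm t : sorted ltn t -> perm_eq (map swap (candH t)) (candH t).
Proof.
move=> st; have swK : involutive swap by case.
apply: uniq_perm; rewrite ?(map_inj_uniq (inv_inj swK)) ?undup_uniq //.
move=> pq; apply/mapP/idP => [[pq' H ->] | H]; first exact: candH_swap.
by exists (swap pq); rewrite ?swK //; apply: candH_swap.
Qed.

Lemma lexlt_total p q : (lexlt p q + lexlt q p + (p == q) = 1)%N.
Proof.
elim: p q => [|x p IHp] [|y q] //=; rewrite eqseq_cons.
have := IHp q; case: (ltngtP x y) => //= [xy|xy|->] _ //=.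
Qed.

End Monomials.

(** * The Poisson superalgebra *)

Section Poisson.
Local Open Scope ring_scope.
Variable K : fieldType.
Implicit Types (f g h : Hf K) (p q t : seq nat).

(** The letter y_j takes the place of the derivation d_j. *)
Definition Wt t (n : nat -> nat) : Prop := sorted ltn t /\
  finsupp_balanced (fun j => count_mem (2 * j)%N t) (fun j => count_mem (2 * j).+1 t) n.

Definition hsupp f t : Prop := f t != 0.

Lemma Wt_adm t n : Wt t n -> admissible n.
Proof.
move=> [st [_ nb]]; do 2 eexists; split; last exact: nb.
have u : uniq t by rewrite (sorted_uniq ltn_trans ltnn).
by move=> j; rewrite !count_uniq_mem //; split; case: (_ \in _).
Qed.

Lemma Wt_uniq t n n' : Wt t n -> Wt t n' -> tri n = tri n'.
Proof. by move=> [_ H] [_]; apply: fb_uniq. Qed.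

Lemma Wt_nil : Wt [::] (fun=> 0%N).
Proof. by split=> //; apply: fb0. Qed.

Lemma Wt_cat p q t : sorted ltn t -> perm_eq t (p ++ q) -> Wadd Wt p q t.
Proof.
move=> st pt n1 n2 [_ H1] [_ H2]; split=> //; apply: fb_add H1 H2 _ => j.
by rewrite !(permP pt) !count_cat; lia.
Qed.

Lemma Wt_contracted p q t : contracted p q t -> Wadd Wt p q t.
Proof.
move=> [j0 [z1 [z2 [zz z1p z2q st pt]]]] n1 n2 [_ H1] [_ H2]; split=> //.
apply: fb_add H1 H2 _ => j.
have C (z : nat) (s : seq nat) : z \in s -> forall c, (count_mem c (rem z s) + (z == c) = count_mem c s)%N.
  by move=> zs c; rewrite (permP (perm_to_rem zs)) /= addnC.
have := C _ _ z1p (2 * j)%N; have := C _ _ z1p (2 * j).+1.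
have := C _ _ z2q (2 * j)%N; have := C _ _ z2q (2 * j).+1.
by rewrite !(permP pt) !count_cat; case: zz => -[-> ->]; lia.
Qed.

Lemma contracted_nil p t : ~ contracted [::] p t /\ ~ contracted p [::] t.
Proof. by split=> -[j [z1 [z2 []]]]. Qed.

Lemma mul3_neq0 (a b c : K) : a * b * c != 0 -> [/\ a != 0, b != 0 & c != 0].
Proof. by rewrite !mulf_eq0 !negb_or => /andP[/andP[]]. Qed.

Lemma hmul_supp f g t : hsupp (hmul f g) t ->
  exists p q, [/\ hsupp f p, hsupp g q, sorted ltn t & perm_eq t (p ++ q)].
Proof.
case/sum_neq0 => p [_ _]; set q := filter _ _.
move=> /mul3_neq0[fp gq /pcoef_neq0[st pt]].
by exists p, q.
Qed.

Lemma hbr_supp f g t : hsupp (hbr f g) t ->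
  exists p q, [/\ hsupp f p, hsupp g q & contracted p q t].
Proof.
case/sum_neq0 => -[p q] [_ _] /= /mul3_neq0[fp gq /mbr_neq0 c].
by exists p, q.
Qed.

Lemma hsq_supp f t : hsupp (hsq f) t ->
  exists p q, [/\ hsupp f p, hsupp f q & contracted p q t].
Proof.
case/sum_neq0 => -[p q] [_ _] /= /mul3_neq0[fp gq /mbr_neq0 c].
by exists p, q.
Qed.

Lemma hadd_supp f g t : hsupp (hadd f g) t -> hsupp f t \/ hsupp g t.
Proof.
rewrite /hsupp /hadd; case: (eqVneq (f t) 0) => [-> | _]; last by left.
by rewrite add0r; right.
Qed.

Lemma hscale_supp c f t : hsupp (hscale c f) t -> hsupp f t.
Proof. by rewrite /hsupp /hscale mulf_eq0 negb_or => /andP[]. Qed.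

Lemma hpe_supp f t : hsupp (hpe f) t -> hsupp f t.
Proof. by rewrite /hsupp /hpe; case: odd; rewrite ?eqxx. Qed.

Lemma hpo_supp f t : hsupp (hpo f) t -> hsupp f t.
Proof. by rewrite /hsupp /hpo; case: odd; rewrite ?eqxx. Qed.

Lemma VV_neq0 i t : hsupp (VV K i) t -> exists k, t = Lk i k.
Proof.
rewrite /hsupp /VV; case: hasP => [[k _ /eqP] | _]; last by rewrite eqxx.
by exists k.
Qed.

Lemma size_Lk i k : size (Lk i k) = (2 * k).+1.
Proof.
rewrite /Lk size_cat size_map /= addn1; congr _.+1.
by elim: k i => // k IHk i; rewrite blkS /= IHk; lia.
Qed.

Lemma VV_Lk i k : VV K i (Lk i k) = 1.
Proof.
rewrite /VV; case: hasP => // H; case: H; exists k; rewrite ?mem_iota ?size_Lk //.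
by lia.
Qed.

Lemma LkS i k : Lk i k.+1 = (2 * i)%N :: (2 * i.+1)%N :: Lk (i + 3) k.
Proof.
rewrite /Lk blkS /= addn1; congr [:: _, _ & _ ++ [:: _.+1]]; lia.
Qed.

Lemma Lk_path x i k : (x < 2 * i)%N -> path ltn x (Lk i k).
Proof.
elim: k x i => [|k IHk] x i xi; first by rewrite /= muln0 addn0 andbT; lia.
by rewrite LkS /= xi IHk ?andbT; lia.
Qed.

Lemma Lk_sorted i k : sorted ltn (Lk i k).
Proof. by case: k => [|k] //; rewrite LkS /= Lk_path ?andbT; lia. Qed.

Lemma Wt_Lk i k : (i < 3)%N -> exists2 n, Wt (Lk i k) n & tri n = vdeg i.
Proof.
move=> i3; have [n Hn En] := fb_blk k i3; exists n => //; split; first exact: Lk_sorted.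
apply: fb_ext Hn => j; rewrite count_uniq_mem ?(sorted_uniq ltn_trans ltnn) ?Lk_sorted //.
  rewrite /Lk mem_cat inE orbC (_ : _ == _ = false) /=; last by apply/eqP; lia.
  by rewrite mem_map // => x y; lia.
rewrite /Lk mem_cat inE; case: mapP => [[x _] | _]; first by lia.
by rewrite /=; congr (nat_of_bool _); apply/eqP/eqP; lia.
Qed.

Let P := [:: hone K; VV K 0; VV K 1; VV K 2].

(** The second half is proved along: degrees in N^3 that add up to 0 are 0, so a bracket of degree 0
    would come from an empty monomial, in which nothing can be contracted. *)
Lemma Palg_W f : Palg K f -> forall t, hsupp f t ->
  exists n, Wt t n /\ (tri n = t0 -> t = [::]).
Proof.
have tri0 n1 n2 : tadd (tri n1) (tri n2) = t0 -> tri n1 = t0 /\ tri n2 = t0.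
  by case=> a b c; split; congr (_, _, _); lia.
have br p q t : contracted p q t -> (exists n, Wt p n /\ (tri n = t0 -> p = [::])) ->
    (exists n, Wt q n /\ (tri n = t0 -> q = [::])) ->
    exists n, Wt t n /\ (tri n = t0 -> t = [::]).
  move=> c [n1 [W1 E1]] [n2 [W2 E2]].
  exists (fun j => n1 j + n2 j)%N; split; first exact: Wt_contracted c _ _ W1 W2.
  rewrite tri_nadd => /tri0[/E1 E _]; rewrite E in c.
  by case: (contracted_nil q t) => /(_ c).
elim=> {f} [f fP | | f g _ Hf _ Hg | c f _ Hf | f _ Hf | f _ Hf
           | op f g opA _ Hf _ Hg | f _ Hf _] t.
- case: fP => [<- | H].
    rewrite /hsupp /hone; case: (eqVneq t [::]) => [-> _ | _]; last by rewrite eqxx.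
    by exists (fun=> 0%N); split=> //; apply: Wt_nil.
  move=> Ht; have [i [i3 E]] : exists i, (i < 3)%N /\ f = VV K i.
    by case: H => [<- | [<- | [<- | //]]]; [exists 0%N | exists 1%N | exists 2%N].
  move: Ht; rewrite E => /VV_neq0[k ->].
  have [n Wn En] := Wt_Lk k i3; exists n; split=> //.
  by rewrite En => /vdeg_nz.
- by rewrite /hsupp eqxx.
- by move=> /hadd_supp[]; [apply: Hf | apply: Hg].
- by move=> /hscale_supp; apply: Hf.
- by move=> /hpe_supp; apply: Hf.
- by move=> /hpo_supp; apply: Hf.
- case: opA => [<- | [<- | //]].
    move=> /hmul_supp[p [q [/Hf[n1 [W1 E1]] /Hg[n2 [W2 E2]] st pt]]].
    exists (fun j => n1 j + n2 j)%N; split; first exact: Wt_cat st pt _ _ W1 W2.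
    rewrite tri_nadd => /tri0[/E1 Ep /E2 Eq]; move: pt; rewrite Ep Eq /=.
    by move/perm_nilP.
  by move=> /hbr_supp[p [q [/Hf Wp /Hg Wq c]]]; apply: br c Wp Wq.
- by move=> /hsq_supp[p [q [/Hf Wp /Hf Wq c]]]; apply: br c Wp Wq.
Qed.

Lemma Palg_graded : graded (A := Halg K) (Palg K) hsupp Wt (Wadd Wt).
Proof.
split.
- exact: gen_subalg.
- by move=> t; rewrite /hsupp eqxx.
- move=> f _ Hf; apply: functional_extensionality => t.
  by apply/eqP/negPn/negP; apply: Hf.
- by move=> f g t _ _; apply: hadd_supp.
- by move=> c f t _; apply: hscale_supp.
- by move=> f t _; apply: hpe_supp.
- by move=> f t _; apply: hpo_supp.
- move=> op f g t opA _ _; case: opA => [<- | [<- | //]].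
    by move=> /hmul_supp[p [q [? ? ? ?]]]; exists p, q; split=> //; apply: Wt_cat.
  by move=> /hbr_supp[p [q [? ? ?]]]; exists p, q; split=> //; apply: Wt_contracted.
- move=> f t _ _ /hsq_supp[p [q [? ? ?]]]; exists p, q; split=> //.
  exact: Wt_contracted.
- by [].
- by move=> f t Hf /(Palg_W Hf)[n [Wn _]]; exists n.
- exact: Wt_adm.
- exact: Wt_uniq.
Qed.

Lemma is_odd_supp f t : is_odd (A := Halg K) f -> f t != 0 -> odd (size t).
Proof. by move=> /= Of; rewrite -{1}Of /= /hpo; case: ifP => //; rewrite eqxx. Qed.

(** In the bracket sum the diagonal pairs vanish by [contracted_diag], and those above and below the
    diagonal are brought together by the symmetry of the bracket on odd monomials. *)
Lemma hsqD f g : is_odd (A := Halg K) f -> is_odd (A := Halg K) g ->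
  hsq (hadd f g) = hadd (hadd (hsq f) (hsq g)) (hbr f g).
Proof.
move=> Of Og; apply: functional_extensionality => t; rewrite /hadd /hsq /hbr.
case: (boolP (sorted ltn t)) => [st | nst]; last first.
  have m0 p q : mbr K p q t = 0.
    apply/eqP/negPn/negP => /mbr_neq0[j [z1 [z2 [_ _ _ st _]]]].
    by rewrite st in nst.
  by rewrite !big1 ?addr0 // => pq _; rewrite m0 mulr0.
rewrite -big_split /=.
have -> : \sum_(pq <- candH t) f pq.1 * g pq.2 * mbr K pq.1 pq.2 t =
  \sum_(pq <- candH t | lexlt pq.1 pq.2)
     (f pq.1 * g pq.2 + g pq.1 * f pq.2) * mbr K pq.1 pq.2 t.
  rewrite (bigID (fun pq => lexlt pq.1 pq.2)) /=.
  have -> : \sum_(pq <- candH t | ~~ lexlt pq.1 pq.2) f pq.1 * g pq.2 * mbr K pq.1 pq.2 t =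
      \sum_(pq <- candH t | lexlt pq.2 pq.1) f pq.1 * g pq.2 * mbr K pq.1 pq.2 t.
    rewrite [LHS]big_mkcond [RHS]big_mkcond; apply: eq_bigr => -[p q] _ /=.
    have := lexlt_total p q; case: (lexlt p q); case: (lexlt q p) => //=.
    case: eqP => // -> _; case: (eqVneq (f q) 0) => [-> | fq]; first by rewrite !mul0r.
    have oq := is_odd_supp Of fq.
    case: (eqVneq (mbr K q q t) 0) => [-> | /mbr_neq0]; first by rewrite mulr0.
    by move/contracted_diag; rewrite oq => /(_ isT).
  rewrite -[X in _ + X](perm_big _ (candH_swap_perm st)) big_map /= -big_split /=.
  apply: eq_bigr => -[p q] _ /=; rewrite mulrDl; congr (_ + _).
  case: (eqVneq (f q) 0) => [-> | fq]; first by rewrite mul0r mulr0 !mul0r.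
  case: (eqVneq (g p) 0) => [-> | gp]; first by rewrite mulr0 !mul0r.
  rewrite (mulrC (g p)) mbr_sym //; first exact: is_odd_supp Of fq.
  exact: is_odd_supp Og gp.
rewrite -big_split /=; apply: eq_bigr => -[p q] _ /=.
rewrite -!mulrDl; congr (_ * _).
by rewrite mulrDl !mulrDr [g p * f q + _]addrC addrACA.
Qed.

Lemma Palg_linear : linear_ops (A := Halg K) P.
Proof.
split.
- by move=> f g h; apply: functional_extensionality => t; rewrite /= /hadd addrA.
- by move=> f g; apply: functional_extensionality => t; rewrite /= /hadd addrC.
- by move=> f; apply: functional_extensionality => t; rewrite /= /hadd add0r.
- by move=> c f g; apply: functional_extensionality => t; rewrite /= /hscale mulrDr.
- by move=> c; apply: functional_extensionality => t; rewrite /= /hscale mulr0.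
- move=> f g; apply: functional_extensionality => t; rewrite /= /hadd /hpe.
  by case: odd; rewrite ?addr0.
- by apply: functional_extensionality => t; rewrite /= /hpe; case: odd.
- move=> f g; apply: functional_extensionality => t; rewrite /= /hadd /hpo.
  by case: odd; rewrite ?addr0.
- by apply: functional_extensionality => t; rewrite /= /hpo; case: odd.
- by move=> f _; apply: functional_extensionality => t; rewrite /= /hpo; case: odd.
- move=> op f g h opA _ _ _; apply: functional_extensionality => t.
  case: opA => [<- | [<- | //]]; rewrite /= /hadd -big_split /=;
    by apply: eq_bigr => pq _; rewrite !mulrDl.
- move=> op f g h opA _ _ _; apply: functional_extensionality => t.
  case: opA => [<- | [<- | //]]; rewrite /= /hadd -big_split /=;
    by apply: eq_bigr => pq _; rewrite !mulrDr !mulrDl.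
- move=> op f opA _; apply: functional_extensionality => t.
  by case: opA => [<- | [<- | //]]; rewrite /= /hz; apply: big1 => pq _; rewrite !mul0r.
- move=> op f opA _; apply: functional_extensionality => t.
  case: opA => [<- | [<- | //]]; rewrite /= /hz; apply: big1 => pq _;
    by rewrite !mulr0 !mul0r.
- apply: functional_extensionality => t; rewrite /= /hz; apply: big1 => pq _.
  by rewrite !mul0r.
- exists (@hbr K); first by right; left.
  by move=> f g _ _; apply: hsqD.
Qed.

(* The only nonzero brackets below contract x_j with a lone y_j. *)
Lemma contract_head j p t : sorted ltn ((2 * j)%N :: p) ->
  mbr K ((2 * j)%N :: p) [:: (2 * j).+1] t = if t == p then sgn K (size p) else 0.
Proof.
move=> sp; rewrite /mbr.
have jm : j \in iota 0 (maxl ((2 * j)%N :: p)).+1.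
  rewrite mem_iota add0n ltnS /=; apply: leq_trans (leq_maxl _ _); lia.
rewrite (bigD1_seq j) ?iota_uniq //= big1 ?addr0; last first.
  move=> i ij; rewrite /dterm !inE.
  rewrite (_ : (2 * i == (2 * j).+1)%N = false) ?andbF ?add0r; last by apply/eqP; lia.
  by rewrite (_ : ((2 * i).+1 == (2 * j).+1)%N = false) ?andbF //; apply/eqP; lia.
rewrite /dterm !inE (_ : (2 * j == (2 * j).+1)%N = false) ?andbF ?add0r; last by apply/eqP; lia.
rewrite !eqxx /= !eqxx /= -[sgn K 0]/1 !mul1r /pcoef cats0.
have sp' : sorted ltn p by apply: path_sorted sp.
have inv0 : inv p [::] = 0%N by rewrite /inv; apply: big1.
rewrite inv0 -[sgn K 0]/1 {1}/sgn exprS mulN1r opprK -/(sgn K _); case: eqP => [-> | tp].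
  by rewrite sp' perm_refl mulr1.
case: andP => [[st /perm_mem E]|_]; last by rewrite mulr0.
by case: tp; apply: (irr_sorted_eq ltn_trans ltnn).
Qed.

(** A nonempty p has letters beyond 2 j, which brings j into the range of the candidates. *)
Lemma candH_head j p : sorted ltn ((2 * j)%N :: p) -> p != [::] ->
  ((2 * j)%N :: p, [:: (2 * j).+1]) \in candH p.
Proof.
move=> sp p0; apply/candHP; exists j, (2 * j)%N, (2 * j).+1, p; split.
- case: p sp p0 => // x p /= /andP[jx _] _.
  by apply: leq_trans (leq_maxl _ _); lia.
- by right.
- exact: subseq_refl.
congr (_, _).
  rewrite sorted_sort //; first exact: leq_trans.
  by apply: sub_sorted sp => x y /ltnW.
by rewrite (eq_in_filter (a2 := pred0)) ?filter_pred0 // => y ->.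
Qed.

Lemma Lk_odd i k x : (2 * x).+1 \in Lk i k -> x = (i + 3 * k)%N.
Proof.
rewrite /Lk mem_cat inE => /orP[/mapP[y _] | /eqP]; last by lia.
by lia.
Qed.

(** All monomials of V_i except y_i contain x_i, so only brackets of y_i with the longer ones
    survive; they give V_i^[2] = x_{i+1} V_{i+3}. *)
Lemma hsq_VV i t : hsq (VV K i) t =
  if t is x :: t' then (if x == (2 * i.+1)%N then VV K (i + 3) t' else 0) else 0.
Proof.
have key p q : hsupp (VV K i) p -> hsupp (VV K i) q -> lexlt p q -> contracted p q t ->
    exists k, [/\ p = Lk i k.+1, q = [:: (2 * i).+1] & t = (2 * i.+1)%N :: Lk (i + 3) k].
  move=> /VV_neq0[k ->] /VV_neq0[l ->] lt [j [z1 [z2 [zz z1p z2q st pt]]]].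
  have ut : uniq (rem z1 (Lk i k) ++ rem z2 (Lk i l)).
    by rewrite -(perm_uniq pt) (sorted_uniq ltn_trans ltnn).
  case: k lt z1p pt ut => [|k] lt z1p pt ut.
    case: l lt z2q pt ut => [|l]; first by rewrite /= ltnn eqxx.
    by rewrite LkS /= muln0 addn0 => /orP[|/andP[/eqP]]; lia.
  case: l lt z2q pt ut => [|l] lt z2q pt ut.
    exists k; split=> //; first by rewrite /Lk /= muln0 addn0.
    have z2E : z2 = (2 * i).+1 by move: z2q; rewrite /Lk /= inE muln0 addn0 => /eqP.
    have z1E : z1 = (2 * i)%N.
      case: zz => -[E1 E2]; first by lia.
      by lia.
    move: pt; rewrite z1E z2E LkS /Lk /= muln0 addn0 !eqxx cats0 => /perm_mem E.
    apply: (irr_sorted_eq ltn_trans ltnn) => //.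
    have := Lk_sorted i k.+1; rewrite LkS; exact: path_sorted.
  have i1 : (2 * i)%N \in rem z1 (Lk i k.+1).
    have : (2 * i)%N \in Lk i k.+1 by rewrite LkS inE eqxx.
    rewrite (perm_mem (perm_to_rem z1p)) inE => /orP[/eqP E | //].
    have E2 : z2 = (2 * i).+1 by case: zz; lia.
    by move: z2q; rewrite E2 => /Lk_odd; lia.
  have i2 : (2 * i)%N \in rem z2 (Lk i l.+1).
    have : (2 * i)%N \in Lk i l.+1 by rewrite LkS inE eqxx.
    rewrite (perm_mem (perm_to_rem z2q)) inE => /orP[/eqP E | //].
    have E2 : z1 = (2 * i).+1 by case: zz; lia.
    by move: z1p; rewrite E2 => /Lk_odd; lia.
  by move: ut; rewrite cat_uniq => /and3P[_ /hasPn/(_ _ i2)]; rewrite /= i1.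
have zero : (forall k, t <> (2 * i.+1)%N :: Lk (i + 3) k) -> hsq (VV K i) t = 0.
  move=> H; apply/eqP/negPn/negP => /sum_neq0[[p q] [_ /= lt]].
  move=> /mul3_neq0[fp gq /mbr_neq0 c].
  by have [k [_ _ /H]] := key _ _ fp gq lt c.
case: (classic (exists k, t = (2 * i.+1)%N :: Lk (i + 3) k)) => [[k Et] | H]; last first.
  rewrite zero; last by move=> k E; apply: H; exists k.
  case: t H {key zero} => // x t H; case: eqP => // Ex.
  case: (eqVneq (VV K (i + 3) t) 0) => [-> // | /VV_neq0[k Ek]].
  by case: H; exists k; rewrite Ex Ek.
rewrite Et eqxx VV_Lk -Et /hsq.
have sp : sorted ltn ((2 * i)%N :: t).
  by rewrite Et; have := Lk_sorted i k.+1; rewrite LkS.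
have tn : t != [::] by rewrite Et.
rewrite -big_filter (bigD1_seq ((2 * i)%N :: t, [:: (2 * i).+1])) /=; first last.
- by rewrite filter_uniq // undup_uniq.
- by rewrite mem_filter candH_head //= ltnSn.
rewrite contract_head // eqxx.
have -> : (2 * i)%N :: t = Lk i k.+1 by rewrite Et -LkS.
have -> : [:: (2 * i).+1] = Lk i 0 by rewrite /Lk /= muln0 addn0.
rewrite !VV_Lk !mul1r Et /= size_Lk sgn_odd /= oddM /= big_seq_cond big1 ?addr0 //.
move=> [p q] /=; rewrite mem_filter /= => /andP[/andP[lt _] ne].
apply/eqP/negPn/negP => /mul3_neq0[fp gq].
rewrite -Et => /mbr_neq0 c; have [l [Ep Eq El]] := key _ _ fp gq lt c.
move: ne; rewrite Ep Eq.
have -> : l = k.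
  by move: El; rewrite Et => -[/(f_equal size)]; rewrite !size_Lk; lia.
by rewrite /Lk /= muln0 addn0 eqxx.
Qed.

(** The monomials of V_{i+1} except y_{i+1} contain x_{i+1}, as do all those of V_i^[2]. So just
    y_{i+1} contributes, and it strips off x_{i+1}. This recovers V_{i+3} inside P with the degree
    predicted by [vdeg_rec]. *)
Lemma hbr_VV i : hbr (hsq (VV K i)) (VV K i.+1) = hscale (-1) (VV K (i + 3)).
Proof.
apply: functional_extensionality => t.
have key p q : hsupp (hsq (VV K i)) p -> hsupp (VV K i.+1) q -> contracted p q t ->
    exists k, [/\ p = (2 * i.+1)%N :: Lk (i + 3) k, q = [:: (2 * i.+1).+1] & t = Lk (i + 3) k].
  rewrite /hsupp hsq_VV; case: p => [|x p]; first by rewrite eqxx.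
  case: (eqVneq x (2 * i.+1)%N) => [-> | _]; last by rewrite eqxx.
  move=> /VV_neq0[k ->] /VV_neq0[l ->] [j [z1 [z2 [zz z1p z2q st pt]]]].
  have ut : uniq (rem z1 ((2 * i.+1)%N :: Lk (i + 3) k) ++ rem z2 (Lk i.+1 l)).
    by rewrite -(perm_uniq pt) (sorted_uniq ltn_trans ltnn).
  have podd x' : (2 * x').+1 \in (2 * i.+1)%N :: Lk (i + 3) k -> x' = (i + 3 + 3 * k)%N.
    by rewrite inE => /orP[/eqP | /Lk_odd //]; lia.
  exists k; case: l z2q pt ut => [|l] z2q pt ut.
    have z2E : z2 = (2 * i.+1).+1 by move: z2q; rewrite /Lk /= inE muln0 addn0 => /eqP.
    have z1E : z1 = (2 * i.+1)%N by case: zz; lia.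
    split=> //; first by rewrite /Lk /= muln0 addn0.
    move: pt; rewrite z1E z2E /Lk /= muln0 addn0 !eqxx cats0 => /perm_mem E.
    by apply: (irr_sorted_eq ltn_trans ltnn) => //; apply: Lk_sorted.
  exfalso.
  have i1 : (2 * i.+1)%N \in rem z1 ((2 * i.+1)%N :: Lk (i + 3) k).
    have : (2 * i.+1)%N \in (2 * i.+1)%N :: Lk (i + 3) k by rewrite inE eqxx.
    rewrite (perm_mem (perm_to_rem z1p)) inE => /orP[/eqP E | //].
    have E2 : z2 = (2 * i.+1).+1 by case: zz; lia.
    by move: z2q; rewrite E2 => /Lk_odd; lia.
  have i2 : (2 * i.+1)%N \in rem z2 (Lk i.+1 l.+1).
    have : (2 * i.+1)%N \in Lk i.+1 l.+1 by rewrite LkS inE eqxx.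
    rewrite (perm_mem (perm_to_rem z2q)) inE => /orP[/eqP E | //].
    have E2 : z1 = (2 * i.+1).+1 by case: zz; lia.
    by move: z1p; rewrite E2 => /podd; lia.
  by move: ut; rewrite cat_uniq => /and3P[_ /hasPn/(_ _ i2)]; rewrite /= i1.
rewrite /hscale mulN1r.
case: (classic (exists k, t = Lk (i + 3) k)) => [[k Et] | H]; last first.
  have -> : VV K (i + 3) t = 0.
    by apply/eqP/negPn/negP => /VV_neq0.
  rewrite oppr0; apply/eqP/negPn/negP => /sum_neq0[[p q] [_ _ /=]].
  move=> /mul3_neq0[fp gq /mbr_neq0 c].
  by have [k [_ _ Et]] := key _ _ fp gq c; case: H; exists k.
have sp : sorted ltn ((2 * i.+1)%N :: t) by rewrite Et /= Lk_path //; lia.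
have tn : t != [::] by rewrite Et -size_eq0 size_Lk.
rewrite /hbr (bigD1_seq ((2 * i.+1)%N :: t, [:: (2 * i.+1).+1])) /=; first last.
- exact: undup_uniq.
- exact: candH_head.
rewrite contract_head // eqxx hsq_VV eqxx.
have -> : [:: (2 * i.+1).+1] = Lk i.+1 0 by rewrite /Lk /= muln0 addn0.
rewrite Et !VV_Lk !mul1r size_Lk sgn_odd /= oddM /= big_seq_cond big1 ?addr0 //.
move=> [p q] /=; rewrite -Et => /andP[_ ne].
apply/eqP/negPn/negP => /mul3_neq0[fp gq /mbr_neq0 c].
have [l [Ep Eq El]] := key _ _ fp gq c.
by move: ne; rewrite Ep Eq -El /Lk /= muln0 addn0 eqxx.
Qed.

Lemma VV_odd i : is_odd (A := Halg K) (VV K i).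
Proof.
apply: functional_extensionality => t; rewrite /= /hpo.
case: (boolP (odd _)) => // ot; apply/esym/eqP/negPn/negP => /VV_neq0[k E].
by move: ot; rewrite E size_Lk /= oddM.
Qed.

Lemma VV_Palg n : Palg K (VV K n) /\ hom (A := Halg K) hsupp Wt (vdeg n) (VV K n).
Proof.
elim/ltn_ind: n => n IHn.
have base i : (i < 3)%N -> InL (VV K i) P ->
    Palg K (VV K i) /\ hom (A := Halg K) hsupp Wt (vdeg i) (VV K i).
  move=> i3 iP; split; first exact: gen_in.
  move=> t m /VV_neq0[k ->] Wm; have [m' Wm' <-] := Wt_Lk k i3.
  exact: Wt_uniq Wm Wm'.
case: n IHn => [|[|[|n]]] IHn.
- by apply: base => //; right; left.
- by apply: base => //; right; right; left.
- by apply: base => //; right; right; right; left.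
have [P0 h0] := IHn n ltac:(lia); have [P1 h1] := IHn n.+1 ltac:(lia).
have -> : VV K n.+3 = hscale (-1) (hbr (hsq (VV K n)) (VV K n.+1)).
  rewrite hbr_VV addn3; apply: functional_extensionality => t.
  by rewrite /hscale !mulN1r opprK.
have Ps : Palg K (hsq (VV K n)) by apply: gen_sq => //; apply: VV_odd.
have Pb : Palg K (hbr (hsq (VV K n)) (VV K n.+1)) by apply: gen_op => //; right; left.
split; first exact: gen_scale.
rewrite vdeg_rec; apply: (hom_scale Palg_graded) => //.
apply: (hom_op Palg_graded) => //; first by right; left.
by apply: (hom_sq Palg_graded) => //; apply: VV_odd.
Qed.

Lemma Palg_gens_hom x : InL x P -> exists d, hom (A := Halg K) hsupp Wt d x.
Proof.
case=> [<- | [<- | [<- | [<- | //]]]]; last 3 first.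
- by exists (vdeg 0); case: (VV_Palg 0).
- by exists (vdeg 1); case: (VV_Palg 1).
- by exists (vdeg 2); case: (VV_Palg 2).
exists t0 => t n; rewrite /hsupp /hone; case: (eqVneq t [::]) => [-> _ | _]; last by rewrite eqxx.
by move=> Wn; apply: Wt_uniq Wn Wt_nil.
Qed.

Lemma Palg_degs_fin f : Palg K f ->
  exists L : seq triple, forall t n, hsupp f t -> Wt t n -> tri n \in L.
Proof. exact: (gen_degs_fin Palg_linear Palg_graded Palg_gens_hom). Qed.

Lemma Palg_split (Q : triple -> bool) f : Palg K f ->
  exists a b, [/\ Palg K a, Palg K b, f = hadd a b,
    forall t n, hsupp a t -> Wt t n -> Q (tri n) = true &
    forall t n, hsupp b t -> Wt t n -> Q (tri n) = false].
Proof. exact: (gen_split Palg_linear Palg_graded Palg_gens_hom). Qed.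

Lemma hbr_const f g : Palg K f -> Palg K g -> hbr f g [::] = 0.
Proof.
move=> Pf Pg; apply/eqP/negPn/negP => /hbr_supp[p [q [fp gq c]]].
have [n1 [W1 E1]] := Palg_W Pf fp; have [n2 [W2 E2]] := Palg_W Pg gq.
have := Wt_uniq Wt_nil (Wt_contracted c W1 W2).
rewrite tri_nadd => -[a b d].
have Ep : p = [::] by apply: E1; congr (_, _, _); lia.
by rewrite Ep in c; case: (contracted_nil q [::]) => /(_ c).
Qed.

Lemma hsq_const f : Palg K f -> hsq f [::] = 0.
Proof.
move=> Pf; apply/eqP/negPn/negP => /hsq_supp[p [q [fp gq c]]].
have [n1 [W1 E1]] := Palg_W Pf fp; have [n2 [W2 E2]] := Palg_W Pf gq.
have := Wt_uniq Wt_nil (Wt_contracted c W1 W2).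
rewrite tri_nadd => -[a b d].
have Ep : p = [::] by apply: E1; congr (_, _, _); lia.
by rewrite Ep in c; case: (contracted_nil q [::]) => /(_ c).
Qed.

Lemma hmul_const f g : f [::] = 0 -> hmul f g [::] = 0.
Proof. by move=> f0; rewrite /hmul /= big_seq1 f0 !mul0r. Qed.

Lemma Po_subalg : is_subalg (A := Halg K) (Po K).
Proof.
split.
- by split; first exact: gen_0.
- by move=> f g [Pf f0] [Pg g0]; split; [apply: gen_add | rewrite /= /hadd f0 g0 addr0].
- by move=> c f [Pf f0]; split; [apply: gen_scale | rewrite /= /hscale f0 mulr0].
- by move=> f [Pf f0]; split; split; [exact: gen_pe | | exact: gen_po |].
- split.
    move=> op f g opA [Pf f0] [Pg g0]; split; first exact: gen_op.
    by case: opA => [<- | [<- | //]]; [apply: hmul_const | apply: hbr_const].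
  by move=> f [Pf f0] Of; split; [apply: gen_sq | apply: hsq_const].
Qed.

Lemma Po_sub f : Po K f -> Palg K f.
Proof. by case. Qed.

Lemma Po_graded : graded (A := Halg K) (Po K) hsupp Wt (Wadd Wt).
Proof. exact: (graded_sub (A := Halg K) Po_sub Po_subalg Palg_graded). Qed.

Lemma Po_deg f t n : Po K f -> hsupp f t -> Wt t n -> tri n <> t0.
Proof.
move=> [Pf f0] ft Wn n0; have [m [Wm Em]] := Palg_W Pf ft.
by move: ft; rewrite /hsupp Em ?f0 ?eqxx // -n0; apply: Wt_uniq Wm Wn.
Qed.

Lemma Po_split (Q : triple -> bool) f : Q t0 = false -> Po K f ->
  exists a b, [/\ Po K a, Po K b, f = hadd a b,
    forall t n, hsupp a t -> Wt t n -> Q (tri n) = true &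
    forall t n, hsupp b t -> Wt t n -> Q (tri n) = false].
Proof.
move=> Q0 [/(Palg_split Q)[a [b [Pa Pb E Ha Hb]]] f0].
(* Degree 0 is on the false side, so the constant term of f, which is 0, would have to be that of
   b. *)
have a0 : a [::] = 0.
  by apply/eqP/negPn/negP => /Ha/(_ Wt_nil); rewrite Q0.
by exists a, b; split=> //; split=> //; move: f0; rewrite E /hadd a0 add0r.
Qed.

Lemma VV_Po n : Po K (VV K n).
Proof.
split; first by case: (VV_Palg n).
apply/eqP/negPn/negP => /VV_neq0[k /(f_equal size)].
by rewrite size_Lk.
Qed.

Theorem Po_continuum : continuum_ln_decompositions (A := Halg K) (Po K).
Proof.
apply: (graded_continuum (graded_kcompose Po_graded)) => //.
- by move=> f t n Pf ft Wn /(Po_deg Pf ft Wn).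
- by move=> f [Pf _]; apply: Palg_degs_fin.
- exact: Po_split.
move=> n; exists (VV K n), (Lk n 0); split; first exact: VV_Po.
  by rewrite /hsupp VV_Lk oner_neq0.
by case: (VV_Palg n).
Qed.

End Poisson.

(** * Algebras of linear operators *)

Section LinearMaps.
Local Open Scope ring_scope.
Variables (K : fieldType) (V : lmodType K).
Implicit Types (f g : V) (M N : V -> V).

Definition islin M : Prop := forall c f g, M (c *: f + g) = c *: M f + M g.

Lemma lin0 M : islin M -> M 0 = 0.
Proof.
move=> lM; have := lM (-1) 0 0; by rewrite scaler0 addr0 scaleN1r addNr.
Qed.

Lemma linD M f g : islin M -> M (f + g) = M f + M g.
Proof. by move=> lM; have := lM 1 f g; rewrite !scale1r. Qed.

Lemma lin_if M (b : bool) f : islin M -> M (if b then f else 0) = if b then M f else 0.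
Proof. by move=> lM; case: b => //; exact: lin0. Qed.

Lemma linZ M c f : islin M -> M (c *: f) = c *: M f.
Proof.
move=> lM; have H := lM c f 0.
have -> : M (c *: f) = M (c *: f + 0) by congr M; rewrite addr0.
rewrite H -[RHS]addr0; congr (_ + _); exact: lin0.
Qed.

Lemma linN M f : islin M -> M (- f) = - M f.
Proof. by move=> lM; rewrite -scaleN1r linZ // scaleN1r. Qed.

Lemma lin_sum M (I : Type) (r : seq I) (P : pred I) (F : I -> V) :
  islin M -> M (\sum_(i <- r | P i) F i) = \sum_(i <- r | P i) M (F i).
Proof.
move=> lM; elim: r => [|x r IHr]; first by rewrite !big_nil lin0.
by rewrite !big_cons; case: (P x); rewrite ?linD // IHr.
Qed.

Lemma linC M N : islin M -> islin N -> islin (fun f => M (N f)).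
Proof. by move=> lM lN c f g; rewrite lN lM. Qed.

Lemma linDf M N : islin M -> islin N -> islin (fun f => M f + N f).
Proof. by move=> lM lN c f g; rewrite lM lN scalerDr addrACA. Qed.

Lemma linNf M : islin M -> islin (fun f => - M f).
Proof. by move=> lM c f g; rewrite lM opprD scalerN. Qed.

End LinearMaps.

(* The operators are first studied on the free module over an abstract set [T] of
   monomials, which keeps unification from unfolding the type [mono]. *)
Section LinearOperators.
Local Open Scope ring_scope.
Variables (K : fieldType) (T : choiceType) (par : T -> bool) (ct : T -> nat -> bool).
Local Notation L := {malg K[T]}.
Local Notation E := (L -> L).
Implicit Types (f g : L) (M N : E) (m : T).

Definition lift (h : T -> L) : E :=
  fun f => \sum_(m <- msupp f) f@_m *: h m.

Lemma lift_wide h f (D : {fset T}) : (msupp f `<=` D)%fset ->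
  lift h f = \sum_(m <- D) f@_m *: h m.
Proof.
move=> fD; rewrite /lift; apply: big_fset_incl => // m _ nm.
by rewrite mcoeff_outdom ?scale0r.
Qed.

Lemma lift_lin h : islin (lift h).
Proof.
move=> c f g; pose D := (msupp f `|` msupp g)%fset.
rewrite !(@lift_wide h _ D); last 3 first.
- exact: fsubsetUr.
- exact: fsubsetUl.
- apply: fsubset_trans (msuppD_le _ _) _; apply: fsetSU; exact: msuppZ_le.
rewrite scaler_sumr -big_split; apply: eq_bigr => m _ /=.
by rewrite mcoeffD mcoeffZ scalerDl scalerA.
Qed.

Lemma lift_U h m : lift h << m >> = h m.
Proof. by rewrite /lift msuppU oner_eq0 big_seq_fset1 mcoeffUU scale1r. Qed.

Lemma scale_U (c : K) m : c *: (<< m >> : L) = << c *g m >>.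
Proof.
apply/malgP => k; rewrite mcoeffZ !mcoeffU.
by rewrite mulrnAr mulr1.
Qed.

Lemma lin_expand M f : islin M -> M f = \sum_(m <- msupp f) f@_m *: M << m >>.
Proof.
move=> lM; rewrite {1}(monalgE f) lin_sum //; apply: eq_bigr => m _.
by rewrite -linZ // scale_U.
Qed.

Lemma lin_eq M N : islin M -> islin N -> (forall m, M << m >> = N << m >>) ->
  forall f, M f = N f.
Proof.
move=> lM lN E f; rewrite (lin_expand f lM) (lin_expand f lN).
by apply: eq_bigr => m _; rewrite E.
Qed.

Lemma lin_entries M N : islin M -> islin N ->
  (forall m m', (M << m >>)@_m' = (N << m >>)@_m') -> M = N.
Proof.
move=> lM lN E; apply: functional_extensionality; apply: lin_eq => // m.
by apply/malgP.
Qed.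

Definition oz : E := fun _ => 0.
Definition oadd M N : E := fun f => M f + N f.
Definition oscale (c : K) M : E := fun f => c *: M f.
Definition ocomp M N : E := fun f => M (N f).
Definition oopp M : E := fun f => - M f.
Definition oev f : L := \sum_(m <- msupp f | ~~ par m) f@_m *: << m >>.
Definition ood f : L := \sum_(m <- msupp f | par m) f@_m *: << m >>.
Definition ope M : E := oadd (ocomp oev (ocomp M oev)) (ocomp ood (ocomp M ood)).
Definition opo M : E := oadd (ocomp ood (ocomp M oev)) (ocomp oev (ocomp M ood)).
Definition obr M N : E :=
  let Me := ope M in let Mo := opo M in let Ne := ope N in let No := opo N in
  oadd (oadd (ocomp Me N) (oopp (ocomp N Me)))
  (oadd (oadd (ocomp Mo Ne) (oopp (ocomp Ne Mo)))
        (oadd (ocomp Mo No) (ocomp No Mo))).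

Definition LieOp : alg K :=
  @Alg K E oz oadd oscale ope opo [:: obr] (fun M => ocomp M M).
Definition AssOp : alg K :=
  @Alg K E oz oadd oscale id (fun _ => oz) [:: ocomp] (fun M => ocomp M M).

Lemma islin0 : islin oz.
Proof. by move=> c f g; rewrite /oz scaler0 addr0. Qed.

Lemma islin_add M N : islin M -> islin N -> islin (oadd M N).
Proof. exact: linDf. Qed.

Lemma islin_scale c M : islin M -> islin (oscale c M).
Proof. by move=> lM d f g; rewrite /oscale lM scalerDr !scalerA (mulrC c). Qed.

Lemma islin_opp M : islin M -> islin (oopp M).
Proof. exact: linNf. Qed.

Lemma islin_comp M N : islin M -> islin N -> islin (ocomp M N).
Proof. exact: linC. Qed.

Lemma oev_lift f : oev f = lift (fun m => if par m then 0 else << m >>) f.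
Proof.
rewrite /oev big_mkcond; apply: eq_bigr => m _.
by case: (par _); rewrite /= ?scaler0.
Qed.

Lemma ood_lift f : ood f = lift (fun m => if par m then << m >> else 0) f.
Proof.
rewrite /ood big_mkcond; apply: eq_bigr => m _.
by case: (par _); rewrite /= ?scaler0.
Qed.

Lemma islin_oev : islin oev.
Proof. by move=> c f g; rewrite !oev_lift lift_lin. Qed.

Lemma islin_ood : islin ood.
Proof. by move=> c f g; rewrite !ood_lift lift_lin. Qed.

Lemma islin_ope M : islin M -> islin (ope M).
Proof.
move=> lM; have le := islin_oev; have lo := islin_ood.
by apply: islin_add; do 2 (apply: islin_comp => //).
Qed.

Lemma islin_opo M : islin M -> islin (opo M).
Proof.
move=> lM; have le := islin_oev; have lo := islin_ood.
by apply: islin_add; do 2 (apply: islin_comp => //).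
Qed.

Lemma islin_obr M N : islin M -> islin N -> islin (obr M N).
Proof.
move=> lM lN; have lMe := islin_ope lM; have lMo := islin_opo lM.
have lNe := islin_ope lN; have lNo := islin_opo lN.
apply: islin_add; first by apply: islin_add; [|apply: islin_opp]; apply: islin_comp.
apply: islin_add; first by apply: islin_add; [|apply: islin_opp]; apply: islin_comp.
by apply: islin_add; apply: islin_comp.
Qed.

Lemma lift_coef h f m : (lift h f)@_m = \sum_(k <- msupp f) f@_k * (h k)@_m.
Proof. by rewrite /lift raddf_sum; apply: eq_bigr => k _; rewrite /= mcoeffZ. Qed.

Lemma coef_expand f m : f@_m = \sum_(k <- msupp f) f@_k * << k >>@_m.
Proof.
rewrite {1}(@lin_expand (fun g => g) f) // raddf_sum.
by apply: eq_bigr => k _; rewrite /= mcoeffZ.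
Qed.

Lemma oev_coef f m : (oev f)@_m = if par m then 0 else f@_m.
Proof.
rewrite (coef_expand f) oev_lift lift_coef; case: (boolP (par m)) => om.
  rewrite big1 // => k _; case: (boolP (par k)) => ok; first by rewrite mcoeff0 mulr0.
  by rewrite mcoeffU; case: eqP => [Ek | _]; [rewrite Ek om in ok | rewrite mulr0].
apply: eq_bigr => k _; case: (boolP (par k)) => ok //.
by rewrite mcoeff0 mcoeffU; case: eqP => [Ek | _] //; rewrite Ek (negbTE om) in ok.
Qed.

Lemma ood_coef f m : (ood f)@_m = if par m then f@_m else 0.
Proof.
rewrite (coef_expand f) ood_lift lift_coef; case: (boolP (par m)) => om; last first.
  rewrite big1 // => k _; case: (boolP (par k)) => ok; last by rewrite mcoeff0 mulr0.
  by rewrite mcoeffU; case: eqP => [Ek | _]; [rewrite Ek (negbTE om) in ok | rewrite mulr0].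
apply: eq_bigr => k _; case: (boolP (par k)) => ok //.
by rewrite mcoeff0 mcoeffU; case: eqP => [Ek | _] //; rewrite Ek om in ok.
Qed.

Lemma oev_U m : oev << m >> = if ~~ par m then << m >> else 0.
Proof. by rewrite oev_lift lift_U; case: (par m). Qed.

Lemma ood_U m : ood << m >> = if par m then << m >> else 0.
Proof. by rewrite ood_lift lift_U. Qed.

Lemma ope_entry M m m' : islin M ->
  (ope M << m >>)@_m' = if par m (+) par m' then 0 else (M << m >>)@_m'.
Proof.
move=> lM; rewrite /ope /oadd /ocomp mcoeffD oev_coef ood_coef oev_U ood_U.
rewrite !lin_if //.
by case: (par m); case: (par m') => /=; rewrite ?mcoeff0 ?addr0 ?add0r.
Qed.

Lemma opo_entry M m m' : islin M ->
  (opo M << m >>)@_m' = if par m (+) par m' then (M << m >>)@_m' else 0.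
Proof.
move=> lM; rewrite /opo /oadd /ocomp mcoeffD oev_coef ood_coef oev_U ood_U.
rewrite !lin_if //.
by case: (par m); case: (par m') => /=; rewrite ?mcoeff0 ?addr0 ?add0r.
Qed.

Lemma opo_id M : islin M -> opo (opo M) = opo M.
Proof.
move=> lM; have lo := islin_opo lM; apply: lin_entries => [||m m'].
- exact: islin_opo.
- exact: lo.
by rewrite (opo_entry m m' lo) (opo_entry m m' lM); case: (_ (+) _).
Qed.

Lemma ope_odd M : islin M -> opo M = M -> ope M = oz.
Proof.
move=> lM oM; apply: lin_entries => [||m m'].
- exact: islin_ope.
- exact: islin0.
rewrite ope_entry // -{1}oM opo_entry // /oz mcoeff0.
by case: (_ (+) _).
Qed.

(** An operator like v_i is an infinite combination of monomials in the x_j and d_j; its matrix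
    entries are single coefficients. *)
Definition esupp M (e : T * T) : Prop := (M << e.1 >>)@_e.2 != 0.

Lemma opo_flip M : islin M -> (forall m m', esupp M (m, m') -> par m (+) par m') ->
  opo M = M.
Proof.
move=> lM oM; apply: lin_entries => // [|m m']; first exact: islin_opo.
rewrite opo_entry //; case: ifP => // pm; apply/esym/eqP/negPn/negP => /oM.
by rewrite pm.
Qed.

Lemma ope_flip M : islin M -> (forall m m', esupp M (m, m') -> par m = par m') ->
  ope M = M /\ opo M = oz.
Proof.
move=> lM eM; split; apply: lin_entries => //.
- exact: islin_ope.
- move=> m m'; rewrite ope_entry //; case: ifP => // pm.
  by apply/esym/eqP/negPn/negP => /eM E; rewrite E addbb in pm.
- exact: islin_opo.
- exact: islin0.
move=> m m'; rewrite opo_entry // /oz mcoeff0; case: ifP => // pm.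
by apply/eqP/negPn/negP => /eM E; rewrite E addbb in pm.
Qed.

(** From e.1 to e.2, a removed variable counts as d_j and an added one as x_j; a variable present in
    both cancels in b - a. Membership being 0 or 1, these counts are admissible at once. *)
Definition We (e : T * T) (n : nat -> nat) : Prop :=
  finsupp_balanced (fun j => ct e.2 j : nat) (fun j => ct e.1 j : nat) n.

Lemma We_adm e n : We e n -> admissible n.
Proof.
by move=> [_ nb]; do 2 eexists; split; last exact: nb; move=> j; split; case: (ct _ _).
Qed.

Lemma We_uniq e n n' : We e n -> We e n' -> tri n = tri n'.
Proof. exact: fb_uniq. Qed.

(** The intermediate monomial occurs once in a and once in b, so it cancels. *)
Lemma We_comp m m1 m' : Wadd We (m1, m') (m, m1) (m, m').
Proof. by move=> n1 n2 H1 H2; apply: fb_add H1 H2 _ => j /=; lia. Qed.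

Lemma Wadd_sym e1 e2 e : Wadd We e1 e2 e -> Wadd We e2 e1 e.
Proof.
move=> H n1 n2 H1 H2; have := H _ _ H2 H1.
have -> // : (fun j => n2 j + n1 j)%N = (fun j => n1 j + n2 j)%N.
by apply: functional_extensionality => j; rewrite addnC.
Qed.

Lemma ocomp_supp M N m m' : islin M -> esupp (ocomp M N) (m, m') ->
  exists m1, esupp N (m, m1) /\ esupp M (m1, m').
Proof.
move=> lM; rewrite /esupp /ocomp (lin_expand _ lM) raddf_sum => /sum_neq0[m1 [_ _ /=]].
by rewrite mcoeffZ mulf_eq0 negb_or => /andP[]; exists m1.
Qed.

Lemma ocomp_Wadd M N e : islin M -> esupp (ocomp M N) e ->
  exists e1 e2, [/\ esupp M e1, esupp N e2 & Wadd We e1 e2 e].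
Proof.
case: e => m m' lM /(ocomp_supp lM)[m1 [h1 h2]].
by exists (m1, m'), (m, m1); split=> //; apply: We_comp.
Qed.

Lemma oadd_supp M N e : esupp (oadd M N) e -> esupp M e \/ esupp N e.
Proof.
rewrite /esupp /oadd mcoeffD; case: (eqVneq ((M << e.1 >>)@_e.2) 0) => [-> | _]; last by left.
by rewrite add0r; right.
Qed.

Lemma oopp_supp M e : esupp (oopp M) e -> esupp M e.
Proof. by rewrite /esupp /oopp mcoeffN oppr_eq0. Qed.

Lemma oscale_supp c M e : esupp (oscale c M) e -> esupp M e.
Proof. by rewrite /esupp /oscale mcoeffZ mulf_eq0 negb_or => /andP[]. Qed.

Lemma ope_supp M e : islin M -> esupp (ope M) e -> esupp M e.
Proof. by move=> lM; rewrite /esupp ope_entry //; case: (_ (+) _); rewrite ?eqxx. Qed.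

Lemma opo_supp M e : islin M -> esupp (opo M) e -> esupp M e.
Proof. by move=> lM; rewrite /esupp opo_entry //; case: (_ (+) _); rewrite ?eqxx. Qed.

Lemma oz_supp e : ~ esupp oz e.
Proof. by rewrite /esupp /oz mcoeff0 eqxx. Qed.

Lemma supp_eq0 M : islin M -> (forall e, ~ esupp M e) -> M = oz.
Proof.
move=> lM H; apply: lin_entries => //; first exact: islin0.
move=> m m'; rewrite /oz mcoeff0; apply/eqP/negPn/negP.
exact: (H (m, m')).
Qed.

Lemma obr_Wadd M N e : islin M -> islin N -> esupp (obr M N) e ->
  exists e1 e2, [/\ esupp M e1, esupp N e2 & Wadd We e1 e2 e].
Proof.
move=> lM lN; have lMe := islin_ope lM; have lMo := islin_opo lM.
have lNe := islin_ope lN; have lNo := islin_opo lN.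
have sMe e' := @ope_supp M e' lM; have sMo e' := @opo_supp M e' lM.
have sNe e' := @ope_supp N e' lN; have sNo e' := @opo_supp N e' lN.
have Lf M' N' : islin M' -> (forall e', esupp M' e' -> esupp M e') ->
    (forall e', esupp N' e' -> esupp N e') -> esupp (ocomp M' N') e ->
    exists e1 e2, [/\ esupp M e1, esupp N e2 & Wadd We e1 e2 e].
  move=> lM' h1 h2 /(ocomp_Wadd lM')[e1 [e2 [s1 s2 w]]].
  by exists e1, e2; split; [apply: h1 | apply: h2 |].
have Rt M' N' : islin N' -> (forall e', esupp M' e' -> esupp M e') ->
    (forall e', esupp N' e' -> esupp N e') -> esupp (ocomp N' M') e ->
    exists e1 e2, [/\ esupp M e1, esupp N e2 & Wadd We e1 e2 e].
  move=> lN' h1 h2 /(ocomp_Wadd lN')[e2 [e1 [s2 s1 w]]].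
  by exists e1, e2; split; [apply: h1 | apply: h2 | apply: Wadd_sym].
rewrite /obr /=; case/oadd_supp => [|/oadd_supp[]] /oadd_supp[].
- exact: Lf.
- by move/oopp_supp; apply: Rt.
- exact: Lf.
- by move/oopp_supp; apply: Rt.
- exact: Lf.
- exact: Rt.
Qed.

Lemma oaddA M N P : oadd M (oadd N P) = oadd (oadd M N) P.
Proof. by apply: functional_extensionality => f; apply: addrA. Qed.

Lemma oaddC M N : oadd M N = oadd N M.
Proof. by apply: functional_extensionality => f; apply: addrC. Qed.

Lemma oadd0 M : oadd oz M = M.
Proof. by apply: functional_extensionality => f; apply: add0r. Qed.

Lemma oscaleD c M N : oscale c (oadd M N) = oadd (oscale c M) (oscale c N).
Proof. by apply: functional_extensionality => f; apply: scalerDr. Qed.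

Lemma oscale0 c : oscale c oz = oz.
Proof. by apply: functional_extensionality => f; apply: scaler0. Qed.

Lemma ocompDl M N P : ocomp (oadd M N) P = oadd (ocomp M P) (ocomp N P).
Proof. by []. Qed.

Lemma ocompDr M N P : islin P -> ocomp P (oadd M N) = oadd (ocomp P M) (ocomp P N).
Proof. by move=> lP; apply: functional_extensionality => f; apply: linD. Qed.

Lemma ocomp0 M : islin M -> ocomp M oz = oz.
Proof. by move=> lM; apply: functional_extensionality => f; apply: lin0. Qed.

Lemma oaddACA M N P Q : oadd (oadd M N) (oadd P Q) = oadd (oadd M P) (oadd N Q).
Proof. by apply: functional_extensionality => f; apply: addrACA. Qed.

Lemma ooppD M N : oopp (oadd M N) = oadd (oopp M) (oopp N).
Proof. by apply: functional_extensionality => f; apply: opprD. Qed.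

Lemma opeD M N : ope (oadd M N) = oadd (ope M) (ope N).
Proof.
rewrite /ope; move: oev ood islin_oev islin_ood => ev od le lo.
by rewrite !ocompDl !ocompDr // oaddACA.
Qed.

Lemma opoD M N : opo (oadd M N) = oadd (opo M) (opo N).
Proof.
rewrite /opo; move: oev ood islin_oev islin_ood => ev od le lo.
by rewrite !ocompDl !ocompDr // oaddACA.
Qed.

Lemma ope0 : ope oz = oz.
Proof.
have le := islin_oev; have lo := islin_ood.
by rewrite /ope -[ocomp oz oev]/oz -[ocomp oz ood]/oz !ocomp0 // oadd0.
Qed.

Lemma opo0 : opo oz = oz.
Proof.
have le := islin_oev; have lo := islin_ood.
by rewrite /opo -[ocomp oz oev]/oz -[ocomp oz ood]/oz !ocomp0 // oadd0.
Qed.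

Lemma addr6ACA (V : zmodType) (a a' b b' c c' d d' x x' y y' : V) :
  ((a + a') + (b + b')) + (((c + c') + (d + d')) + ((x + x') + (y + y'))) =
  (a + b + ((c + d) + (x + y))) + (a' + b' + ((c' + d') + (x' + y'))).
Proof.
by rewrite (addrACA a) (addrACA c) (addrACA x) (addrACA (c + d)) (addrACA (a + b)).
Qed.

Lemma obrDl M N P : islin M -> islin N -> islin P ->
  obr (oadd M N) P = oadd (obr M P) (obr N P).
Proof.
move=> lM lN lP; have lPe := islin_ope lP; have lPo := islin_opo lP.
rewrite /obr /= opeD opoD.
move: (ope M) (opo M) (ope N) (opo N) (ope P) (opo P) lPe lPo => *.
rewrite !ocompDl !ocompDr // !ooppD; apply: functional_extensionality => f.
exact: addr6ACA.
Qed.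

Lemma obrDr M N P : islin M -> islin N -> islin P ->
  obr P (oadd M N) = oadd (obr P M) (obr P N).
Proof.
move=> lM lN lP; have lPe := islin_ope lP; have lPo := islin_opo lP.
rewrite /obr /= opeD opoD.
move: (ope M) (opo M) (ope N) (opo N) (ope P) (opo P) lPe lPo => *.
rewrite !ocompDl !ocompDr // !ooppD; apply: functional_extensionality => f.
exact: addr6ACA.
Qed.

Lemma obr0l M : islin M -> obr oz M = oz.
Proof.
move=> lM; have := lin0 (islin_ope lM); have := lin0 (islin_opo lM); have := lin0 lM.
rewrite /obr /= ope0 opo0; move: (ope M) (opo M) => Me Mo M0 Mo0 Me0.
apply: functional_extensionality => f; rewrite /oadd /ocomp /oopp /oz.
by rewrite M0 Mo0 Me0 oppr0 !addr0.
Qed.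

Lemma obr0r M : islin M -> obr M oz = oz.
Proof.
move=> lM; have := lin0 (islin_ope lM); have := lin0 (islin_opo lM); have := lin0 lM.
rewrite /obr /= ope0 opo0; move: (ope M) (opo M) => Me Mo M0 Mo0 Me0.
apply: functional_extensionality => f; rewrite /oadd /ocomp /oopp /oz.
by rewrite Mo0 Me0 oppr0 !addr0.
Qed.

Lemma obr_odd M N : islin M -> islin N -> opo M = M -> opo N = N ->
  obr M N = oadd (ocomp M N) (ocomp N M).
Proof.
move=> lM lN oM oN; have := lin0 lM; have := lin0 lN.
rewrite /obr /= oM oN !ope_odd // => N0 M0.
apply: functional_extensionality => f; rewrite /oadd /ocomp /oopp /oz.
by rewrite N0 M0 oppr0 !add0r.
Qed.

Lemma obr_even M N : islin M -> islin N -> ope M = M -> opo M = oz ->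
  obr M N = oadd (ocomp M N) (oopp (ocomp N M)).
Proof.
move=> lM lN eM oM; have := lin0 (islin_ope lN); have := lin0 (islin_opo lN).
rewrite /obr /= eM oM; move: (ope N) (opo N) => Ne No No0 Ne0.
apply: functional_extensionality => f; rewrite /oadd /ocomp /oopp /oz.
by rewrite No0 Ne0 oppr0 !addr0.
Qed.

Section Generated.
Variable S : seq E.
Hypothesis Slin : forall M, InL M S -> islin M.
Hypothesis SW : forall M e, InL M S -> esupp M e -> exists n, We e n /\ tri n <> t0.
Hypothesis Shom : forall M, InL M S -> exists d, forall e n, esupp M e -> We e n -> tri n = d.

Let taddn0 d e : d <> t0 -> tadd d e <> t0.
Proof.
case: d => [[a b] c]; case: e => [[a' b'] c'] /= H [] *; apply: H.
by congr (_, _, _); lia.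
Qed.

Lemma Lie_lin M : gen (A := LieOp) S M -> islin M.
Proof.
elim=> {M} [M /Slin | | M N _ lM _ lN | c M _ lM | M _ lM | M _ lM
           | f M N fA _ lM _ lN | M _ lM _] //.
- exact: islin0.
- exact: islin_add.
- exact: islin_scale.
- exact: islin_ope.
- exact: islin_opo.
- by case: fA => [<- | //]; apply: islin_obr.
- exact: islin_comp.
Qed.

Lemma Ass_lin M : gen (A := AssOp) S M -> islin M.
Proof.
elim=> {M} [M /Slin | | M N _ lM _ lN | c M _ lM | M _ lM | M _ lM
           | f M N fA _ lM _ lN | M _ lM _] //.
- exact: islin0.
- exact: islin_add.
- exact: islin_scale.
- exact: islin0.
- by case: fA => [<- | //]; apply: islin_comp.
- exact: islin_comp.
Qed.

Let comb M N e :
  (exists e1 e2, [/\ esupp M e1, esupp N e2 & Wadd We e1 e2 e]) ->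
  (forall e', esupp M e' -> exists n, We e' n /\ tri n <> t0) ->
  (forall e', esupp N e' -> exists n, We e' n /\ tri n <> t0) ->
  exists n, We e n /\ tri n <> t0.
Proof.
move=> [e1 [e2 [s1 s2 w]]] /(_ _ s1)[n1 [W1 z1]] /(_ _ s2)[n2 [W2 _]].
exists (fun j => n1 j + n2 j)%N; split; first exact: w.
by rewrite tri_nadd; apply: taddn0.
Qed.

Lemma Lie_W M : gen (A := LieOp) S M ->
  forall e, esupp M e -> exists n, We e n /\ tri n <> t0.
Proof.
elim=> {M} [M MS | | M N _ HM _ HN | c M _ HM | M gM HM | M gM HM
           | f M N fA gM HM gN HN | M gM HM _] e.
- exact: SW.
- by move/oz_supp.
- by move/oadd_supp => []; [apply: HM | apply: HN].
- by move/oscale_supp; apply: HM.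
- by move/(ope_supp (Lie_lin gM)); apply: HM.
- by move/(opo_supp (Lie_lin gM)); apply: HM.
- case: fA => [<- | //] /(obr_Wadd (Lie_lin gM) (Lie_lin gN)) H.
  exact: (comb H HM HN).
- move=> /(ocomp_Wadd (Lie_lin gM)) H; exact: (comb H HM HM).
Qed.

Lemma Ass_W M : gen (A := AssOp) S M ->
  forall e, esupp M e -> exists n, We e n /\ tri n <> t0.
Proof.
elim=> {M} [M MS | | M N _ HM _ HN | c M _ HM | M gM HM | M gM HM
           | f M N fA gM HM gN HN | M gM HM _] e.
- exact: SW.
- by move/oz_supp.
- by move/oadd_supp => []; [apply: HM | apply: HN].
- by move/oscale_supp; apply: HM.
- exact: HM.
- by move/oz_supp.
- case: fA => [<- | //] /(ocomp_Wadd (Ass_lin gM)) H.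
  exact: (comb H HM HN).
- move=> /(ocomp_Wadd (Ass_lin gM)) H; exact: (comb H HM HM).
Qed.

Lemma Lie_graded : graded (A := LieOp) (gen (A := LieOp) S) esupp We (Wadd We).
Proof.
split.
- exact: gen_subalg.
- exact: oz_supp.
- by move=> M /Lie_lin; apply: supp_eq0.
- by move=> M N e _ _; apply: oadd_supp.
- by move=> c M e _; apply: oscale_supp.
- by move=> M e /Lie_lin lM; apply: ope_supp.
- by move=> M e /Lie_lin lM; apply: opo_supp.
- by move=> f M N e fA /Lie_lin lM /Lie_lin lN; case: fA => [<- | //]; apply: obr_Wadd.
- by move=> M e /Lie_lin lM _; apply: ocomp_Wadd.
- by [].
- by move=> M e /Lie_W H /H[n [Wn _]]; exists n.
- exact: We_adm.
- exact: We_uniq.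
Qed.

Lemma Ass_graded : graded (A := AssOp) (gen (A := AssOp) S) esupp We (Wadd We).
Proof.
split.
- exact: gen_subalg.
- exact: oz_supp.
- by move=> M /Ass_lin; apply: supp_eq0.
- by move=> M N e _ _; apply: oadd_supp.
- by move=> c M e _; apply: oscale_supp.
- by [].
- by move=> M e _ /oz_supp.
- by move=> f M N e fA /Ass_lin lM /Ass_lin lN; case: fA => [<- | //]; apply: ocomp_Wadd.
- by move=> M e /Ass_lin lM _; apply: ocomp_Wadd.
- by [].
- by move=> M e /Ass_W H /H[n [Wn _]]; exists n.
- exact: We_adm.
- exact: We_uniq.
Qed.

Lemma Lie_linear : linear_ops (A := LieOp) S.
Proof.
split.
- exact: oaddA.
- exact: oaddC.
- exact: oadd0.
- exact: oscaleD.
- exact: oscale0.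
- exact: opeD.
- exact: ope0.
- exact: opoD.
- exact: opo0.
- by move=> M /Lie_lin; apply: opo_id.
- by move=> f M N P [<- | //] /Lie_lin ? /Lie_lin ? /Lie_lin ?; apply: obrDl.
- by move=> f M N P [<- | //] /Lie_lin ? /Lie_lin ? /Lie_lin ?; apply: obrDr.
- by move=> f M [<- | //] /Lie_lin ?; apply: obr0l.
- by move=> f M [<- | //] /Lie_lin ?; apply: obr0r.
- by [].
exists obr; first by left.
move=> M N /Lie_lin lM /Lie_lin lN oM oN; rewrite /= obr_odd //.
by rewrite ocompDl !ocompDr // (oaddC (ocomp N M)) oaddACA.
Qed.

Lemma Ass_linear : linear_ops (A := AssOp) S.
Proof.
split=> //.
- exact: oaddA.
- exact: oaddC.
- exact: oadd0.
- exact: oscaleD.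
- exact: oscale0.
- by move=> M N; rewrite /= oadd0.
- by move=> f M N P [<- | //] *; apply: ocompDl.
- by move=> f M N P [<- | //] _ _ /Ass_lin lP; apply: ocompDr.
- by move=> f M [<- | //].
- by move=> f M [<- | //] /Ass_lin lM; apply: ocomp0.
exists ocomp; first by left.
move=> M N _ _ <- <- /=; rewrite /ocomp /oadd.
by apply: functional_extensionality => f; rewrite /oz !addr0.
Qed.

Lemma Lie_degs_fin M : gen (A := LieOp) S M ->
  exists l : seq triple, forall e n, esupp M e -> We e n -> tri n \in l.
Proof. exact: (gen_degs_fin Lie_linear Lie_graded Shom). Qed.

Lemma Lie_split (Q : triple -> bool) M : gen (A := LieOp) S M ->
  exists a b, [/\ gen (A := LieOp) S a, gen (A := LieOp) S b, M = oadd a b,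
    forall e n, esupp a e -> We e n -> Q (tri n) = true &
    forall e n, esupp b e -> We e n -> Q (tri n) = false].
Proof. exact: (gen_split Lie_linear Lie_graded Shom). Qed.

Lemma Lie_continuum :
  (forall n, exists M e, [/\ gen (A := LieOp) S M, esupp M e &
     forall e' k, esupp M e' -> We e' k -> tri k = vdeg n]) ->
  continuum_ln_decompositions (A := LieOp) (gen (A := LieOp) S).
Proof.
move=> H; apply: (graded_continuum (graded_kcompose Lie_graded)) => //.
- move=> M e n gM eM Wn n0; have [k [Wk k0]] := Lie_W gM eM.
  by case: k0; rewrite -n0; apply: We_uniq Wk Wn.
- exact: Lie_degs_fin.
- by move=> Q M _; apply: Lie_split.
Qed.

Lemma Ass_continuum :
  (forall n, exists M e, [/\ gen (A := AssOp) S M, esupp M e &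
     forall e' k, esupp M e' -> We e' k -> tri k = vdeg n]) ->
  continuum_ln_decompositions (A := AssOp) (gen (A := AssOp) S).
Proof.
move=> H; apply: (graded_continuum (graded_kcompose Ass_graded)) => //.
- move=> M e n gM eM Wn n0; have [k [Wk k0]] := Ass_W gM eM.
  by case: k0; rewrite -n0; apply: We_uniq Wk Wn.
- exact: (gen_degs_fin Ass_linear Ass_graded Shom).
- by move=> Q M _; apply: (gen_split Ass_linear Ass_graded Shom).
Qed.

End Generated.

End LinearOperators.

(** * The operators v_n *)

Section Fermions.
Local Open Scope ring_scope.
Variables (K : fieldType) (V : lmodType K) (e : seq nat -> V).
Implicit Types (s t : seq nat) (f g : V).

Definition cnt j s := count (fun y => y < j)%N s.
Definition ins j s := sort leq (j :: s).

Lemma sorted_ext s t : sorted ltn s -> sorted ltn t -> s =i t -> s = t.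
Proof. exact: (irr_sorted_eq ltn_trans ltnn). Qed.

Lemma sorted_uniq_ltn s : sorted ltn s -> uniq s.
Proof. exact: (sorted_uniq ltn_trans ltnn). Qed.

Lemma sort_ltn s : uniq s -> sorted ltn (sort leq s).
Proof. by move=> us; rewrite ltn_sorted_uniq_leq sort_uniq us (sort_sorted leq_total). Qed.

Lemma mem_ins j s x : (x \in ins j s) = (x == j) || (x \in s).
Proof. by rewrite mem_sort inE. Qed.

Lemma sorted_ins j s : sorted ltn s -> j \notin s -> sorted ltn (ins j s).
Proof. by move=> ss js; apply: sort_ltn; rewrite /= js sorted_uniq_ltn. Qed.

Lemma cnt_ins i j s : cnt i (ins j s) = ((j < i) + cnt i s)%N.
Proof. by rewrite /cnt count_sort. Qed.

Lemma sorted_rem j s : sorted ltn s -> sorted ltn (rem j s).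
Proof. by apply: subseq_sorted (rem_subseq j s); apply: ltn_trans. Qed.

Lemma mem_remE j s x : sorted ltn s -> (x \in rem j s) = (x != j) && (x \in s).
Proof. by move=> /sorted_uniq_ltn us; rewrite mem_rem_uniq. Qed.

Lemma cnt_rem i j s : j \in s -> (cnt i (rem j s) + (j < i) = cnt i s)%N.
Proof. by move=> js; rewrite /cnt (permP (perm_to_rem js)) /= addnC. Qed.

Lemma index_cnt j s : sorted ltn s -> j \in s -> index j s = cnt j s.
Proof.
elim: s => //= x s IHs ps; rewrite inE eq_sym; case: eqP => [<- _ | xj /= js].
  rewrite ltnn /cnt; apply/esym/eqP; rewrite -leqn0 leqNgt -has_count; apply/hasPn => y ys /=.
  by have := allP (order_path_min ltn_trans ps) y ys; rewrite /= -leqNgt => /ltnW.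
rewrite (IHs (path_sorted ps) js) -/(cnt j s).
by have /= -> := allP (order_path_min ltn_trans ps) j js.
Qed.

Lemma sgn_par (a b : nat) : odd a = odd b -> sgn K a = sgn K b.
Proof. by rewrite !sgn_odd => ->. Qed.

Lemma scale_sgn a b f : sgn K a *: (sgn K b *: f) = sgn K (a + b) *: f.
Proof. by rewrite scalerA sgnD. Qed.

Lemma opp_sgn a f : - (sgn K a *: f) = sgn K a.+1 *: f.
Proof. by rewrite -scaleNr /sgn exprS mulN1r. Qed.

Hypothesis ext : forall M N : V -> V, islin M -> islin N ->
  (forall s, sorted ltn s -> M (e s) = N (e s)) -> forall f, M f = N f.
Variables X D : nat -> V -> V.
Hypotheses (Xlin : forall j, islin (X j)) (Dlin : forall j, islin (D j)).
Hypothesis XE : forall j s, sorted ltn s ->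
  X j (e s) = if j \in s then 0 else sgn K (cnt j s) *: e (ins j s).
Hypothesis DE : forall j s, sorted ltn s ->
  D j (e s) = if j \in s then sgn K (cnt j s) *: e (rem j s) else 0.

Lemma X_mem j s : sorted ltn s -> j \in s -> X j (e s) = 0.
Proof. by move=> ss js; rewrite XE // js. Qed.

Lemma X_notin j s : sorted ltn s -> j \notin s -> X j (e s) = sgn K (cnt j s) *: e (ins j s).
Proof. by move=> ss js; rewrite XE // (negbTE js). Qed.

Lemma D_notin j s : sorted ltn s -> j \notin s -> D j (e s) = 0.
Proof. by move=> ss js; rewrite DE // (negbTE js). Qed.

Lemma D_mem j s : sorted ltn s -> j \in s -> D j (e s) = sgn K (cnt j s) *: e (rem j s).
Proof. by move=> ss js; rewrite DE // js. Qed.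

(** Checked on monomials, like the other Clifford relations: of the two counts that give the signs,
    exactly one changes when the order is exchanged. *)
Lemma XX_anti i j f : i != j -> X i (X j f) = - X j (X i f).
Proof.
move=> ij; move: f; apply: ext => [||s ss]; first exact: linC.
  by apply: linNf; apply: linC.
case: (boolP (j \in s)) => js; case: (boolP (i \in s)) => si.
- by rewrite (X_mem ss js) (X_mem ss si) (lin0 (Xlin i)) (lin0 (Xlin j)) oppr0.
- rewrite X_mem // (X_notin ss si) (linZ _ _ (Xlin j)) (lin0 (Xlin i)).
  by rewrite X_mem ?sorted_ins ?mem_ins ?js ?orbT // scaler0 oppr0.
- rewrite (X_mem ss si) (X_notin ss js) (linZ _ _ (Xlin i)) (lin0 (Xlin j)).
  by rewrite X_mem ?sorted_ins ?mem_ins ?si ?orbT // scaler0 oppr0.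
rewrite (X_notin ss si) (X_notin ss js) (linZ _ _ (Xlin j)) (linZ _ _ (Xlin i)).
rewrite !X_notin ?sorted_ins ?mem_ins ?negb_or ?si ?js ?ij // 1?eq_sym ?ij //.
rewrite !scale_sgn opp_sgn !cnt_ins; congr (_ *: e _).
  by apply: sgn_par; case: (ltngtP i j) ij => //= _ _; lia.
apply: sorted_ext; rewrite ?sorted_ins ?mem_ins ?negb_or ?si ?js ?ij 1?eq_sym ?ij //.
by move=> x; rewrite !mem_ins orbCA.
Qed.

Lemma XX0 i f : X i (X i f) = 0.
Proof.
move: f; apply: (ext (N := fun _ => 0)) => [||s ss]; first exact: linC.
  by move=> c f g; rewrite scaler0 addr0.
case: (boolP (i \in s)) => si; first by rewrite X_mem // lin0.
by rewrite X_notin // linZ // X_mem ?scaler0 ?sorted_ins ?mem_ins ?eqxx.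
Qed.

Lemma DD0 i f : D i (D i f) = 0.
Proof.
move: f; apply: (ext (N := fun _ => 0)) => [||s ss]; first exact: linC.
  by move=> c f g; rewrite scaler0 addr0.
case: (boolP (i \in s)) => si; last by rewrite D_notin // lin0.
by rewrite D_mem // linZ // D_notin ?scaler0 ?sorted_rem ?mem_remE ?eqxx.
Qed.

Lemma DD_anti i j f : i != j -> D i (D j f) = - D j (D i f).
Proof.
move=> ij; have ji : j != i by rewrite eq_sym.
move: f; apply: ext => [||s ss]; first exact: linC.
  by apply: linNf; apply: linC.
case: (boolP (j \in s)) => js; case: (boolP (i \in s)) => si.
- rewrite (D_mem ss si) (D_mem ss js) (linZ _ _ (Dlin j)) (linZ _ _ (Dlin i)).
  rewrite !D_mem ?sorted_rem ?mem_remE ?si ?js ?ij ?ji //.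
  rewrite !scale_sgn opp_sgn -(cnt_rem i js) -(cnt_rem j si); congr (_ *: e _).
    by apply: sgn_par; case: (ltngtP i j) ij => //= _ _; lia.
  apply: sorted_ext; rewrite ?sorted_rem //.
  by move=> x; rewrite !mem_remE ?sorted_rem // andbCA.
- rewrite (D_notin ss si) (D_mem ss js) (linZ _ _ (Dlin i)) (lin0 (Dlin j)).
  by rewrite D_notin ?sorted_rem ?mem_remE ?(negbTE si) ?andbF // scaler0 oppr0.
- rewrite (D_notin ss js) (D_mem ss si) (linZ _ _ (Dlin j)) (lin0 (Dlin i)).
  by rewrite D_notin ?sorted_rem ?mem_remE ?(negbTE js) ?andbF // scaler0 oppr0.
- by rewrite (D_notin ss js) (D_notin ss si) (lin0 (Dlin i)) (lin0 (Dlin j)) oppr0.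
Qed.

Lemma DX_anti i j f : i != j -> D i (X j f) = - X j (D i f).
Proof.
move=> ij; have ji : j != i by rewrite eq_sym.
move: f; apply: ext => [||s ss]; first exact: linC.
  by apply: linNf; apply: linC.
case: (boolP (j \in s)) => js; case: (boolP (i \in s)) => si.
- rewrite (X_mem ss js) (D_mem ss si) (linZ _ _ (Xlin j)) (lin0 (Dlin i)).
  by rewrite X_mem ?sorted_rem ?mem_remE ?js ?ji // scaler0 oppr0.
- by rewrite (X_mem ss js) (D_notin ss si) (lin0 (Xlin j)) (lin0 (Dlin i)) oppr0.
- rewrite (X_notin ss js) (D_mem ss si) (linZ _ _ (Dlin i)) (linZ _ _ (Xlin j)).
  rewrite D_mem ?sorted_ins ?mem_ins ?si ?orbT //.
  rewrite X_notin ?sorted_rem ?mem_remE ?(negbTE js) ?andbF //.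
  rewrite !scale_sgn opp_sgn cnt_ins -(cnt_rem j si); congr (_ *: e _).
    by apply: sgn_par; case: (ltngtP i j) ij => //= _ _; lia.
  apply: sorted_ext; rewrite ?sorted_rem ?sorted_ins ?sorted_rem ?mem_remE ?(negbTE js) ?andbF //.
  move=> x; rewrite mem_remE ?sorted_ins // !mem_ins mem_remE //.
  by case: (eqVneq x j) => [-> | _] //=; rewrite ji.
- rewrite (D_notin ss si) (X_notin ss js) (linZ _ _ (Dlin i)) (lin0 (Xlin j)).
  by rewrite D_notin ?sorted_ins ?mem_ins ?negb_or ?ij ?si // scaler0 oppr0.
Qed.

Lemma DX_can i f : D i (X i f) = f - X i (D i f).
Proof.
move: f; apply: ext => [||s ss]; first exact: linC.
  by apply: (@linDf _ _ (fun f => f)) => //; apply: linNf; apply: linC.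
case: (boolP (i \in s)) => si.
  rewrite (X_mem ss si) (lin0 (Dlin i)) (D_mem ss si) (linZ _ _ (Xlin i)).
  rewrite X_notin ?sorted_rem ?mem_remE ?eqxx // scale_sgn -(cnt_rem i si) ltnn addn0 addnn.
  rewrite sgn_odd odd_double scale1r (_ : ins i (rem i s) = s) ?subrr //.
  apply: sorted_ext; rewrite ?sorted_ins ?sorted_rem ?mem_remE ?eqxx // => x.
  by rewrite mem_ins mem_remE //; case: eqP => [-> | ].
rewrite (D_notin ss si) (lin0 (Xlin i)) subr0 (X_notin ss si) (linZ _ _ (Dlin i)).
rewrite D_mem ?sorted_ins ?mem_ins ?eqxx // scale_sgn cnt_ins ltnn add0n addnn.
rewrite sgn_odd odd_double scale1r; congr e.
apply: sorted_ext; rewrite ?sorted_rem ?sorted_ins // => x.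
rewrite mem_remE ?sorted_ins // mem_ins; case: eqP => [-> | ] //=.
by rewrite (negbTE si).
Qed.

Definition lm a b : V :=
  if has (fun x => x \in b) a then 0 else sgn K (inv a b) *: e (sort leq (a ++ b)).

Lemma lm_cons x a b : sorted ltn (x :: a) -> sorted ltn b ->
  X x (lm a b) = lm (x :: a) b.
Proof.
move=> sa sb; rewrite /lm /=; have sa' : sorted ltn a := path_sorted sa.
have xa : x \notin a by have /= /andP[] := sorted_uniq_ltn sa.
case: (boolP (has _ a)) => [_ | nab]; first by rewrite orbT lin0.
have sab : sorted ltn (sort leq (a ++ b)).
  apply: sort_ltn; rewrite cat_uniq !sorted_uniq_ltn // andbT /=.
  by rewrite has_sym in nab.
rewrite orbF linZ //; case: (boolP (x \in b)) => xb.
  by rewrite X_mem ?scaler0 // mem_sort mem_cat xb orbT.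
rewrite X_notin // ?mem_sort ?mem_cat ?negb_or ?xa // scale_sgn; congr (sgn K _ *: e _).
  rewrite inv_cons addnC; congr (_ + _)%N; rewrite /cnt count_sort count_cat.
  rewrite (_ : count _ a = 0%N) //; apply/eqP; rewrite -leqn0 leqNgt -has_count.
  apply/hasPn => y ya /=; rewrite -leqNgt.
  by have := allP (order_path_min ltn_trans sa) y ya => /ltnW.
apply: sorted_ext.
- by rewrite sorted_ins // mem_sort mem_cat negb_or xa.
- apply: sort_ltn; rewrite /= mem_cat negb_or xa xb /=.
  by rewrite -(sort_uniq leq) sorted_uniq_ltn.
by move=> y; rewrite mem_ins !mem_sort !inE.
Qed.

Variable vv : nat -> V -> V.
Hypothesis vvlin : forall i, islin (vv i).
Let term i s k : V := if (i + 3 * k)%N \in s then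
  sgn K (index (i + 3 * k)%N s) *: lm (blk i k) (rem (i + 3 * k)%N s) else 0.
Hypothesis vvE : forall i s, sorted ltn s ->
  vv i (e s) = \sum_(k <- iota 0 (maxl s).+1) term i s k.

(** Shift of the summation index: the term k = 0 is d_i, and each later one is x_i x_{i+1} times a
    term of v_{i+3}. *)
Lemma vv_rec i f : vv i f = D i f + X i (X i.+1 (vv (i + 3) f)).
Proof.
move: f; apply: ext => // [|s ss].
  by apply: linDf => //; apply: linC => //; apply: linC.
rewrite !vvE // (lin_sum _ _ _ (Xlin i.+1)) (lin_sum _ _ _ (Xlin i)).
have T0 : term i s 0 = D i (e s).
  rewrite /term muln0 addn0 DE //; case: ifP => // si.
  rewrite /lm /= /inv big_nil -[sgn K 0]/1 scale1r index_cnt //; congr (_ *: e _).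
  by rewrite sorted_sort //; [exact: leq_trans | apply: sub_sorted (sorted_rem i ss) => x y /ltnW].
have TS k : X i (X i.+1 (term (i + 3) s k)) = term i s k.+1.
  rewrite /term (_ : i + 3 + 3 * k = i + 3 * k.+1)%N; last by lia.
  case: ifP => si; last by rewrite (lin0 (Xlin _)) (lin0 (Xlin _)).
  rewrite !linZ //; congr (_ *: _); have sb := blk_sorted i k.+1.
  rewrite blkS addn1 in sb *; have sr := sorted_rem (i + 3 * k.+1)%N ss.
  by rewrite !lm_cons //; apply: path_sorted sb.
(* The shift creates one term beyond the range of the sum; its derivation has an index exceeding
   [maxl s]. *)
have last0 : term i s (maxl s).+1 = 0.
  by rewrite /term; case: ifP => // /maxl_ge; lia.
transitivity (\sum_(k <- iota 0 (maxl s).+2) term i s k).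
  rewrite -[(maxl s).+2]addn1 iotaD big_cat big_seq1 add0n last0.
  exact: esym (addr0 _).
have -> : iota 0 (maxl s).+2 = 0%N :: iota 1 (maxl s).+1 by [].
rewrite big_cons T0; congr (_ + _).
by rewrite (iotaDl 1 0) big_map; apply: eq_bigr => k _; rewrite add1n TS.
Qed.

Lemma vv_above m s : sorted ltn s -> (forall y, y \in s -> y < m)%N -> vv m (e s) = 0.
Proof.
move=> ss sm; rewrite vvE //; apply: big1 => k _; rewrite /term.
by case: ifP => // /sm; lia.
Qed.

(** On a fixed monomial the recursion for v_m stops once m exceeds all indices in it. So
    anticommutation with the x_i and d_i for i > j passes to v_m by descending induction on m; the
    last hypothesis on Y is its base. *)
Lemma vv_anti_ext (Y : V -> V) j m : islin Y -> (j < m)%N ->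
    (forall i f, (j < i)%N -> Y (X i f) = - X i (Y f)) ->
    (forall i f, (j < i)%N -> Y (D i f) = - D i (Y f)) ->
    (forall s i, sorted ltn s -> (j < i)%N -> (forall y, y \in s -> y < i)%N ->
       vv i (Y (e s)) = 0) ->
  forall f, Y (vv m f) = - vv m (Y f).
Proof.
move=> lY jm YX YD Y0; apply: ext => [||s ss]; first exact: linC.
  by apply: linNf; apply: linC.
have [k] : exists k, forall y, y \in s -> (y < m + k)%N.
  by exists (maxl s).+1 => y /maxl_ge; lia.
elim: k m jm => [|k IHk] m jm H.
  rewrite addn0 in H; rewrite vv_above // lin0 // Y0 ?oppr0 //.
rewrite (vv_rec m (e s)) (vv_rec m (Y (e s))) (linD _ _ lY) YD // YX // YX; last by lia.
rewrite (linN _ (Xlin m)) opprK opprD; congr (_ + _).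
rewrite IHk; [|by lia | by move=> y /H; lia].
by rewrite !linN.
Qed.

Lemma vv_X j m f : (j < m)%N -> X j (vv m f) = - vv m (X j f).
Proof.
move=> jm; move: f; apply: (@vv_anti_ext _ j) => //.
- by move=> i f ji; apply: XX_anti; lia.
- by move=> i f ji; rewrite DX_anti ?opprK //; lia.
move=> s i ss ji si; case: (boolP (j \in s)) => js; first by rewrite X_mem // lin0.
rewrite X_notin // linZ // vv_above ?scaler0 ?sorted_ins // => y.
by rewrite mem_ins => /orP[/eqP -> | /si].
Qed.

Lemma vv_D j m f : (j < m)%N -> D j (vv m f) = - vv m (D j f).
Proof.
move=> jm; move: f; apply: (@vv_anti_ext _ j) => //.
- by move=> i f ji; apply: DX_anti; lia.
- by move=> i f ji; apply: DD_anti; lia.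
move=> s i ss ji si; case: (boolP (j \in s)) => js; last by rewrite D_notin // lin0.
rewrite D_mem // linZ // vv_above ?scaler0 ?sorted_rem // => y.
by rewrite mem_remE // => /andP[_ /si].
Qed.

(** Put W = v_{n+3}. The square of d_n and the term with x_n twice vanish; as d_n anticommutes with
    x_{n+1} and W, the mixed terms d_n x_n x_{n+1} W + x_n x_{n+1} W d_n leave x_{n+1} W. *)
Lemma vv_sq n f : vv n (vv n f) = X n.+1 (vv (n + 3) f).
Proof.
set W := vv (n + 3); rewrite (vv_rec n (vv n f)) (vv_rec n f) -/W.
rewrite (linD _ _ (Dlin n)) DD0 add0r DX_can (DX_anti _ (i := n)) ?ltn_eqF //.
rewrite (vv_D f (m := n + 3)); last by lia.
rewrite (linN (W (D n f)) (Xlin n.+1)) opprK -/W.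
rewrite (linD _ _ (vvlin (n + 3) : islin W)).
have -> : W (X n (X n.+1 (W f))) = - X n (W (X n.+1 (W f))).
  by rewrite (vv_X (j := n) (m := n + 3)) ?opprK //; lia.
rewrite (linD _ _ (Xlin n.+1)) (linD _ _ (Xlin n)).
rewrite (linN _ (Xlin n.+1)) (linN _ (Xlin n)).
rewrite (XX_anti (i := n.+1) (j := n)) ?gtn_eqF //.
by rewrite (linN _ (Xlin n)) XX0 !oppr0 addr0 subrK.
Qed.

(** By [vv_sq] the left side is the commutator of v_n^2 with v_{n+1}. The terms with v_{n+4} contain
    x_{n+1} twice; in the rest d_{n+1} meets x_{n+1}, and everything but - v_{n+3} cancels. *)
Lemma vv_br n f :
  X n.+1 (vv (n + 3) (vv n.+1 f)) - vv n.+1 (X n.+1 (vv (n + 3) f)) = - vv (n + 3) f.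
Proof.
set W := vv (n + 3); rewrite (vv_rec n.+1 f) (vv_rec n.+1 (X n.+1 (W f))).
set U := vv (n.+1 + 3).
rewrite DX_can (vv_D f (j := n.+1) (m := n + 3)); last by lia.
rewrite (linN (vv (n + 3) (D n.+1 f)) (Xlin n.+1)) opprK -/W.
rewrite (linD _ _ (vvlin (n + 3) : islin W)) (linD _ _ (Xlin n.+1)).
have -> : W (X n.+1 (X n.+2 (U f))) = - X n.+1 (W (X n.+2 (U f))).
  by rewrite (vv_X (j := n.+1) (m := n + 3)) ?opprK //; lia.
rewrite (linN _ (Xlin n.+1)) XX0 oppr0 addr0.
have -> : U (X n.+1 (W f)) = - X n.+1 (U (W f)).
  by rewrite (vv_X (j := n.+1) (m := n.+1 + 3)) ?opprK //; lia.
rewrite (linN _ (Xlin n.+2)) (linN _ (Xlin n.+1)).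
rewrite (XX_anti (i := n.+2) (j := n.+1)) ?gtn_eqF //.
rewrite (linN _ (Xlin n.+1)) XX0 !oppr0 addr0 opprD addrCA subrr addr0.
by [].
Qed.

End Fermions.

Section FreeModule.
Local Open Scope ring_scope.
Variables (K : fieldType) (T : choiceType).
Local Notation L := {malg K[T]}.

Lemma coefU_neq0 (m m' : T) : (<< m >> : L)@_m' != 0 -> m = m'.
Proof. by rewrite mcoeffU; case: (eqVneq m m') => // _; rewrite eqxx. Qed.

Lemma coefU_eq1 (m : T) : (<< m >> : L)@_m = 1.
Proof. exact: mcoeffUU. Qed.

Lemma coef0_neq0 (m : T) : (0 : L)@_m != 0 -> False.
Proof. by rewrite mcoeff0 eqxx. Qed.

Lemma coefZ_neq0 (c : K) (f : L) m : (c *: f)@_m != 0 -> f@_m != 0.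
Proof. by rewrite mcoeffZ mulf_eq0 negb_or => /andP[]. Qed.

Lemma coef_sum_neq0 (r : seq nat) (F : nat -> L) m :
  (\sum_(k <- r) F k)@_m != 0 -> exists k, (F k)@_m != 0.
Proof. by rewrite raddf_sum => /sum_neq0[k [_ _ Hk]]; exists k. Qed.

Lemma scaleN1_sub (V : lmodType K) (a b c : V) : a - b = - c -> (-1) *: (a - b) = c.
Proof. by move=> ->; rewrite scaleN1r opprK. Qed.

End FreeModule.

(** * The algebras Q and A on the Grassmann algebra *)

Section Grassmann.
Local Open Scope ring_scope.
Variable K : fieldType.

Definition mpar (m : mono) := odd (size (val m)).
Definition mct (m : mono) (j : nat) := j \in val m.

Lemma mk_val (m : mono) : << m >> = mk K (val m).
Proof. by rewrite /mk valK. Qed.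

Lemma mk_sorted s (ss : sorted ltn s) : mk K s = << (exist _ s ss : mono) >>.
Proof. by rewrite /mk insubT. Qed.

Lemma mk_coef t (m : mono) : (mk K t)@_m != 0 -> t = val m.
Proof.
rewrite /mk; case: insubP => [m1 _ <- | _]; last by move/coef0_neq0.
by move/coefU_neq0 => ->.
Qed.

Lemma mk_ext (M N : End K) : islin M -> islin N ->
  (forall s, sorted ltn s -> M (mk K s) = N (mk K s)) -> forall f, M f = N f.
Proof.
move=> lM lN H; apply: (lin_eq lM lN) => m.
by have := H _ (valP m); rewrite -mk_val.
Qed.

Definition Xop (j : nat) : End K := lift (fun m : mono =>
  if j \in val m then 0 else sgn K (cnt j (val m)) *: mk K (ins j (val m))).
Definition Dop (j : nat) : End K := lift (fun m : mono =>
  if j \in val m then sgn K (cnt j (val m)) *: mk K (rem j (val m)) else 0).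

Lemma Xop_lin j : islin (Xop j). Proof. exact: lift_lin. Qed.
Lemma Dop_lin j : islin (Dop j). Proof. exact: lift_lin. Qed.
Lemma v_lin i : islin (@v K i). Proof. exact: lift_lin. Qed.

Lemma lift_mk (h : seq nat -> Lam K) s : sorted ltn s ->
  lift (fun m : mono => h (val m)) (mk K s) = h s.
Proof. by move=> ss; rewrite (mk_sorted ss); exact: lift_U. Qed.

Lemma Xop_mk j s : sorted ltn s ->
  Xop j (mk K s) = if j \in s then 0 else sgn K (cnt j s) *: mk K (ins j s).
Proof.
exact: (lift_mk (fun s => if j \in s then 0 else sgn K (cnt j s) *: mk K (ins j s))).
Qed.

Lemma Dop_mk j s : sorted ltn s ->
  Dop j (mk K s) = if j \in s then sgn K (cnt j s) *: mk K (rem j s) else 0.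
Proof.
exact: (lift_mk (fun s => if j \in s then sgn K (cnt j s) *: mk K (rem j s) else 0)).
Qed.

Lemma v_mk i s : sorted ltn s -> @v K i (mk K s) = vmono K i s.
Proof. exact: (lift_mk (vmono K i)). Qed.

Lemma v_sq n f : @v K n (v n f) = Xop n.+1 (v (n + 3) f).
Proof. exact: (vv_sq mk_ext Xop_lin Dop_lin Xop_mk Dop_mk v_lin v_mk). Qed.

Lemma v_br n f : Xop n.+1 (v (n + 3) (v n.+1 f)) - v n.+1 (Xop n.+1 (v (n + 3) f)) =
  - @v K (n + 3) f.
Proof. exact: (vv_br mk_ext Xop_lin Dop_lin Xop_mk Dop_mk v_lin v_mk). Qed.

(** The summand through v_{n+3} kills x_n, so d_n alone acts. This supplies the nonzero matrix entry
    of v_n used to tell decompositions apart. *)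
Lemma v_single n : @v K n (mk K [:: n]) = mk K [::].
Proof.
have E := vv_rec mk_ext Xop_lin Dop_lin Xop_mk Dop_mk v_lin v_mk n (mk K [:: n]).
have Z : @v K (n + 3) (mk K [:: n]) = 0.
  apply: (vv_above v_mk) => // y; rewrite inE => /eqP ->; lia.
rewrite Z (lin0 (Xop_lin n.+1)) (lin0 (Xop_lin n)) in E.
rewrite E Dop_mk // inE eqxx /cnt /= ltnn eqxx.
by rewrite -[sgn K _]/1 scale1r; exact: addr0.
Qed.

Lemma size_blk i k : size (blk i k) = (2 * k)%N.
Proof. by elim: k i => // k IHk i; rewrite blkS /= IHk; lia. Qed.

Lemma v_supp i (m m' : mono) : esupp (@v K i) (m, m') ->
  exists k, [/\ (i + 3 * k)%N \in val m,
    forall j, j \in blk i k -> j \notin rem (i + 3 * k)%N (val m) &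
    val m' = sort leq (blk i k ++ rem (i + 3 * k)%N (val m))].
Proof.
rewrite /esupp /= mk_val v_mk; last exact: (valP m).
move=> /coef_sum_neq0[k]; case: ifP => [ik | _]; last by move/coef0_neq0.
move=> /coefZ_neq0; rewrite /lmul; case: (boolP (has _ _)) => [_ /coef0_neq0 // | nh].
move=> /coefZ_neq0/mk_coef E; exists k; split=> // j jb.
by apply: contra nh => jr; apply/hasP; exists j.
Qed.

Lemma v_par i (m m' : mono) : esupp (@v K i) (m, m') -> mpar m (+) mpar m'.
Proof.
move=> /v_supp[k [ik _ E]]; rewrite /mpar E size_sort size_cat size_blk size_rem //.
rewrite oddD oddM andFb addFb; case: (val m) ik => // a s _ /=.
by case: (odd _).
Qed.

Lemma fb_shift a b a' b' n : finsupp_balanced a b n ->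
  (forall j, a' j + b j = b' j + a j)%N -> finsupp_balanced a' b' n.
Proof. by move=> [H1 H2] E; split=> // j; have := H2 j; have := E j; lia. Qed.

(** A variable not touched by the term lies in both monomials or in neither, so b - a is that of the
    term itself and [fb_blk] applies. *)
Lemma v_W i (m m' : mono) : (i < 3)%N -> esupp (@v K i) (m, m') ->
  exists2 n, We mct (m, m') n & tri n = vdeg i.
Proof.
move=> i3 /v_supp[k [ik dis E]]; have [n Hn En] := fb_blk k i3; exists n => //.
apply: fb_shift Hn _ => j; rewrite /mct /= E mem_sort mem_cat.
have := dis j; rewrite (mem_remE _ _ (valP m)).
case: (boolP (j \in blk i k)) => [_ /(_ isT) | _ _] /=.
  by rewrite negb_and negbK; case: eqP => [-> | _ /negbTE -> //]; rewrite ik.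
by case: eqP => [-> | _]; rewrite /= ?ik // ?addn0.
Qed.

Let S : seq (End K) := [:: @v K 0; @v K 1; @v K 2].

Lemma S_inv M : InL M S -> exists2 i, (i < 3)%N & M = @v K i.
Proof.
by case=> [<- | [<- | [<- | //]]]; [exists 0%N | exists 1%N | exists 2%N].
Qed.

Lemma S_lin M : InL M S -> islin M.
Proof. by case/S_inv => i _ ->; apply: v_lin. Qed.

Lemma S_W M e : InL M S -> esupp M e -> exists n, We mct e n /\ tri n <> t0.
Proof.
case/S_inv => i i3 ->; case: e => m m' /(v_W i3)[n Wn En].
by exists n; split=> //; rewrite En; apply: vdeg_nz.
Qed.

Lemma S_hom M : InL M S -> exists d, forall e n, esupp M e -> We mct e n -> tri n = d.
Proof.
case/S_inv => i i3 ->; exists (vdeg i) => -[m m'] n /(v_W i3)[n' Wn' <-] Wn.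
exact: We_uniq Wn Wn'.
Qed.

Let GL := LieOp K mpar.
Let GA := AssOp K mono.

Lemma v_odd i : opo mpar (@v K i) = @v K i.
Proof. exact: (opo_flip (v_lin i) (@v_par i)). Qed.

Lemma v2_even i : ope mpar (ocomp (@v K i) (@v K i)) = ocomp (@v K i) (@v K i) /\
  opo mpar (ocomp (@v K i) (@v K i)) = @oz K mono.
Proof.
apply: ope_flip; first exact: islin_comp (v_lin i) (v_lin i).
move=> m m' /(ocomp_supp (v_lin i))[m1 [/v_par h1 /v_par h2]].
by move: h1 h2; case: (mpar m); case: (mpar m1); case: (mpar m').
Qed.

Lemma v_next n : @v K n.+3 = oscale (-1)
  (oadd (ocomp (ocomp (@v K n) (@v K n)) (@v K n.+1))
        (oopp (ocomp (@v K n.+1) (ocomp (@v K n) (@v K n))))).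
Proof.
apply: functional_extensionality => f; apply: esym; apply: scaleN1_sub.
have E1 := v_sq n (v n.+1 f); have E2 := f_equal (@v K n.+1) (v_sq n f).
have B := v_br n f; rewrite addn3 in E1 E2 B.
exact: (eq_trans (f_equal2 (fun a b => a - b) E1 E2) B).
Qed.

Lemma v_Lie n : gen (A := GL) S (@v K n) /\
  hom (A := GL) (@esupp K mono) (We mct) (vdeg n) (@v K n).
Proof.
have G := Lie_graded mpar S_lin S_W.
elim/ltn_ind: n => n IHn.
have base i : (i < 3)%N -> InL (@v K i) S -> gen (A := GL) S (@v K i) /\
    hom (A := GL) (@esupp K mono) (We mct) (vdeg i) (@v K i).
  move=> i3 iS; split; first exact: gen_in.
  move=> [m m'] k /(v_W i3)[k' Wk' <-] Wk; exact: We_uniq Wk Wk'.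
case: n IHn => [|[|[|n]]] IHn.
- by apply: base => //; left.
- by apply: base => //; right; left.
- by apply: base => //; right; right; left.
have [P0 h0] := IHn n ltac:(lia); have [P1 h1] := IHn n.+1 ltac:(lia).
have [ev od] := v2_even n.
have -> : @v K n.+3 = oscale (-1) (obr mpar (ocomp (@v K n) (@v K n)) (@v K n.+1)).
  rewrite v_next (obr_even _ (v_lin n.+1) ev od) //.
  exact: islin_comp (v_lin n) (v_lin n).
have Ps : gen (A := GL) S (ocomp (@v K n) (@v K n)).
  exact: (gen_sq (A := GL) P0 (v_odd n)).
have Pb : gen (A := GL) S (obr mpar (ocomp (@v K n) (@v K n)) (@v K n.+1)).
  exact: (gen_op (A := GL) (or_introl erefl) Ps P1).
split; first exact: (gen_scale (A := GL) (-1) Pb).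
rewrite vdeg_rec; apply: (hom_scale G) Pb _.
by apply: (hom_op G (or_introl erefl) Ps P1 _ h1); apply: (hom_sq G P0 (v_odd n) h0).
Qed.

Lemma v_Ass n : gen (A := GA) S (@v K n).
Proof.
elim/ltn_ind: n => n IHn; case: n IHn => [|[|[|n]]] IHn.
- by apply: (gen_in (A := GA)); left.
- by apply: (gen_in (A := GA)); right; left.
- by apply: (gen_in (A := GA)); right; right; left.
have P0 := IHn n ltac:(lia); have P1 := IHn n.+1 ltac:(lia).
have op M N : gen (A := GA) S M -> gen (A := GA) S N -> gen (A := GA) S (ocomp M N).
  by apply: (gen_op (A := GA)); left.
have opp M : gen (A := GA) S M -> gen (A := GA) S (oopp M).
  have <- : oscale (-1) M = oopp M.
    by apply: functional_extensionality => f; exact: scaleN1r.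
  exact: (gen_scale (A := GA)).
rewrite v_next; apply: (gen_scale (A := GA)); apply: (gen_add (A := GA)).
  exact: (op _ _ (op _ _ P0 P0) P1).
exact: (opp _ (op _ _ P1 (op _ _ P0 P0))).
Qed.

Lemma v_esupp n : exists e, esupp (@v K n) e.
Proof.
have s1 : sorted ltn [:: n] by []; have s0 : sorted ltn (Nil nat) by [].
pose m1 : mono := exist _ [:: n] s1; pose m0 : mono := exist _ [::] s0.
have E1 : @v K n << m1 >> = << m0 >>.
  exact: (eq_trans (f_equal (@v K n) (esym (mk_sorted s1)))
                   (eq_trans (v_single n) (mk_sorted s0))).
have E2 := eq_trans (f_equal (fun f : Lam K => f@_m0) E1) (coefU_eq1 K m0).
exists (m1, m0); apply/negP => /eqP H.
by have /eqP := eq_trans (esym E2) H; rewrite oner_eq0.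
Qed.

Theorem Qalg_continuum : continuum_ln_decompositions (A := LieEnd K) (Qalg K).
Proof.
(* [LieEnd K] and [LieOp K mpar] agree up to conversion. *)
suff H : continuum_ln_decompositions (A := GL) (gen (A := GL) S) by exact: H.
apply: (Lie_continuum (par := mpar) S_lin S_W S_hom) => n.
have [gn hn] := v_Lie n; have [e En] := v_esupp n.
by exists (@v K n), e.
Qed.

Theorem Aalg_continuum : continuum_ln_decompositions (A := AssEnd K) (Aalg K).
Proof.
suff H : continuum_ln_decompositions (A := GA) (gen (A := GA) S) by exact: H.
apply: (Ass_continuum S_lin S_W S_hom) => n.
have [gn hn] := v_Lie n; have [e En] := v_esupp n.
by exists (@v K n), e; split=> //; apply: v_Ass.
Qed.

Lemma Q_lin M : Qalg K M -> islin M.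
Proof. exact: (Lie_lin (par := mpar) S_lin). Qed.

Lemma Q_W M e : Qalg K M -> esupp M e -> exists n, We mct e n /\ tri n <> t0.
Proof. by move=> QM; apply: (Lie_W (par := mpar) S_lin S_W). Qed.

Lemma Q_degs_fin M : Qalg K M ->
  exists l : seq triple, forall e n, esupp M e -> We mct e n -> tri n \in l.
Proof. exact: (Lie_degs_fin (par := mpar) S_lin S_W S_hom). Qed.

Lemma Q_split (P : triple -> bool) M : Qalg K M ->
  exists a b, [/\ Qalg K a, Qalg K b, M = eadd a b,
    forall e n, esupp a e -> We mct e n -> P (tri n) = true &
    forall e n, esupp b e -> We mct e n -> P (tri n) = false].
Proof. exact: (Lie_split (par := mpar) S_lin S_W S_hom). Qed.

Lemma v_Q n : Qalg K (@v K n) /\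
  forall e k, esupp (@v K n) e -> We mct e k -> tri k = vdeg n.
Proof. exact: (v_Lie n). Qed.

End Grassmann.

(** * The Jordan superalgebras *)

Section KantorDouble.
Local Open Scope ring_scope.
Variable K : fieldType.

Definition jsupp (u : Jcar K) (i : bool * seq nat) : Prop :=
  hsupp (if i.1 then u.2 else u.1) i.2.
Definition jW (i : bool * seq nat) (n : nat -> nat) : Prop := Wt i.2 n.
Definition jbar (i : bool * seq nat) : bool := i.1.
Definition junit (i : bool * seq nat) : bool := i.1 && (i.2 == [::]).

Lemma hflip_supp (f : Hf K) t : hsupp (hflip f) t -> hsupp f t.
Proof. by rewrite /hsupp /hflip mulf_eq0 negb_or => /andP[]. Qed.

Lemma hflip_Palg f : Palg K f -> Palg K (hflip f).
Proof.
move=> Pf; have -> : hflip f = hadd (hpe f) (hscale (-1) (hpo f)).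
  apply: functional_extensionality => t; rewrite /hflip /hadd /hscale /hpe /hpo sgn_odd.
  by case: (odd _); rewrite ?add0r // mulr0 addr0 mul1r.
apply: (gen_add (A := Halg K)); first exact: (gen_pe (A := Halg K)).
by apply: (gen_scale (A := Halg K)); apply: (gen_po (A := Halg K)).
Qed.

Lemma hmul_Palg f g : Palg K f -> Palg K g -> Palg K (hmul f g).
Proof. by apply: (gen_op (A := Halg K)); left. Qed.

Lemma hbr_Palg f g : Palg K f -> Palg K g -> Palg K (hbr f g).
Proof. by apply: (gen_op (A := Halg K)); right; left. Qed.

Lemma hadd_Palg f g : Palg K f -> Palg K g -> Palg K (hadd f g).
Proof. exact: (gen_add (A := Halg K)). Qed.

Lemma jprod_Jo u w : Jo K u -> Jo K w -> Jo K (jprod u w).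
Proof.
case: u w => [a b] [c d] [[/= Pa a0] Pb] [[/= Pc c0] Pd].
have [Pc' Pd'] := (hflip_Palg Pc, hflip_Palg Pd); split=> /=; last first.
  by apply: hadd_Palg; apply: hmul_Palg.
split; first by apply: hadd_Palg; [apply: hmul_Palg | apply: hbr_Palg].
by rewrite /hadd hmul_const // hbr_const // addr0.
Qed.

Lemma jprod_supp u w i : jsupp (jprod u w) i ->
  exists i1 i2, [/\ jsupp u i1, jsupp w i2 & kcompose jW jbar junit i1 i2 i].
Proof.
case: u w i => [a b] [c d] [[|] t]; rewrite /jsupp /=.
  case/hadd_supp => /hmul_supp[p [q [sp sq st pt]]].
    exists (false, p), (true, q); split=> //; split=> //.
    by move=> n1 n2; apply: (Wt_cat st pt).
  exists (true, p), (false, q); split=> //; first exact: hflip_supp.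
  by split=> //; move=> n1 n2; apply: (Wt_cat st pt).
case/hadd_supp => [/hmul_supp[p [q [sp sq st pt]]] | /hbr_supp[p [q [sp sq ct]]]].
  exists (false, p), (false, q); split=> //; split=> //.
  by move=> n1 n2; apply: (Wt_cat st pt).
exists (true, p), (true, q); split=> //; first exact: hflip_supp.
split=> //; first by move=> n1 n2; apply: (Wt_contracted ct).
(* Nothing can be contracted with an empty monomial, so neither factor of a nonzero bracket term is
   1bar. *)
rewrite /junit /= => _ _; split; apply/eqP => E; rewrite E in ct.
  by case: (contracted_nil q t).
by case: (contracted_nil p t).
Qed.

Lemma Jo_subalg : is_subalg (A := Jalg K) (Jo K).
Proof.
have [P0 PD PZ Pp _] := Po_subalg K.
have [A0 AD AZ Ap _] := gen_subalg (A := Halg K) [:: hone K; VV K 0; VV K 1; VV K 2].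
split.
- by split.
- by move=> u w [? ?] [? ?]; split; [apply: PD | apply: AD].
- by move=> c u [? ?]; split; [apply: PZ | apply: AZ].
- move=> u [/Pp[? ?] /Ap[? ?]]; by split; split.
- split; first by move=> f u w [<- | //]; apply: jprod_Jo.
  by move=> u Ju _; apply: jprod_Jo.
Qed.

Lemma Jo_graded : graded (A := Jalg K) (Jo K) jsupp jW (kcompose jW jbar junit).
Proof.
split.
- exact: Jo_subalg.
- by case=> [[|] t]; rewrite /jsupp /hsupp /= eqxx.
- move=> [a b] _ H; congr (_, _); apply: functional_extensionality => t;
    apply/eqP/negPn/negP; [exact: (H (false, t)) | exact: (H (true, t))].
- by move=> u w [[|] t] _ _; apply: hadd_supp.
- by move=> c u [[|] t] _; apply: hscale_supp.
- by move=> u [[|] t] _; [apply: hpo_supp | apply: hpe_supp].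
- by move=> u [[|] t] _; [apply: hpe_supp | apply: hpo_supp].
- by move=> f u w i [<- | //] _ _; apply: jprod_supp.
- by move=> u i _ _; apply: jprod_supp.
- by move=> i1 i2 i [].
- move=> u [[|] t] [[P1 _] P2] s.
    by have [n [Wn _]] := Palg_W P2 s; exists n.
  by have [n [Wn _]] := Palg_W P1 s; exists n.
- by move=> i n; apply: Wt_adm.
- by move=> i n n'; apply: Wt_uniq.
Qed.

Theorem Jo_continuum : continuum_ln_decompositions (A := Jalg K) (Jo K).
Proof.
apply: (graded_continuum Jo_graded).
- by move=> i /andP[].
- move=> [b t] n /andP[_ /eqP /= ->] Wn; exact: Wt_uniq Wn Wt_nil.
- move=> u [[|] t] n [Po1 P2] s Wn n0; last by case: (Po_deg Po1 s Wn).
  have [k [Wk Ek]] := Palg_W P2 s; apply/eqP/Ek; rewrite -n0.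
  exact: Wt_uniq Wk Wn.
- move=> u [[P1 _] P2]; have [L1 H1] := Palg_degs_fin P1.
  have [L2 H2] := Palg_degs_fin P2; exists (L1 ++ L2) => -[[|] t] n s Wn; rewrite mem_cat.
    by rewrite (H2 _ _ s Wn) orbT.
  by rewrite (H1 _ _ s Wn).
- move=> P [f g] P0 [/= Pf Pg].
  have [a [b [Pa Pb -> Ha Hb]]] := Po_split P0 Pf.
  have [a' [b' [Pa' Pb' -> Ha' Hb']]] := Palg_split P Pg.
  exists (a, a'), (b, b'); split=> //.
    by move=> [[|] t] n; [apply: Ha' | apply: Ha].
  by move=> [[|] t] n; [apply: Hb' | apply: Hb].
- move=> n; exists (VV K n, hz K), (false, Lk n 0); split.
  + by split; [apply: VV_Po | apply: (gen_0 (A := Halg K))].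
  + by rewrite /jsupp /hsupp /= VV_Lk oner_neq0.
  + have [_ h] := VV_Palg K n; move=> [[|] t] k; last exact: h.
    by rewrite /jsupp /hsupp /= eqxx.
Qed.

(** * The Jordan superalgebra built on Q *)

Definition kidx := option (bool * (mono * mono)).

(** [None] is the index of 1bar, and [Some (b, e)] the entry e of the barred or unbarred operator.
    The multiple of 1 has no index because it is 0 on [Ko]. *)
Definition ksupp (u : Kcar K) (i : kidx) : Prop :=
  let: (l, x, m, y) := u in
  match i with
  | None => m != 0
  | Some (b, e) => esupp (if b then y else x) e
  end.
Definition kW (i : kidx) (n : nat -> nat) : Prop :=
  if i is Some (_, e) then We mct e n else forall j, n j = 0%N.
Definition kbar (i : kidx) : bool := if i is Some (b, _) then b else true.
Definition kunit (i : kidx) : bool := if i is Some _ then false else true.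

Lemma escale0_supp (M : End K) e : ~ esupp (escale 0 M) e.
Proof.
have -> : escale 0 M = @ez K by apply: functional_extensionality => f; exact: scale0r.
exact: oz_supp.
Qed.

Lemma escale_supp_neq0 (c : K) (M : End K) e : esupp (escale c M) e -> c != 0 /\ esupp M e.
Proof.
move=> s; split; last exact: (oscale_supp s).
by apply/eqP => c0; rewrite c0 in s; apply: escale0_supp s.
Qed.

Lemma eflip_supp (M : End K) e : islin M -> esupp (eflip M) e -> esupp M e.
Proof.
move=> lM s; case: (oadd_supp s) => {}s.
  exact: (ope_supp (par := mpar) lM s).
exact: (opo_supp (par := mpar) lM (oopp_supp s)).
Qed.

Lemma We_add0 e n1 n2 : We mct e n1 -> (forall j, n2 j = 0%N) ->
  We mct e (fun j => n1 j + n2 j)%N.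
Proof.
move=> W1 E; suff -> : (fun j => n1 j + n2 j)%N = n1 by [].
by apply: functional_extensionality => j; rewrite E addn0.
Qed.

Lemma We_0add e n1 n2 : (forall j, n1 j = 0%N) -> We mct e n2 ->
  We mct e (fun j => n1 j + n2 j)%N.
Proof.
move=> E W2; suff -> : (fun j => n1 j + n2 j)%N = n2 by [].
by apply: functional_extensionality => j; rewrite E.
Qed.

Lemma kprod_supp u w i : Ko K u -> Ko K w -> ksupp (kprod u w) i ->
  exists i1 i2, [/\ ksupp u i1, ksupp w i2 & kcompose kW kbar kunit i1 i2 i].
Proof.
case: u => [[[l x] m] y]; case: w => [[[l' x'] m'] y'] [-> Qx Qy] [-> Qx' Qy'].
case: i => [[[|] e]|] /= s; last by rewrite !mul0r addr0 eqxx in s.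
  (* The coefficients of 1 have been replaced by 0, so the terms scaled by them have empty
     support. *)
  case: (oadd_supp s) => [{}s | {}s].
    by case: (oadd_supp s) => [{}s | {}s]; case: (escale0_supp s).
  case: (oadd_supp s) => [{}s | {}s].
    have [m0 sx] := escale_supp_neq0 s.
    exists (Some (false, e)), None; split=> //; split=> //.
    by move=> n1 n2; apply: We_add0.
  have [m0 sx] := escale_supp_neq0 s.
  exists None, (Some (false, e)); split=> //; first exact: eflip_supp (Q_lin Qx') sx.
  by split=> //; move=> n1 n2; apply: We_0add.
case: (oadd_supp s) => [{}s | {}s].
  by case: (oadd_supp s) => [{}s | {}s]; case: (escale0_supp s).
have [e1 [e2 [s1 s2 w]]] := obr_Wadd (par := mpar) mct (Q_lin Qy) (Q_lin Qy') s.
by exists (Some (true, e1)), (Some (true, e2)).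
Qed.

Lemma kprod_Ko u w : Ko K u -> Ko K w -> Ko K (kprod u w).
Proof.
case: u => [[[l x] m] y]; case: w => [[[l' x'] m'] y'] [l0 Qx Qy] [l0' Qx' Qy'] /=.
have add M N : Qalg K M -> Qalg K N -> Qalg K (eadd M N).
  exact: (gen_add (A := LieEnd K)).
have sc c M : Qalg K M -> Qalg K (escale c M).
  exact: (gen_scale (A := LieEnd K)).
have br M N : Qalg K M -> Qalg K N -> Qalg K (ebr M N).
  by apply: (gen_op (A := LieEnd K)); left.
have fl M : Qalg K M -> Qalg K (eflip M).
  move=> QM; have -> : eflip M = eadd (epe M) (escale (-1) (epo M)).
    apply: functional_extensionality => f; rewrite /eflip /eadd; congr (_ + _).
    by apply: esym; exact: scaleN1r.
  by apply: add; [exact: (gen_pe (A := LieEnd K)) | apply: sc; exact: (gen_po (A := LieEnd K))].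
split; first by rewrite l0 mul0r.
  apply: (add _ _ (add _ _ (sc _ _ Qx') (sc _ _ Qx)) (br _ _ Qy Qy')).
apply: (add _ _ (add _ _ (sc _ _ Qy') (sc _ _ Qy))).
exact: (add _ _ (sc _ _ Qx) (sc _ _ (fl _ Qx'))).
Qed.

Lemma Ko_subalg : is_subalg (A := Kalg K) (Ko K).
Proof.
have [A0 AD AZ Ap _] := gen_subalg (A := LieEnd K) [:: @v K 0; @v K 1; @v K 2].
split.
- by split.
- move=> [[[l x] m] y] [[[l' x'] m'] y'] [-> Qx Qy] [-> Qx' Qy'].
  by split; [exact: addr0 | exact: AD | exact: AD].
- move=> c [[[l x] m] y] [-> Qx Qy].
  by split; [exact: mulr0 | exact: AZ | exact: AZ].
- move=> [[[l x] m] y] [-> /Ap[Qxe Qxo] /Ap[Qye Qyo]].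
  exact: (conj (And3 erefl Qxe Qyo) (And3 erefl Qxo Qye)).
- split; first by move=> f u w [<- | //]; apply: kprod_Ko.
  by move=> u Ku _; apply: kprod_Ko.
Qed.

Lemma kW_adm i n : kW i n -> admissible n.
Proof.
case: i => [[b e] | H]; first exact: We_adm.
by exists (fun=> 0%N), (fun=> 0%N); split=> // -[|j]; rewrite !H.
Qed.

Lemma kW_uniq i n n' : kW i n -> kW i n' -> tri n = tri n'.
Proof.
case: i => [[b e] | H H']; first exact: We_uniq.
by rewrite /tri !H !H'.
Qed.

Lemma Ko_graded : graded (A := Kalg K) (Ko K) ksupp kW (kcompose kW kbar kunit).
Proof.
split.
- exact: Ko_subalg.
- move=> [[[|] e] | ] /=; [exact: oz_supp | exact: oz_supp | by rewrite eqxx].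
- move=> [[[l x] m] y] [-> Qx Qy] H; congr (_, _, _, _).
  + by apply: (supp_eq0 (Q_lin Qx)) => e; exact: (H (Some (false, e))).
  + by apply/eqP/negPn/negP; exact: (H None).
  + by apply: (supp_eq0 (Q_lin Qy)) => e; exact: (H (Some (true, e))).
- move=> [[[l x] m] y] [[[l' x'] m'] y'] [[[|] e] | ] _ _ /=; try exact: oadd_supp.
  by case: (eqVneq m 0) => [-> | _]; [rewrite add0r; right | left].
- move=> c [[[l x] m] y] [[[|] e] | ] _ /=; try exact: oscale_supp.
  by rewrite mulf_eq0 negb_or => /andP[].
- move=> [[[l x] m] y] [[[|] e] | ] [_ Qx Qy] /=; last by rewrite eqxx.
    exact: (opo_supp (par := mpar) (Q_lin Qy)).
  exact: (ope_supp (par := mpar) (Q_lin Qx)).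
- move=> [[[l x] m] y] [[[|] e] | ] [_ Qx Qy] //=.
    exact: (ope_supp (par := mpar) (Q_lin Qy)).
  exact: (opo_supp (par := mpar) (Q_lin Qx)).
- by move=> f u w i [<- | //]; apply: kprod_supp.
- by move=> u i Ku _; apply: kprod_supp.
- by move=> i1 i2 i [].
- move=> [[[l x] m] y] [[[|] e] | ] [_ Qx Qy] s; last by exists (fun=> 0%N).
    by have [n [Wn _]] := Q_W Qy s; exists n.
  by have [n [Wn _]] := Q_W Qx s; exists n.
- exact: kW_adm.
- exact: kW_uniq.
Qed.

Theorem Ko_continuum : continuum_ln_decompositions (A := Kalg K) (Ko K).
Proof.
apply: (graded_continuum Ko_graded).
- by case.
- by case=> // n _ H; rewrite /tri !H.
- move=> [[[l x] m] y] [[b e] | //] n [_ Qx Qy] s Wn n0.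
  have [k [Wk []]] : exists k, We mct e k /\ tri k <> t0.
    by case: b s {Wn} => s; [apply: Q_W Qy s | apply: Q_W Qx s].
  by rewrite -n0; apply: We_uniq Wk Wn.
- move=> [[[l x] m] y] [_ Qx Qy]; have [L1 H1] := Q_degs_fin Qx.
  have [L2 H2] := Q_degs_fin Qy; exists (t0 :: L1 ++ L2) => -[[[|] e] | ] n s Wn.
  + by rewrite inE mem_cat (H2 _ _ s Wn) !orbT.
  + by rewrite inE mem_cat (H1 _ _ s Wn) orbT.
  + by rewrite /tri !Wn inE eqxx.
- move=> P [[[l x] m] y] P0 [-> Qx Qy].
  have [a [b [Qa Qb -> Ha Hb]]] := Q_split P Qx.
  have [a' [b' [Qa' Qb' -> Ha' Hb']]] := Q_split P Qy.
  (* 1bar has degree 0, which is on the false side, so its coefficient m goes to the second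
     summand. *)
  exists (0, a, 0, a'), (0, b, m, b'); split=> //.
  + by rewrite /= !add0r.
  + by move=> [[[|] e] | ] n /=; [apply: Ha' | apply: Ha | rewrite eqxx].
  + move=> [[[|] e] | ] n /=; [exact: Hb' | exact: Hb |].
    by move=> _ H; rewrite /tri !H.
- move=> n; have [Qn hn] := v_Q K n; have [e En] := v_esupp K n.
  exists (0, @v K n, 0, @ez K), (Some (false, e)); split=> //.
    by split=> //; exact: (gen_0 (A := LieEnd K)).
  move=> [[[|] e'] | ] k /=; [by move/oz_supp | exact: hn | by rewrite eqxx].
Qed.

End KantorDouble.

Local Open Scope ring_scope.

Theorem theorem14p2 (K : fieldType) :
  [/\ @continuum_ln_decompositions K (LieEnd K) (Qalg K),
      @continuum_ln_decompositions K (AssEnd K) (Aalg K),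
      @continuum_ln_decompositions K (Halg K) (Po K) &
      ((2%:R : K) != 0 ->
         @continuum_ln_decompositions K (Jalg K) (Jo K) /\
         @continuum_ln_decompositions K (Kalg K) (Ko K))].
Proof.
split.
- exact: Qalg_continuum.
- exact: Aalg_continuum.
- exact: Po_continuum.
- by move=> _; split; [exact: Jo_continuum | exact: Ko_continuum].
Qed.
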